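(* Let $\Omega=\Omega_0\times(0,T)$, the operators $A$, $D$, the spaces $W$, $\mathcal V$, $\mathcal V^*$, $V$, $V^*$, and the mesh $\Omega_h$ with the associated $A_h$, $W_h$, $D_h$, $Q$, $b(\cdot,\cdot)$ be as defined in the context. Suppose that $\mathcal V$ is dense in $V$ and $\mathcal V^*$ is dense in $V^*$ (with respect to the norm $\|\cdot\|_W$). Then $$V={}^\perp D(V^* )\qquad\text{and}\qquad A:V\to L^2(\Omega)^{d+1}\ \text{is a bijection.}$$ Consequently, the following broken weak formulation is well posed: given any $F\in W_h'$, find $u\in L^2(\Omega)^{d+1}$ and $\lambda\in Q$ such that $$b((u,\lambda),w)=F(w)\qquad\text{for all } w\in W_h .$$ (Well posed means: for every $F\in W_h'$ there is exactly one solution $(u,\lambda)\in L^2(\Omega)^{d+1}\times Q$, and it depends continuously on $F$, i.e. there is a constant $C$ independent of $F$ with $\|u\|+\|\lambda\|_Q\le C\|F\|_{W_h'}$.)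
   Context: Domain. $d\ge 1$; $\Omega_0\subset\mathbb R^d$ is a bounded domain with Lipschitz boundary, $T>0$, $c>0$ is a constant, and $\Omega=\Omega_0\times(0,T)\subset\mathbb R^{d+1}$ with points $(x,t)$. All functions are real-valued. $(\cdot,\cdot)=(\cdot,\cdot)_\Omega$ and $\|\cdot\|$ are the inner product and norm of $L^2(\Omega)^{d+1}$. Vector functions $u$ with $d+1$ components are partitioned as $u=(u_q,u_\mu)$, with $u_q$ having $d$ components and $u_\mu$ scalar. $\mathcal D(\Omega)$ denotes smooth compactly supported functions in $\Omega$, $\mathcal D'(\Omega)$ the distributions, and $\mathcal D(\bar\Omega)$ the functions on $\bar\Omega$ that are smooth up to the boundary (restrictions of smooth compactly supported functions on $\mathbb R^{d+1}$). Wave operator. On any open set $K\subset\Omega$, $A$ is the distributional operator $$Au=\begin{pmatrix}\partial_t u_q-c\,\nabla_x u_\mu\\ \partial_t u_\mu-c\,\mathrm{div}_x u_q\end{pmatrix},\qquad u\in L^2(K)^{d+1}.$$ $W(K)=\{u\in L^2(K)^{d+1}: Au\in L^2(K)^{d+1}\}$, $W=W(\Omega)$, with graph norm $\|u\|_W=(\|u\|^2+\|Au\|^2)^{1/2}$ (a Hilbert space). $D:W\to W'$ is defined by $\langle Du,v\rangle_W=(Au,v)+(u,Av)$ for $u,v\in W$, where $W'$ is the dual of $W$. For $S\subset W'$, the right annihilator is ${}^\perp S=\{w\in W:\langle s',w\rangle_W=0\ \text{for all } s'\in S\}$. Boundary parts: $\Gamma_0=\Omega_0\times\{0\}$, $\Gamma_T=\Omega_0\times\{T\}$,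 $\Gamma_b=\partial\Omega_0\times[0,T]$. Put $$\mathcal V=\{u\in\mathcal D(\bar\Omega)^{d+1}: u|_{\Gamma_0}=0,\ u_\mu|_{\Gamma_b}=0\},\qquad \mathcal V^*=\{v\in\mathcal D(\bar\Omega)^{d+1}: v|_{\Gamma_T}=0,\ v_\mu|_{\Gamma_b}=0\}.$$ $V=\{u\in W:\langle Du,v\rangle_W=0\ \text{for all } v\in\mathcal V^*\}$, with the topology of $W$. Regard $A$ as an unbounded operator in $L^2(\Omega)^{d+1}$ with domain $\mathrm{dom}(A)=V$; it is densely defined, and its Hilbert space adjoint $A^*$ acts as the distributional operator $-A$ on $\mathrm{dom}(A^* )=\{\tilde w\in L^2(\Omega)^{d+1}:\exists\,\ell\in L^2(\Omega)^{d+1}\text{ with }(Au,\tilde w)=(u,\ell)\ \forall u\in\mathrm{dom}(A)\}\subset W$. $V^*$ denotes $\mathrm{dom}(A^* )$ with the topology of $W$; equivalently $V^*={}^\perp D(V)$. One has $\mathcal V\subset V$ and $\mathcal V^*\subset V^*$. Broken spaces. $\Omega_h$ is a partition of $\Omega$ into finitely many pairwise disjoint open elements $K$ with Lipschitz boundaries (e.g. $(d+1)$-simplices or $(d+1)$-dimensional hyperrectangles) with $\bar\Omega=\bigcup_{K\in\Omega_h}\bar K$. $A_h$ is the wave operator applied element by element: $(A_hw)|_K=A(w|_K)$. $W_h=\{w\in L^2(\Omega)^{d+1}:A_hw\in L^2(\Omega)^{d+1}\}$ with norm $\|w\|_{W_h}=(\|w\|^2+\|A_hw\|^2)^{1/2}$,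 and $W_h'$ is its dual. $D_h:W_h\to W_h'$ is $\langle D_hw,v\rangle_h=(A_hw,v)+(w,A_hv)$ for $w,v\in W_h$. $D_{h,V}=D_h|_V:V\to W_h'$, and $Q=\mathrm{ran}(D_{h,V})$ with the quotient norm $\|\rho\|_Q=\inf\{\|v\|_W: v\in V,\ D_hv=\rho\}$. The bilinear form on $(L^2(\Omega)^{d+1}\times Q)\times W_h$ is $$b((v,\rho),w)=-(v,A_hw)_\Omega+\langle\rho,w\rangle_h .$$ *)

(* Defs.v *)
From HB Require Import structures.
From mathcomp Require Import all_boot all_order all_algebra.
From mathcomp Require Import all_classical all_reals all_analysis.

Set Implicit Arguments.
Unset Strict Implicit.
Unset Printing Implicit Defensive.
Import Order.TTheory GRing.Theory Num.Theory.
Import numFieldNormedType.Exports.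
Local Open Scope classical_set_scope.
Local Open Scope ring_scope.

(* The points of R^(n+1) are written (x, t), with t the last coordinate. *)
Definition pt (R : Type) (n : nat) (x : 'rV[R]_n) (t : R) : 'rV[R]_n.+1 :=
  \row_i (if unlift ord_max i is Some j then x 0 j else t).

Definition xpart (R : Type) (n : nat) (z : 'rV[R]_n.+1) : 'rV[R]_n :=
  \row_j z 0 (lift ord_max j).

Definition tpart (R : Type) (n : nat) (z : 'rV[R]_n.+1) : R := z 0 ord_max.

(* Lebesgue measure on the Borel sets of R^n, as the n-fold product of the
   one-dimensional one. *)
Definition rV_display : measure_display.
Proof. exact: default_measure_display. Qed.

Section rV_measurable.
Variables (R : realType) (n : nat).

Definition rV_coord (i : 'I_n) (x : 'rV[R]_n) : measurableTypeR R := x 0 i.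

Let rV_set0 : g_sigma_preimage rV_coord set0.
Proof. exact: sigma_algebra0. Qed.

Let rV_setC A : g_sigma_preimage rV_coord A -> g_sigma_preimage rV_coord (~` A).
Proof. exact: sigma_algebraC. Qed.

Let rV_bigcup (F : _^nat) : (forall i, g_sigma_preimage rV_coord (F i)) ->
  g_sigma_preimage rV_coord (\bigcup_i F i).
Proof. exact: sigma_algebra_bigcup. Qed.

HB.instance Definition _ := @isMeasurable.Build rV_display
  'rV[R]_n (g_sigma_preimage rV_coord) rV_set0 rV_setC rV_bigcup.

End rV_measurable.

Fixpoint leb (R : realType) (n : nat) : set 'rV[R]_n -> \bar R :=
  match n return set 'rV[R]_n -> \bar R with
  | 0%N => \d_(0 : 'rV[R]_0)
  | m.+1 => pushforward (@leb R m \x @lebesgue_measure R)%E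
              (fun p => pt p.1 p.2)
  end.
Arguments leb : clear implicits.

Section leb_measure.
Variable R : realType.

Lemma measurable_rV_coord n (i : 'I_n) :
  measurable_fun [set: 'rV[R]_n] (@rV_coord R n i).
Proof.
move=> _ Y mY; rewrite setTI; apply: sub_sigma_algebra => /=.
rewrite -bigcup_seq/=; exists i => /=; first by rewrite mem_index_enum.
by exists Y => //; rewrite setTI.
Qed.

Lemma measurable_fun_rV d (T : measurableType d) n (f : T -> 'rV[R]_n) :
  (forall i, measurable_fun [set: T] (@rV_coord R n i \o f)) ->
  measurable_fun [set: T] f.
Proof.
move=> mf; suff H : g_sigma_preimage (fun i => @rV_coord R n i \o f) `<=` measurable.
  move=> _ A mA; apply: H.
  by rewrite g_sigma_preimage_comp; exists A.
apply: smallest_sub; first exact: sigma_algebra_measurable.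
move=> A; rewrite -bigcup_seq => -[i _ [B mB <-]]; exact: mf.
Qed.

Lemma measurable_pt n : measurable_fun
  [set: 'rV[R]_n * measurableTypeR R] (fun p => pt p.1 p.2).
Proof.
apply: measurable_fun_rV => i.
case: (unliftP ord_max i) => [j ij|ij].
  rewrite (_ : _ \o _ = @rV_coord R n j \o fst).
    by apply: measurableT_comp => //; exact: measurable_rV_coord.
  by apply/funext => p /=; rewrite /rV_coord mxE ij liftK.
rewrite (_ : _ \o _ = snd) //.
by apply/funext => p /=; rewrite /rV_coord mxE ij unlift_none.
Qed.

Lemma measurable_xpart n : measurable_fun [set: 'rV[R]_n.+1] (@xpart R n).
Proof.
apply: measurable_fun_rV => i.
rewrite (_ : _ \o _ = @rV_coord R n.+1 (lift ord_max i)).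
  exact: measurable_rV_coord.
by apply/funext => z /=; rewrite /rV_coord mxE.
Qed.

Lemma ptK n (x : 'rV[R]_n) (t : R) : xpart (pt x t) = x.
Proof. by apply/rowP => i; rewrite !mxE liftK. Qed.

Lemma ptKt n (x : 'rV[R]_n) (t : R) : tpart (pt x t) = t.
Proof. by rewrite /tpart mxE unlift_none. Qed.

Lemma sigma_finite_product d1 d2 (T1 : measurableType d1)
    (T2 : measurableType d2) (m1 : {sigma_finite_measure set T1 -> \bar R})
    (m2 : {sigma_finite_measure set T2 -> \bar R}) :
  sigma_finite setT (m1 \x m2)%E.
Proof.
have /sigma_finiteP[F [TF ndF Foo]] := sigma_finiteT m1.
have /sigma_finiteP[G [TG ndG Goo]] := sigma_finiteT m2.
exists (fun k => F k `*` G k).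
  rewrite -setXTT TF TG predeqE => -[x y]; split.
    move=> [/= [k _ Fkx] [l _ Gly]]; exists (maxn k l) => //; split.
    - by move: x Fkx; exact/subsetPset/ndF/leq_maxl.
    - by move: y Gly; exact/subsetPset/ndG/leq_maxr.
  by move=> [k _ []/= ? ?]; split; exists k.
move=> k; have [? ?] := Foo k; have [? ?] := Goo k.
split; first exact: measurableX.
by rewrite product_measure1E// lte_mul_pinfty// ge0_fin_numE.
Qed.

Section leb_step.
Variables (n : nat) (m : {sigma_finite_measure set 'rV[R]_n -> \bar R}).

Definition leb_step : set 'rV[R]_n.+1 -> \bar R :=
  pushforward (m \x @lebesgue_measure R)%E (fun p => pt p.1 p.2).

Let measurable_pre A : measurable A -> measurable
  ((fun p : 'rV[R]_n * measurableTypeR R => pt p.1 p.2) @^-1` A).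
Proof. by move=> mA; rewrite -[X in measurable X]setTI; exact: measurable_pt. Qed.

Let leb_step0 : leb_step set0 = 0%E.
Proof. by rewrite /leb_step /pushforward preimage_set0 measure0. Qed.

Let leb_step_ge0 A : (0 <= leb_step A)%E.
Proof. rewrite /leb_step /pushforward; exact: (measure_ge0 (m \x @lebesgue_measure R)%E). Qed.

Let leb_step_sigma_additive : semi_sigma_additive leb_step.
Proof.
move=> F mF tF mUF; rewrite /leb_step /pushforward preimage_bigcup.
apply: measure_semi_sigma_additive.
- by move=> k; exact: measurable_pre.
- apply/trivIsetP => /= i j _ _ ij; rewrite -preimage_setI.
  by move/trivIsetP : tF => /(_ _ _ _ _ ij) ->//; rewrite preimage_set0.
- by rewrite -preimage_bigcup; exact: measurable_pre.
Qed.

HB.instance Definition _ := isMeasure.Build _ _ _ leb_step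
  leb_step0 leb_step_ge0 leb_step_sigma_additive.

Let leb_step_sigma_finite : sigma_finite setT leb_step.
Proof.
have [F TF Foo] := sigma_finite_product m (@lebesgue_measure R).
pose g (z : 'rV[R]_n.+1) : 'rV[R]_n * measurableTypeR R := (xpart z, tpart z).
have gK : forall A, (fun p => pt p.1 p.2) @^-1` (g @^-1` A) = A.
  by move=> A; rewrite predeqE => -[x t]; rewrite /preimage /mkset/= /g/= ptK ptKt.
exists (fun k => g @^-1` F k).
  by rewrite -preimage_bigcup -TF preimage_setT.
move=> k; have [mFk Fkoo] := Foo k; split.
  rewrite -[X in measurable X]setTI; apply: measurable_fun_pair => //.
    exact: measurable_xpart.
  exact: (measurable_rV_coord ord_max).
by rewrite /leb_step /pushforward gK.
Qed.

HB.instance Definition _ := Measure_isSigmaFinite.Build _ _ _ leb_step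
  leb_step_sigma_finite.

End leb_step.

Lemma leb_sigma_finite_measure n :
  {m : {sigma_finite_measure set 'rV[R]_n -> \bar R} |
    leb R n = m :> (set 'rV[R]_n -> \bar R)}.
Proof.
elim: n => [|n [m mE]]; first by exists (\d_(0 : 'rV[R]_0)).
by exists (leb_step m); rewrite /= mE.
Qed.

Section leb_instances.
Variable n : nat.

Let leb0 : leb R n set0 = 0%E.
Proof. by have [m ->] := leb_sigma_finite_measure n; exact: measure0. Qed.

Let leb_ge0 A : (0 <= leb R n A)%E.
Proof. by have [m ->] := leb_sigma_finite_measure n; exact: measure_ge0. Qed.

Let leb_sigma_additive : semi_sigma_additive (leb R n).
Proof.
have [m ->] := leb_sigma_finite_measure n.
exact: measure_semi_sigma_additive.
Qed.

HB.instance Definition _ := isMeasure.Build _ _ _ (leb R n)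
  leb0 leb_ge0 leb_sigma_additive.

Let leb_sigma_finite : sigma_finite setT (leb R n).
Proof. by have [m ->] := leb_sigma_finite_measure n; exact: sigma_finiteT. Qed.

HB.instance Definition _ := Measure_isSigmaFinite.Build _ _ _ (leb R n)
  leb_sigma_finite.

End leb_instances.

End leb_measure.

Definition boundary (X : topologicalType) (A : set X) : set X :=
  closure A `\` interior A.

Definition dotv (R : realType) (n : nat) (x y : 'rV[R]_n) : R :=
  \sum_i x 0 i * y 0 i.

(* Near each boundary point, A is the strict subgraph, in some unit direction
   e, of a Lipschitz function phi of the component of y orthogonal to e. *)
Definition lipschitz_boundary (R : realType) (n : nat) (A : set 'rV[R]_n) :=
  forall z, boundary A z ->
    exists (e : 'rV[R]_n) (phi : 'rV[R]_n -> R) (U : set 'rV[R]_n),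
      [/\ dotv e e = 1, lipschitz phi, open_nbhs z U &
          forall y, U y -> (A y <-> dotv y e < phi (y - dotv y e *: e))].

Section functions.
Variables (R : realType) (n : nat).
Local Notation E := 'rV[R]_n.

Definition partial (i : 'I_n) (f : E -> R) : E -> R := 'D_(delta_mx 0 i) f.

Definition iter_partial (s : seq 'I_n) (f : E -> R) : E -> R :=
  foldr partial f s.

Definition smooth (f : E -> R) := forall s : seq 'I_n,
  continuous (iter_partial s f) /\
  forall i z, derivable (iter_partial s f) z (delta_mx 0 i).

Definition supp (f : E -> R) : set E := closure [set z | f z != 0].

(* The space D(K). *)
Definition test_fun (K : set E) : set (E -> R) :=
  [set phi | [/\ smooth phi, compact (supp phi) & supp phi `<=` K]].

(* The pairing of the distribution d_i g on K with phi, for g in L^2(K). *)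
Definition dpartial (K : set E) (g : E -> R) (i : 'I_n) (phi : E -> R) : R :=
  - \int[leb R n]_(z in K) (g z * partial i phi z).

(* Elements of L^2(K)^m are represented by functions on the whole space of
   which only the values on K matter, and are compared with eqL2. *)
Variable m : nat.
Implicit Types u v : E -> 'rV[R]_m.

Definition component u (i : 'I_m) : E -> R := fun z => u z 0 i.

Definition L2 (K : set E) : set (E -> 'rV[R]_m) :=
  [set u | forall i, (component u i) \_ K \in Lfun (leb R n) 2%:E].

Definition eqL2 (K : set E) u v := u = v %[ae leb R n in K].

Definition ip (K : set E) u v : R :=
  \sum_i \int[leb R n]_(z in K) (component u i z * component v i z).

Definition normL2 (K : set E) u : R := Num.sqrt (ip K u u).

End functions.

Section duality.
Variables (R : realType) (U : lmodType R).
Implicit Types (X S : set U) (N : U -> R) (F G : U -> R).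

(* Members of the dual of a subspace X of U, normed by N, are represented by
   functions on U of which only the values on X matter. *)
Definition eq_dual X F G := forall w, X w -> F w = G w.

Definition dual X N : set (U -> R) :=
  [set F | (forall a w1 w2, X w1 -> X w2 ->
              F (a *: w1 + w2) = a * F w1 + F w2) /\
           exists M, forall w, X w -> `|F w| <= M * N w].

Definition dual_norm X N F : R :=
  sup [set `|F w| | w in [set w | X w /\ N w <= 1]].

Definition right_annihilator X (S : set (U -> R)) : set U :=
  [set w | X w /\ forall s, S s -> s w = 0].

Definition dense_in S X N :=
  forall u, X u -> forall eps, 0 < eps -> exists2 v, S v & N (u - v) < eps.

End duality.

Section wave.
Variables (R : realType) (d : nat) (c : R).
Local Notation E := 'rV[R]_d.+1.
Local Notation vec := (E -> 'rV[R]_d.+1).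
Implicit Types (K : set E) (u v w f : vec).

(* u = (u_q, u_mu) is split like (x, t). *)
Definition qidx (j : 'I_d) : 'I_d.+1 := lift ord_max j.
Definition tidx : 'I_d.+1 := ord_max.
Definition qcomp u (j : 'I_d) : E -> R := component u (qidx j).
Definition mucomp u : E -> R := component u tidx.

(* Au = f in the sense of distributions on K. *)
Definition is_wave K u f := forall phi, test_fun K phi ->
  (forall j, dpartial K (qcomp u j) tidx phi
             - c * dpartial K (mucomp u) (qidx j) phi
             = \int[leb R d.+1]_(z in K) (qcomp f j z * phi z)) /\
  dpartial K (mucomp u) tidx phi
    - c * (\sum_j dpartial K (qcomp u j) (qidx j) phi)
    = \int[leb R d.+1]_(z in K) (mucomp f z * phi z).

Definition Wspace K : set vec :=
  [set u | L2 K u /\ exists2 f, L2 K f & is_wave K u f].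

(* For u in Wspace K, a representative of Au. *)
Definition Aop K u : vec := xget 0 [set f | L2 K f /\ is_wave K u f].

Definition normW K u : R := Num.sqrt (normL2 K u ^+ 2 + normL2 K (Aop K u) ^+ 2).

Definition Dop K u : vec -> R := fun v => ip K (Aop K u) v + ip K u (Aop K v).

End wave.

Section space_time.
Variables (R : realType) (d : nat) (Om0 : set 'rV[R]_d) (T c : R).
Local Notation E := 'rV[R]_d.+1.
Local Notation vec := (E -> 'rV[R]_d.+1).
Implicit Types (u v w f : vec).

Definition Omega : set E := [set z | Om0 (xpart z) /\ 0 < tpart z < T].
Definition Gamma0 : set E := [set z | Om0 (xpart z) /\ tpart z = 0].
Definition GammaT : set E := [set z | Om0 (xpart z) /\ tpart z = T].
Definition Gammab : set E :=
  [set z | boundary Om0 (xpart z) /\ 0 <= tpart z <= T].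

(* Its restrictions to the closure of Omega make up D(closure Omega)^(d+1). *)
Definition smooth_vec : set vec :=
  [set u | forall i, smooth (component u i) /\ compact (supp (component u i))].

Definition calV : set vec :=
  [set u | [/\ smooth_vec u, forall z, Gamma0 z -> u z = 0 &
               forall z, Gammab z -> mucomp u z = 0]].

Definition calVstar : set vec :=
  [set v | [/\ smooth_vec v, forall z, GammaT z -> v z = 0 &
               forall z, Gammab z -> mucomp v z = 0]].

Definition Vspace : set vec :=
  [set u | Wspace c Omega u /\ forall v, calVstar v -> Dop c Omega u v = 0].

(* dom(A^* ), for A with domain Vspace. *)
Definition Vstar : set vec :=
  [set w | L2 Omega w /\ exists2 l : vec, L2 Omega l &
     forall u, Vspace u -> ip Omega (Aop c Omega u) w = ip Omega u l].

Definition is_mesh (Oh : set (set E)) :=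
  [/\ finite_set Oh, trivIset Oh id,
      forall K, Oh K ->
        [/\ open K, K !=set0, K `<=` Omega & lipschitz_boundary K] &
      closure Omega = \bigcup_(K in Oh) closure K].

Variable Oh : set (set E).

Definition is_wave_h w f := forall K, Oh K -> is_wave c K w f.

Definition Wh : set vec :=
  [set w | L2 Omega w /\ exists2 f, L2 Omega f & is_wave_h w f].

(* For w in Wh, a representative of A_h w. *)
Definition Ah w : vec := xget 0 [set f | L2 Omega f /\ is_wave_h w f].

Definition normWh w : R :=
  Num.sqrt (normL2 Omega w ^+ 2 + normL2 Omega (Ah w) ^+ 2).

Definition Dh w : vec -> R := fun v => ip Omega (Ah w) v + ip Omega w (Ah v).

Definition Qspace : set (vec -> R) :=
  [set rho | exists2 v, Vspace v & eq_dual Wh (Dh v) rho].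

Definition normQ (rho : vec -> R) : R :=
  inf [set normW c Omega v | v in [set v | Vspace v /\ eq_dual Wh (Dh v) rho]].

Definition bform (x : vec * (vec -> R)) w : R :=
  - ip Omega x.1 (Ah w) + x.2 w.

Definition solution (F : vec -> R) (u : vec) (lam : vec -> R) :=
  [/\ L2 Omega u, Qspace lam & forall w, Wh w -> bform (u, lam) w = F w].

End space_time.

(* Main.v *)
Require Import Defs.
From mathcomp Require Import all_boot all_order all_algebra.
From mathcomp Require Import all_classical all_reals all_analysis.
From mathcomp Require Import measurable_realfun ring lra.
Import Order.TTheory GRing.Theory Num.Theory.
Import numFieldNormedType.Exports.
Local Open Scope classical_set_scope.
Local Open Scope ring_scope.

(* A coercivity estimate ||v|| <= C ||A v|| holds on the smooth spaces calV and
   calVstar: multiply A v by (T - t) v, resp. t v, and integrate by parts, all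
   boundary terms being zero. By the density assumptions it extends to V and
   V^*, whence A is injective on V, and a functional (f, .) is represented on
   V^* as (A w, A .), so that u = A w solves A u = f and lies in V.

   For the broken problem, let r represent F in the Hilbert space W_h and let
   p in V solve A p = r; then u = p - A_h r and lambda = D_h p solve it.
   Conversely, testing a solution of the homogeneous problem with V^* puts u in
   V with A u = 0, so u = 0.

   A u = f is handled through the pairing (u, A psi) = - (f, psi) with test
   vectors psi; restricting psi to those supported in a single element gives
   A_h, and these still determine f since the skeleton of the mesh, being
   locally a union of Lipschitz graphs, is a null set. *)

(** * Semi-inner product spaces *)

(** Nothing is quotiented by a.e. equality: vectors are functions, and [Aop] and [Ah] choose
    arbitrary representatives of an image. The Hilbert space arguments are therefore run with
    semi-inner products on a subset of a vector space; a null difference replaces equality, and an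
    operator is linear only up to null vectors.

    These arguments know the wave operator only through pairings with test vectors, the totality of
    those vectors and the energy estimate. Its formal adjoint is its opposite, so one [Acl] serves
    both the operator and its adjoint, and test vectors lie in [V] as well as in [V*]. This gives a
    weak image to the elements of [V*], which are defined by a mere adjoint relation.

    Coercivity has two uses: on [V] it gives injectivity, on [V*] it makes the form (A ., A .)
    complete, so that the Riesz theorem yields surjectivity on [V]. The energy constant is 4 T^2;
    passing to the closure multiplies it by 4. *)

Section semi_hilbert.
Context {R : realType} {U : lmodType R}.
Implicit Types (X : set U) (B : U -> U -> R) (s t : nat -> U) (u v w : U).

Definition subspace X := X 0 /\ forall a u v, X u -> X v -> X (a *: u + v).

Definition semi_inner X B :=
  [/\ subspace X, forall u v, X u -> X v -> B u v = B v u,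
      forall a u v w, X u -> X v -> X w -> B (a *: u + v) w = a * B u w + B v w &
      forall u, X u -> 0 <= B u u].

Definition converges_in B s u := forall eps, 0 < eps ->
  exists N, forall n, (N <= n)%N -> B (s n - u) (s n - u) < eps.

Definition cauchy_in B s := forall eps, 0 < eps ->
  exists N, forall m n, (N <= m)%N -> (N <= n)%N ->
    B (s m - s n) (s m - s n) < eps.

Definition complete_in X B := forall s, (forall n, X (s n)) -> cauchy_in B s ->
  exists2 u, X u & converges_in B s u.

Lemma subspaceD X u v : subspace X -> X u -> X v -> X (u + v).
Proof. by move=> [_ XD] Xu Xv; rewrite -[u]scale1r; exact: XD. Qed.

Lemma subspaceZ X a u : subspace X -> X u -> X (a *: u).
Proof. by move=> [X0 XD] Xu; rewrite -[_ *: _]addr0; exact: XD. Qed.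

Lemma subspaceB X u v : subspace X -> X u -> X v -> X (u - v).
Proof. by move=> XX Xu Xv; rewrite -scaleN1r addrC; apply XX. Qed.

Section semi_inner.
Context {X : set U} {B : U -> U -> R} (XB : semi_inner X B).

Let XX : subspace X. Proof. by case: XB. Qed.
Let X0 : X 0. Proof. by case: XX. Qed.
Let XD u v : X u -> X v -> X (u + v). Proof. exact: subspaceD. Qed.
Let XZ a u : X u -> X (a *: u). Proof. exact: subspaceZ. Qed.

Lemma ipC u v : X u -> X v -> B u v = B v u. Proof. by case: XB => _ + _ _; exact. Qed.

Lemma ip_ge0 u : X u -> 0 <= B u u. Proof. by case: XB => _ _ _; exact. Qed.

Lemma ipDl u v w : X u -> X v -> X w -> B (u + v) w = B u w + B v w.
Proof.
by case: XB => _ _ BD _ Xu Xv Xw; rewrite -[u in LHS]scale1r BD// mul1r.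
Qed.

Lemma ip0l w : X w -> B 0 w = 0.
Proof. by move=> Xw; apply: (addIr (B 0 w)); rewrite -ipDl// addr0 add0r. Qed.

Lemma ipZl a u w : X u -> X w -> B (a *: u) w = a * B u w.
Proof.
by case: XB => _ _ BD _ Xu Xw; rewrite -[_ *: _]addr0 BD// ip0l// addr0.
Qed.

Lemma ipDr u v w : X u -> X v -> X w -> B w (u + v) = B w u + B w v.
Proof. by move=> *; rewrite ipC ?ipDl ?(ipC w)//; exact: XD. Qed.

Lemma ipZr a u w : X u -> X w -> B w (a *: u) = a * B w u.
Proof. by move=> *; rewrite ipC ?ipZl ?(ipC w)//; exact: XZ. Qed.

Lemma ipNl u w : X u -> X w -> B (- u) w = - B u w.
Proof. by move=> *; rewrite -scaleN1r ipZl// mulN1r. Qed.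

Lemma ipNr u w : X u -> X w -> B w (- u) = - B w u.
Proof. by move=> *; rewrite -scaleN1r ipZr// mulN1r. Qed.

Lemma ipBl u v w : X u -> X v -> X w -> B (u - v) w = B u w - B v w.
Proof. by move=> *; rewrite ipDl ?ipNl// -scaleN1r; exact: XZ. Qed.

Lemma ipBr u v w : X u -> X v -> X w -> B w (u - v) = B w u - B w v.
Proof. by move=> *; rewrite ipDr ?ipNr// -scaleN1r; exact: XZ. Qed.

Lemma ip0r w : X w -> B w 0 = 0.
Proof. by move=> Xw; rewrite ipC// ip0l. Qed.

Lemma ipBB u v : X u -> X v -> B (u - v) (u - v) = B u u - 2 * B u v + B v v.
Proof.
move=> Xu Xv; have Xuv : X (u - v) by exact: subspaceB.
by rewrite ipBl// !ipBr// (ipC v u)//; ring.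
Qed.

Lemma ipDD u v : X u -> X v -> B (u + v) (u + v) = B u u + 2 * B u v + B v v.
Proof.
move=> Xu Xv; have Xuv : X (u + v) by exact: XD.
by rewrite ipDl// !ipDr// (ipC v u)//; ring.
Qed.

Lemma ipBBC u v : X u -> X v -> B (u - v) (u - v) = B (v - u) (v - u).
Proof. by move=> Xu Xv; rewrite !ipBB// (ipC v u)//; ring. Qed.

Lemma cauchy_schwarz u v : X u -> X v -> B u v ^+ 2 <= B u u * B v v.
Proof.
move=> Xu Xv; have [v0|v0] := eqVneq (B v v) 0.
  have H a : 0 <= B u u - 2 * a * B u v.
    have := ip_ge0 _ (subspaceB _ _ (a *: v) XX Xu (XZ a _ Xv)).
    rewrite ipBB ?ipZr ?ipZl//; [|exact: XZ..].
    by rewrite v0 !mulr0 addr0 mulrA.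
  have [->|n0] := eqVneq (B u v) 0; first by rewrite v0 mulr0 expr0n.
  (* When [B v v = 0] the quadratic in [a] degenerates to an affine function that stays nonnegative;
     at this [a] it would equal -1 unless its slope is zero. *)
  have := H ((B u u + 1) / (2 * B u v)).
  have -> : 2 * ((B u u + 1) / (2 * B u v)) * B u v = B u u + 1 by field.
  lra.
have vp : 0 < B v v by rewrite lt_neqAle eq_sym v0 ip_ge0.
have := ip_ge0 _ (subspaceB _ _ ((B u v / B v v) *: v) XX Xu (XZ _ _ Xv)).
rewrite ipBB ?ipZr ?ipZl//; [|exact: XZ..].
have -> : B u u - 2 * (B u v / B v v * B u v) +
   B u v / B v v * (B u v / B v v * B v v) = B u u - B u v ^+ 2 / B v v by field.
by rewrite subr_ge0 ler_pdivrMr.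
Qed.

Lemma normr_ip u v : X u -> X v -> `|B u v| <= Num.sqrt (B u u) * Num.sqrt (B v v).
Proof.
move=> Xu Xv; rewrite -sqrtrM ?ip_ge0// -sqrtr_sqr ler_sqrt ?cauchy_schwarz//.
by rewrite mulr_ge0// ip_ge0.
Qed.

Lemma ip_null u v : X u -> X v -> B u u = 0 -> B u v = 0.
Proof.
move=> Xu Xv u0; have := cauchy_schwarz _ _ Xu Xv.
by rewrite u0 mul0r => H; apply/eqP; rewrite -sqrf_eq0 eq_le H sqr_ge0.
Qed.

Lemma ip_eq u u' v : X u -> X u' -> X v -> B (u - u') (u - u') = 0 -> B u v = B u' v.
Proof.
move=> Xu Xu' Xv u0; apply/eqP; rewrite -subr_eq0 -ipBl//.
by rewrite ip_null//; exact: subspaceB.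
Qed.

Lemma ip_triangle u v : X u -> X v ->
  B (u + v) (u + v) <= 2 * B u u + 2 * B v v.
Proof.
move=> Xu Xv; have := ip_ge0 _ (subspaceB _ _ _ XX Xu Xv).
by rewrite ipBB// ipDD//; lra.
Qed.

Lemma ip_null_trans u v w : X u -> X v -> X w -> B (u - v) (u - v) = 0 ->
  B (v - w) (v - w) = 0 -> B (u - w) (u - w) = 0.
Proof.
move=> Xu Xv Xw uv vw; have := ip_triangle (u - v) (v - w).
rewrite uv vw !mulr0 addr0 addrA subrK => H.
apply/eqP; rewrite eq_le ip_ge0 ?andbT; last exact: subspaceB.
by apply: H; exact: subspaceB.
Qed.

(** Pairing with a fixed vector is continuous, so an identity between two such pairings survives the
    limit. The closedness of the weak operator and that of the adjoint relation both rest on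
    this. *)
Lemma convergent_ip_eq s t u w x y : (forall n, X (s n)) -> (forall n, X (t n)) ->
  X u -> X w -> X x -> X y -> converges_in B s u -> converges_in B t w ->
  (forall n, B (s n) x = B (t n) y) -> B u x = B w y.
Proof.
move=> Xs Xt Xu Xw Xx Xy su tw sxty; apply/eqP; rewrite -subr_eq0 -sqrf_eq0.
rewrite eq_le sqr_ge0 andbT; apply/ler_addgt0Pr => e e0; rewrite add0r.
(* Cauchy-Schwarz and [(a - b)^2 <= 2 a^2 + 2 b^2] lead to the bound [(e / M) (M - 1)]; the [+ 1]
   keeps [M] positive when [x] and [y] are null. *)
pose M := 2 * (B x x + B y y) + 1.
have M0 : 0 < M by rewrite /M; have := ip_ge0 _ Xx; have := ip_ge0 _ Xy; lra.
have [N1 /(_ (maxn N1 _)) H1] := su _ (divr_gt0 e0 M0).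
have [N2 /(_ (maxn _ N2)) H2] := tw _ (divr_gt0 e0 M0).
have {}H1 := H1 N2 (leq_maxl _ _); have {}H2 := H2 N1 (leq_maxr _ _).
set n := maxn N1 N2 in H1 H2.
have -> : B u x - B w y = B (t n - w) y - B (s n - u) x.
  by rewrite !ipBl// sxty; ring.
have /= C1 := cauchy_schwarz _ _ (subspaceB _ _ _ XX (Xs n) Xu) Xx.
have /= C2 := cauchy_schwarz _ _ (subspaceB _ _ _ XX (Xt n) Xw) Xy.
have D1 : B (s n - u) (s n - u) * B x x <= e / M * B x x.
  by rewrite ler_wpM2r ?ip_ge0// ltW.
have D2 : B (t n - w) (t n - w) * B y y <= e / M * B y y.
  by rewrite ler_wpM2r ?ip_ge0// ltW.
have E1 : e / M * M = e by rewrite divfK// gt_eqF.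
have E2 : 0 < e / M by rewrite divr_gt0.
set a := B (t n - w) y in C2 *; set b := B (s n - u) x in C1 *.
have : (a - b) ^+ 2 <= 2 * a ^+ 2 + 2 * b ^+ 2.
  by have := sqr_ge0 (a + b); rewrite !expr2; lra.
move: E1; rewrite /M; lra.
Qed.

(* The representative minimizes [B w w - 2 F w]; by the parallelogram law a
   minimizing sequence is Cauchy. *)
Theorem riesz_representation (F : U -> R) : complete_in X B ->
  dual X (fun w => Num.sqrt (B w w)) F ->
  exists2 r, X r & forall w, X w -> F w = B r w.
Proof.
move=> cX [FD [M FM]].
have FDD u v : X u -> X v -> F (u + v) = F u + F v.
  by move=> Xu Xv; rewrite -[u in LHS]scale1r FD// mul1r.
have F0 : F 0 = 0 by apply: (addIr (F 0)); rewrite -FDD// addr0 add0r.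
have FZ a u : X u -> F (a *: u) = a * F u.
  by move=> Xu; rewrite -[_ *: _]addr0 FD// F0 addr0.
pose J w := B w w - 2 * F w.
have Jlb w : X w -> - M ^+ 2 <= J w.
  move=> Xw; have := FM w Xw; rewrite /J; have := sqr_sqrtr (ip_ge0 _ Xw).
  set q := Num.sqrt _ => <-; have := ler_norm (F w).
  by have := sqr_ge0 (q - M); rewrite !expr2; lra.
pose S := [set J w | w in X].
have Sinf : has_inf S.
  by split; [exists (J 0), 0 | exists (- M ^+ 2) => _ [w Xw <-]; exact: Jlb].
have near n : exists w, X w /\ J w < inf S + n.+1%:R^-1.
  have e0 : 0 < (n.+1%:R^-1 : R) by rewrite invr_gt0.
  by have [_ [w Xw <-] Jw] := inf_adherent e0 Sinf; exists w.
have [s sP] := choice near.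
have Xs n : X (s n) by have [] := sP n.
have infJ w : X w -> inf S <= J w.
  by move=> Xw; apply: ge_inf; [case: Sinf | exists w].
(* The midpoint of [u] and [v] is a competitor, so [J] is at least [inf S] there. *)
have par u v : X u -> X v ->
    B (u - v) (u - v) <= 2 * (J u - inf S) + 2 * (J v - inf S).
  move=> Xu Xv; have Xuv := XD _ _ Xu Xv; have Xz := XZ 2^-1 _ Xuv.
  by have := infJ _ Xz; rewrite /J FZ// FDD// ipZl// ipZr// ipDD// ipBB//; lra.
have rate n : J (s n) - inf S < n.+1%:R^-1 by have [_] := sP n; rewrite -ltrBlDl.
have small (e : R) : 0 < e ->
    exists N, forall n, (N <= n)%N -> J (s n) - inf S < e / 4.
  move=> e0; exists (Num.truncn (4 / e)) => n Nn; apply: lt_trans (rate n) _.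
  rewrite invf_plt ?posrE ?divr_gt0// invf_div.
  by rewrite (lt_le_trans (truncnS_gt _))// ler_nat.
have [e e0 | r Xr sr] := cX s Xs.

  have [N NP] := small _ e0.
  exists N => m n Nm Nn; have := par _ _ (Xs m) (Xs n).
  have := NP _ Nm; have := NP _ Nn; lra.
exists r => // w Xw.
have Jr : J r <= inf S.
  (* [2 B r dl - 2 F dl] is at most [2 q] times the seminorm of [dl], hence at most [e / 2], while
     [J (s n)] exceeds [inf S] by less than [e / 4]. *)
  apply/ler_addgt0Pr => e e0; pose q := Num.sqrt (B r r) + `|M| + 1.
  have q0 : 0 < q by rewrite /q ltr_wpDl// addr_ge0// sqrtr_ge0.
  have h0 : 0 < e / (4 * q) by rewrite divr_gt0// mulr_gt0.
  have [N2 /(_ (maxn _ N2)) H2] := small _ e0.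
  have [N1 /(_ (maxn N1 _)) H1] := sr _ (exprn_gt0 2 h0).
  have {}H1 := H1 N2 (leq_maxl _ _).
  have {}H2 := H2 N1 (leq_maxr _ _).
  set n := maxn N1 N2 in H1 H2; pose dl := r - s n.
  have Xdl : X dl by exact: subspaceB.
  have dlE : Num.sqrt (B dl dl) < e / (4 * q).
    by rewrite -(ltr_pXn2r (n := 2))// ?nnegrE ?sqrtr_ge0 ?ltW// sqr_sqrtr ?ip_ge0// ipBBC.
  have -> : J r = J (s n) + 2 * B r dl - B dl dl - 2 * F dl.
    have rE : s n + dl = r by rewrite /dl addrC subrK.
    have -> : B r dl = B (s n) dl + B dl dl by rewrite -ipDl// rE.
    by rewrite -[in LHS]rE /J ipDD// FDD//; ring.
  have := FM _ Xdl; have := normr_ip _ _ Xr Xdl; have := ip_ge0 _ Xdl.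
  have := ler_norm (B r dl); have := ler_norm (- F dl).
  rewrite normrN; set D := Num.sqrt (B dl dl) in dlE *.
  have D0 : 0 <= D by exact: sqrtr_ge0.
  have : M * D <= `|M| * D by rewrite ler_wpM2r// ler_norm.
  have : q * D <= e / 4.
    have -> : e / 4 = q * (e / (4 * q)) by field; rewrite gt_eqF.
    by rewrite ler_wpM2l// ltW.
  rewrite /q; lra.
have key a : 0 <= a ^+ 2 * B w w + 2 * a * (B r w - F w).
  have := infJ _ (XD _ _ Xr (XZ a _ Xw)); have := Jr.
  rewrite /J FDD ?FZ ?ipDD ?ipZl ?ipZr//; [|exact: XZ..].
  rewrite expr2; lra.
have wp : 0 < B w w + 1 by have := ip_ge0 _ Xw; lra.
(* The exact minimizer in [a] would divide by [B w w], which may be zero. With [+ 1] the quadratic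
   still takes a negative value unless [B r w = F w]. *)
have := key (- (B r w - F w) / (B w w + 1)).
set g := B r w - F w; set q := B w w in wp *.
have -> : (- g / (q + 1)) ^+ 2 * q + 2 * (- g / (q + 1)) * g =
   - (g ^+ 2 * ((q + 2) / (q + 1) ^+ 2)) by field; rewrite gt_eqF.
rewrite oppr_ge0 pmulr_lle0; last first.
  by rewrite divr_gt0 ?exprn_gt0//; lra.
move=> g0; have : g = 0 by apply/eqP; rewrite -sqrf_eq0 eq_le g0 sqr_ge0.
by rewrite /g; lra.
Qed.

End semi_inner.
End semi_hilbert.

(** * The broken formulation of an abstract weak operator *)

Section weak_operator.
Context {R : realType} {U : lmodType R} {L : set U} {ip : U -> U -> R}.
Hypotheses (LI : semi_inner L ip) (LC : complete_in L ip).
Implicit Types (S : set U) (A : U -> U) (u v w f g : U).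

Definition sqn u := ip u u.
Local Notation "u ~~ v" := (sqn (u - v) = 0) (at level 70).

(* [f] is the image of [u] under the operator whose formal adjoint, on the test
   vectors [S], is [- Acl]. *)
Definition graph (Acl : U -> U) S u f :=
  [/\ L u, L f & forall psi, S psi -> ip u (Acl psi) = - ip f psi].

Definition domain Acl S : set U := [set u | exists f, graph Acl S u f].

Definition graph_ip A u v := ip u v + ip (A u) (A v).

(** Stands in for the density of the test vectors: it makes the image in [graph] unique up to a null
    vector. *)
Definition total S := forall f, L f -> (forall psi, S psi -> ip f psi = 0) ->
  sqn f = 0.

Let LL : subspace L. Proof. by case: LI. Qed.
Let LD a u v : L u -> L v -> L (a *: u + v). Proof. by case: LL => _; exact. Qed.
Let LB u v : L u -> L v -> L (u - v). Proof. exact: subspaceB. Qed.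
Let LZ a u : L u -> L (a *: u). Proof. exact: subspaceZ. Qed.
Let LN u : L u -> L (- u). Proof. by rewrite -scaleN1r; exact: LZ. Qed.

Lemma ip_eql u v w : L u -> L v -> L w -> u ~~ v -> ip u w = ip v w.
Proof. by move=> Lu Lv Lw uv; exact: (ip_eq LI). Qed.

Lemma ip_eqr u v w : L u -> L v -> L w -> u ~~ v -> ip w u = ip w v.
Proof. by move=> Lu Lv Lw uv; rewrite !(ipC LI w)//; exact: ip_eql. Qed.

Lemma ip_eqq u v : L u -> L v -> u ~~ v -> sqn u = sqn v.
Proof.
by move=> Lu Lv uv; rewrite /sqn (ip_eql _ v)// (ip_eqr _ v).
Qed.

(** * A weak operator: its graph norm, completeness, and coercivity by density *)

Section one_operator.
Context {Acl : U -> U} {S : set U} {A : U -> U}.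
Hypotheses (SL : S `<=` L) (AclL : forall psi, S psi -> L (Acl psi)).
Hypothesis (totS : total S).
Hypothesis (AE : forall u, domain Acl S u -> graph Acl S u (A u)).
Local Notation gr := (graph Acl S).
Local Notation dom := (domain Acl S).

Lemma graph_uniq u f g : gr u f -> gr u g -> f ~~ g.
Proof.
move=> [Lu Lf fP] [_ Lg gP]; apply: totS => [|psi Spsi]; first exact: LB.
have Lpsi := SL _ Spsi.
by rewrite (ipBl LI)//; have := fP _ Spsi; rewrite gP//; lra.
Qed.

Lemma graph_domain u f : gr u f -> A u ~~ f.
Proof. by move=> uf; apply: (graph_uniq u) => //; apply: AE; exists f. Qed.

Lemma graph_lin a u v f g : gr u f -> gr v g -> gr (a *: u + v) (a *: f + g).
Proof.
move=> [Lu Lf fP] [Lv Lg gP]; split; [exact: LD|exact: LD|move=> psi Spsi].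
have Lpsi := SL _ Spsi; have LApsi := AclL _ Spsi.
rewrite (ipDl LI)//; last exact: LZ.
rewrite (ipZl LI)// fP// gP// (ipDl LI)//; last exact: LZ.
by rewrite (ipZl LI)//; ring.
Qed.

Lemma domain_sub u : dom u -> L u.
Proof. by case=> f []. Qed.

Lemma domain_image u : dom u -> L (A u).
Proof. by move=> /AE[]. Qed.

Lemma domain_subspace : subspace dom.
Proof.
split=> [|a u v [f uf] [g vg]]; last by exists (a *: f + g); exact: graph_lin.
have L0 : L 0 by case: LL.
exists 0; split=> // psi Spsi; have Lpsi := SL _ Spsi.
by rewrite !(ip0l LI) ?oppr0//; exact: AclL.
Qed.

Lemma image_lin a u v : dom u -> dom v -> A (a *: u + v) ~~ a *: A u + A v.
Proof. by move=> uD vD; apply: graph_domain; apply: graph_lin; exact: AE. Qed.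

Lemma image_linl a u v w : dom u -> dom v -> L w ->
  ip (A (a *: u + v)) w = a * ip (A u) w + ip (A v) w.
Proof.
move=> uD vD Lw; have [Au Av] := (domain_image _ uD, domain_image _ vD).
rewrite (ip_eql _ (a *: A u + A v))//.
- by rewrite (ipDl LI) ?(ipZl LI)//; exact: LZ.
- by apply: domain_image; case: domain_subspace => _; exact.
- exact: LD.
- exact: image_lin.
Qed.

Lemma image_sub u v : dom u -> dom v -> A (u - v) ~~ A u - A v.
Proof.
move=> uD vD; have := image_lin (-1) v u vD uD.
by rewrite !scaleN1r (addrC (- v)) (addrC (- A v)).
Qed.

Lemma image_sqnB u v : dom u -> dom v -> sqn (A (u - v)) = sqn (A u - A v).
Proof.
move=> uD vD; apply: ip_eqq; last exact: image_sub.
- by apply: domain_image; exact: subspaceB domain_subspace _ _.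
- by apply: LB; exact: domain_image.
Qed.

(** Each condition in [graph] pairs [u] and [f] with vectors that depend on neither, so it passes to
    L^2 limits. *)
Lemma graph_closed s u f : (forall n, dom (s n)) -> L u -> L f ->
  converges_in ip s u -> converges_in ip (fun n => A (s n)) f -> gr u f.
Proof.
move=> sD Lu Lf su Asf; split=> // psi Spsi.
have Lpsi := SL _ Spsi; have LApsi := AclL _ Spsi.
rewrite -(ipNr LI)//.
apply: (convergent_ip_eq LI s (fun n => A (s n))) => //.
- by move=> n; exact: domain_sub.
- by move=> n; exact: domain_image.
- exact: LN.
- move=> n; have [_ LAs ->//] := AE _ (sD n).
  by rewrite (ipNr LI).
Qed.

Lemma graph_semi_inner : semi_inner dom (graph_ip A).
Proof.
split; first exact: domain_subspace.
- move=> u v uD vD; rewrite /graph_ip !(ipC LI v) ?(ipC LI (A v))//;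
  by [exact: domain_sub | exact: domain_image].
- move=> a u v w uD vD wD; have [Lu Lv] := (domain_sub _ uD, domain_sub _ vD).
  have Lw := domain_sub _ wD; have LAw := domain_image _ wD.
  rewrite /graph_ip (ipDl LI)//; last exact: LZ.
  by rewrite (ipZl LI)// image_linl//; ring.
- move=> u uD; rewrite /graph_ip addr_ge0// (ip_ge0 LI)//.
  + exact: domain_sub.
  + exact: domain_image.
Qed.

Lemma graph_complete : complete_in dom (graph_ip A).
Proof.
move=> s sD cs.
have Ls n : L (s n) by exact: domain_sub.
have LAs n : L (A (s n)) by exact: domain_image.
have sE m n : graph_ip A (s m - s n) (s m - s n) =
    sqn (s m - s n) + sqn (A (s m) - A (s n)).
  by rewrite /graph_ip -[ip (A _) _]/(sqn _) image_sqnB.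
have c1 : cauchy_in ip s.
  move=> e e0; have [N NP] := cs _ e0; exists N => m n Nm Nn.
  have := NP _ _ Nm Nn; rewrite sE => ?.
  have : 0 <= sqn (A (s m) - A (s n)) by apply: (ip_ge0 LI); exact: LB.
  by rewrite -[ip _ _]/(sqn _); lra.
have c2 : cauchy_in ip (fun n => A (s n)).
  move=> e e0; have [N NP] := cs _ e0; exists N => m n Nm Nn.
  have := NP _ _ Nm Nn; rewrite sE => ?.
  have : 0 <= sqn (s m - s n) by apply: (ip_ge0 LI); exact: LB.
  by rewrite -[ip _ _]/(sqn _); lra.
have [u Lu su] := LC _ Ls c1; have [f Lf Asf] := LC _ LAs c2.
have uf : gr u f by exact: graph_closed su Asf.
have uD : dom u by exists f.
exists u => // e e0; have e2 : 0 < e / 2 by lra.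
have [N1 H1] := su _ e2; have [N2 H2] := Asf _ e2.
exists (maxn N1 N2) => n; rewrite geq_max => /andP[/H1 {}H1 /H2 {}H2].
rewrite /graph_ip -[ip (A _) _]/(sqn _) image_sqnB//.
(* The limit [f] of the images is an image of [u], but not necessarily the chosen one; the two
   differ by a null vector. *)
have -> : sqn (A (s n) - A u) = sqn (A (s n) - f).
  apply: ip_eqq; [by apply: LB => //; exact: domain_image|exact: LB|].
  rewrite opprB addrC addrA subrK /sqn (ipBBC LI)//; last exact: domain_image.
  exact: graph_domain.
by rewrite /sqn; lra.
Qed.

(** The triangle inequality for squared seminorms costs a factor 2. It is applied once to [u] and
    once to [A v], whence [4 * C]. *)
Lemma dense_coercive (X Y : set U) (C : R) : 0 <= C -> X `<=` dom ->
  (forall v, Y v -> dom v /\ sqn v <= C * sqn (A v)) ->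
  dense_in Y X (fun u => Num.sqrt (Num.sqrt (sqn u) ^+ 2 + Num.sqrt (sqn (A u)) ^+ 2)) ->
  forall u, X u -> sqn u <= 4 * C * sqn (A u).
Proof.
move=> C0 XD YP dYX u Xu; apply/ler_addgt0Pr => e e0.
have uD := XD _ Xu; have Lu := domain_sub _ uD; have LAu := domain_image _ uD.
(* If [a] and [b] are the squared errors on [u] and on [A u], what is left over is
   [2 a + 4 C b <= (2 + 4 C) (a + b) < e]. *)
have d0 : 0 < e / (2 + 4 * C) by rewrite divr_gt0//; lra.
have /(dYX _ Xu)[v Yv] : 0 < Num.sqrt (e / (2 + 4 * C)) by rewrite sqrtr_gt0.
have [vD vC] := YP _ Yv; have Lv := domain_sub _ vD; have LAv := domain_image _ vD.
have n1 : 0 <= sqn (u - v) by apply: (ip_ge0 LI); exact: LB.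
have n2 : 0 <= sqn (A u - A v) by apply: (ip_ge0 LI); exact: LB.
rewrite image_sqnB// ltr_sqrt// !sqr_sqrtr// ltr_pdivlMr; last by lra.
have := ip_triangle LI _ _ (LB _ _ Lu Lv) Lv; rewrite subrK.
have := ip_triangle LI _ _ (LB _ _ LAv LAu) LAu; rewrite subrK.
rewrite (ipBBC LI)// -!/(sqn _).
set a := sqn (u - v) in n1 *; set b := sqn (A u - A v) in n2 *.
move=> H1 H2 H3.
have := ler_wpM2l C0 H1.
have : 0 <= a * C by rewrite mulr_ge0.
have : 0 <= b * C by rewrite mulr_ge0.
by lra.
Qed.

End one_operator.

(** * The spaces [V] and [V*], and the broken problem *)

Section broken_formulation.
Context {Acl : U -> U} {S Sh : set U} {A Ah : U -> U} {CV CVs : set U} {C : R}.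
Hypotheses (SL : S `<=` L) (AclL : forall psi, S psi -> L (Acl psi)).
Hypotheses (ShS : Sh `<=` S) (totSh : total Sh).
Hypothesis (AclE : forall psi, S psi -> graph Acl S psi (Acl psi)).
Hypothesis (AE : forall u, domain Acl S u -> graph Acl S u (A u)).
Hypothesis (AhE : forall u, domain Acl Sh u -> graph Acl Sh u (Ah u)).
Hypothesis (C0 : 0 <= C).
Hypothesis (CVE : forall v, CV v -> domain Acl S v /\ sqn v <= C * sqn (A v)).
Hypothesis (CVsE : forall v, CVs v -> domain Acl S v /\ sqn v <= C * sqn (A v)).

Local Notation W := (domain Acl S).
Local Notation Wh := (domain Acl Sh).
Local Notation nrm u := (Num.sqrt (ip u u)).

Definition graph_norm (B : U -> U) u := Num.sqrt (nrm u ^+ 2 + nrm (B u) ^+ 2).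

Definition bdry_form (B : U -> U) u v := ip (B u) v + ip u (B v).

Local Notation D := (bdry_form A).
Local Notation Dh := (bdry_form Ah).

Definition bdry_domain : set U :=
  [set u | W u /\ forall v, CVs v -> D u v = 0].
Local Notation V := bdry_domain.

Definition adjoint_domain : set U :=
  [set w | L w /\ exists2 l, L l & forall u, V u -> ip (A u) w = ip u l].
Local Notation Vs := adjoint_domain.

Definition trace_space : set (U -> R) :=
  [set rho | exists2 v, V v & eq_dual Wh (Dh v) rho].

Definition trace_norm (rho : U -> R) : R :=
  inf [set graph_norm A v | v in [set v | V v /\ eq_dual Wh (Dh v) rho]].

Definition broken_solution (F : U -> R) u (lam : U -> R) :=
  [/\ L u, trace_space lam & forall w, Wh w -> - ip u (Ah w) + lam w = F w].

Hypothesis (CVV : dense_in CV V (graph_norm A)).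
Hypothesis (CVsVs : dense_in CVs Vs (graph_norm A)).

Let ShL : Sh `<=` L. Proof. by move=> u /ShS/SL. Qed.
Let AclhL psi : Sh psi -> L (Acl psi). Proof. by move=> /ShS/AclL. Qed.
Let totS : total S.
Proof. by move=> f Lf fS; apply: totSh => // psi /ShS; exact: fS. Qed.

Let WL u : W u -> L u. Proof. exact: domain_sub. Qed.
Let AL u : W u -> L (A u). Proof. by move=> /AE[]. Qed.
Let WhL u : Wh u -> L u. Proof. exact: domain_sub. Qed.
Let AhL u : Wh u -> L (Ah u). Proof. by move=> /AhE[]. Qed.

Let graph_broken u f : graph Acl S u f -> graph Acl Sh u f.
Proof. by case=> Lu Lf uf; split=> // psi /ShS; exact: uf. Qed.

Let WWh : W `<=` Wh.
Proof. by move=> u [f /graph_broken uf]; exists f. Qed.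

Let AhA u : W u -> sqn (Ah u - A u) = 0.
Proof.
move=> Wu; apply: (graph_domain ShL totSh AhE).
by apply: graph_broken; exact: AE.
Qed.

Let graph_A u f : graph Acl S u f -> sqn (A u - f) = 0.
Proof. exact: graph_domain. Qed.

Let VW : V `<=` W. Proof. by move=> u []. Qed.

(** For a test vector [D psi v = 0] is just the weak definition of [A v], valid for every [v] in
    [W], in particular on [CVs]. *)
Let SV : S `<=` V.
Proof.
move=> psi Spsi; have psiW : W psi by exists (Acl psi); exact: AclE.
have Lpsi := SL _ Spsi; have LApsi := AclL _ Spsi.
split=> // v /CVsE[vW _]; have [Lv LAv vP] := AE _ vW.
rewrite /bdry_form (ip_eql _ (Acl psi))//; [|exact: AL|exact/graph_A/AclE].
by rewrite (ipC LI)// vP// (ipC LI psi)// addrC subrr.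
Qed.

(** Test vectors belong to [V], so the adjoint relation can be tested with them; this is the weak
    equation for [w] with image [- l]. *)
Let adjoint_graph w l : L w -> L l ->
  (forall u, V u -> ip (A u) w = ip u l) -> graph Acl S w (- l).
Proof.
move=> Lw Ll wl; split=> // [|psi Spsi]; first exact: LN.
have Lpsi := SL _ Spsi; have LApsi := AclL _ Spsi.
have psiW : W psi by exact/VW/SV.
rewrite (ipNl LI)// opprK (ipC LI)// (ipC LI l)// -wl//; last exact: SV.
apply: ip_eql => //; first exact: AL.
rewrite /sqn (ipBBC LI)//; last exact: AL.
exact/graph_A/AclE.
Qed.

Let VsW : Vs `<=` W.
Proof. by move=> w [Lw [l Ll wl]]; exists (- l); exact: adjoint_graph. Qed.

Let D_V_Vs u w : V u -> Vs w -> D u w = 0.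
Proof.
move=> Vu Vsw; have [Lw [l Ll wl]] := Vsw.
have Lu := WL _ (VW _ Vu); have LAu := AL _ (VW _ Vu); have LAw := AL _ (VsW _ Vsw).
rewrite /bdry_form wl// (ip_eqr (A w) (- l))//.
- by rewrite (ipNr LI)// subrr.
- exact: LN.
- exact/graph_A/adjoint_graph.
Qed.

(** The condition defining [V] is, for each fixed [v] in [CVs], an adjoint relation with
    [l = - A v]. *)
Let CVsVs_sub : CVs `<=` Vs.
Proof.
move=> v CVsv; have [vW _] := CVsE _ CVsv.
have Lv := WL _ vW; have LAv := AL _ vW.
split=> //; exists (- A v) => [|u Vu]; first exact: LN.
have Lu := WL _ (VW _ Vu).
by rewrite (ipNr LI)//; apply/eqP; rewrite -addr_eq0; apply/eqP; apply Vu.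
Qed.

Let DC u v : W u -> W v -> D u v = D v u.
Proof.
move=> uW vW; rewrite /bdry_form (ipC LI (A u)) ?(ipC LI u) 1?addrC//;
  by [exact: WL | exact: AL].
Qed.

Let annihilator_V u : W u -> (forall w, Vs w -> D u w = 0) -> V u.
Proof. by move=> Wu H; split=> // v /CVsVs_sub; exact: H. Qed.

(** [V] annihilates [Vs] because the elements of [Vs] satisfy the adjoint relation with [l = - A w].
    Conversely, annihilating [Vs] is at least as strong as annihilating its subset [CVs], which is
    what [V] asks for. *)
Theorem bdry_domain_annihilator : V = right_annihilator W (D @` Vs).
Proof.
apply/seteqP; split=> [u Vu|u [Wu uP]].
  split=> [|_ [w Vsw <-]]; first exact: VW.
  by rewrite DC; [exact: D_V_Vs|exact: VsW|exact: VW].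
apply: annihilator_V => // w Vsw; rewrite DC//; last exact: VsW.
by apply: uP; exists w.
Qed.

Let coerciveV u : V u -> sqn u <= 4 * C * sqn (A u).
Proof. exact: (dense_coercive SL AclL totS AE _ _ _ C0 VW CVE CVV). Qed.

Let coerciveVs u : Vs u -> sqn u <= 4 * C * sqn (A u).
Proof. exact: (dense_coercive SL AclL totS AE _ _ _ C0 VsW CVsE CVsVs). Qed.

Let WB u v : W u -> W v -> W (u - v).
Proof. by apply: subspaceB; exact: (domain_subspace SL AclL). Qed.

Let Dlin a u v w : W u -> W v -> W w -> D (a *: u + v) w = a * D u w + D v w.
Proof.
move=> Wu Wv Ww; have [Lu Lv] := (WL _ Wu, WL _ Wv); have Lw := WL _ Ww.
rewrite /bdry_form (image_linl SL AclL totS AE)//.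
have LAw := AL _ Ww; have LAv := AL _ Wv.
by rewrite (ipDl LI)//; [rewrite (ipZl LI)//; ring|exact: LZ].
Qed.

Let VB u v : V u -> V v -> V (u - v).
Proof.
move=> Vu Vv; have [Wu Wv] := (VW _ Vu, VW _ Vv).
split=> [|w CVsw]; first exact: WB.
have Ww : W w by apply/VsW/CVsVs_sub.
rewrite addrC -scaleN1r Dlin//.
by case: Vu Vv => _ /(_ _ CVsw)-> [_ /(_ _ CVsw)->]; rewrite mulr0 addr0.
Qed.

Lemma bdry_domain_inj u v : V u -> V v -> A u ~~ A v -> u ~~ v.
Proof.
move=> Vu Vv uv; have Vuv := VB _ _ Vu Vv.
have [Wu Wv] := (VW _ Vu, VW _ Vv).
apply/eqP; rewrite eq_le; apply/andP; split.
  have := coerciveV _ Vuv; rewrite (image_sqnB SL AclL totS AE)//.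
  by rewrite uv mulr0.
by apply: (ip_ge0 LI); apply: LB; exact: WL.
Qed.

Let VsB : subspace Vs.
Proof.
split.
  split; first by case: LL.
  by exists 0 => [|u Vu]; [case: LL|rewrite !(ip0r LI)//; [exact/WL/VW|exact/AL/VW]].
move=> a w1 w2 [Lw1 [l1 Ll1 wl1]] [Lw2 [l2 Ll2 wl2]]; split; first exact: LD.
exists (a *: l1 + l2) => [|u Vu]; first exact: LD.
have Lu := WL _ (VW _ Vu); have LAu := AL _ (VW _ Vu).
rewrite (ipDr LI)//; last exact: LZ.
rewrite (ipZr LI)// wl1// wl2// (ipDr LI)//; last exact: LZ.
by rewrite (ipZr LI).
Qed.

Let adjoint_semi_inner : semi_inner Vs (fun u v => ip (A u) (A v)).
Proof.
split; first exact: VsB.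
- by move=> u v uD vD; apply: (ipC LI); exact/AL/VsW.
- move=> a u v w uD vD wD.
  by rewrite (image_linl SL AclL totS AE)//; [exact: VsW|exact: VsW|exact/AL/VsW].
- by move=> u uD; apply: (ip_ge0 LI); exact/AL/VsW.
Qed.

(** Coercivity turns a sequence whose images are Cauchy into one that is Cauchy itself; its limit
    stays in [Vs] since the adjoint relation is closed. *)
Let adjoint_complete : complete_in Vs (fun u v => ip (A u) (A v)).
Proof.
move=> s sVs cs.
have sW n : W (s n) by exact: VsW.
have Ls n : L (s n) by exact: WL.
have LAs n : L (A (s n)) by exact: AL.
have c2 : cauchy_in ip (fun n => A (s n)).
  move=> e e0; have [N NP] := cs _ e0; exists N => m n Nm Nn.
  rewrite -[ip _ _]/(sqn _) -(image_sqnB SL AclL totS AE)//; exact: NP.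
have c1 : cauchy_in ip s.
  (* The coercivity constant is [4 * C]; adding 1 avoids a division by zero when [C = 0]. *)
  move=> e e0; have e1 : 0 < e / (4 * C + 1) by rewrite divr_gt0//; move: C0; lra.
  have [N NP] := cs _ e1; exists N => m n Nm Nn.
  have := NP _ _ Nm Nn; rewrite ltr_pdivlMr; last by move: C0; lra.
  have : Vs (s m - s n) by exact: subspaceB.
  move=> Vsd; have := coerciveVs _ Vsd.
  have : 0 <= sqn (A (s m - s n)) by exact/(ip_ge0 LI)/AL/VsW.
  by rewrite /sqn; lra.
have [u Lu su] := LC _ Ls c1; have [f Lf Asf] := LC _ LAs c2.
have uf : graph Acl S u f by exact: (graph_closed SL AclL AE s).
have Wu : W u by exists f.
exists u.
  split=> //; exists (- f) => [|v Vv]; first exact: LN.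
  have Lv := WL _ (VW _ Vv); have LAv := AL _ (VW _ Vv).
  rewrite (ipNr LI)// -(ipNl LI)// (ipC LI (A v))// (ipC LI _ f)//; last exact: LN.
  (* [D v (s n) = 0] is the adjoint relation along the sequence. *)
  apply: (convergent_ip_eq LI s (fun n => A (s n))) => //; first exact: LN.
  move=> n; have := D_V_Vs _ _ Vv (sVs n); rewrite /bdry_form.
  by rewrite (ipNr LI)// (ipC LI (A v))// (ipC LI v)//; lra.
move=> e e0; have [N NP] := Asf _ e0; exists N => n Nn.
have -> : ip (A (s n - u)) (A (s n - u)) = sqn (A (s n) - A u).
  exact: (image_sqnB SL AclL totS AE).
have -> : sqn (A (s n) - A u) = sqn (A (s n) - f); last exact: NP.
have LAu := AL _ Wu.
apply: ip_eqq; [exact: LB|exact: LB|].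
rewrite opprB addrC addrA subrK /sqn (ipBBC LI)//.
exact: graph_A.
Qed.

(* [u = A w0], where [w0] represents the functional [- (f, .)] on the adjoint
   domain for the inner product [(A ., A .)]. *)
Lemma bdry_domain_surj f : L f -> exists2 u, V u & A u ~~ f.
Proof.
move=> Lf.
have [|w0 Vsw0 w0P] := riesz_representation adjoint_semi_inner
    (fun w => - ip f w) adjoint_complete.
  split=> [a w1 w2 /VsW/WL Lw1 /VsW/WL Lw2|].
    by rewrite (ipDr LI)//; [rewrite (ipZr LI)//; ring|exact: LZ].
  exists (nrm f * Num.sqrt (4 * C)) => w Vsw; have Lw := WL _ (VsW _ Vsw).
  rewrite normrN (le_trans (normr_ip LI _ _ Lf Lw))// -mulrA ler_wpM2l ?sqrtr_ge0//.
  rewrite -sqrtrM; last by rewrite mulr_ge0.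
  by rewrite ler_wsqrtr//; exact: coerciveVs.
have LAw0 := AL _ (VsW _ Vsw0).
(* On a test vector the Riesz identity reads [(A w0, Acl psi) = - (f, psi)], the weak form of
   [A (A w0) = f]. *)
have uf : graph Acl S (A w0) f.
  split=> // psi Spsi; have Lpsi := SL _ Spsi; have LApsi := AclL _ Spsi.
  have Vspsi : Vs psi.
    split=> //; exists (- Acl psi) => [|u Vu]; first exact: LN.
    have [Lu LAu uP] := AE _ (VW _ Vu).
    by rewrite (ipNr LI)// uP// opprK.
  have := w0P _ Vspsi; rewrite (ip_eqr (A psi) (Acl psi))//.
  - exact/AL/VsW.
  - exact/graph_A/AclE.
have Wu : W (A w0) by exists f.
exists (A w0); last exact: graph_A.
(* The same identity on all of [Vs] reads [(f, w) + (A w0, A w) = 0], that is [D (A w0) w = 0]: it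
   encodes the boundary conditions as well as the equation. *)
apply: annihilator_V => // w Vsw.
have Lw := WL _ (VsW _ Vsw).
rewrite /bdry_form (ip_eql _ f)//; [|exact: AL|exact: graph_A].
by have := w0P _ Vsw; lra.
Qed.

Let nWh_gip u : Wh u -> graph_norm Ah u = Num.sqrt (graph_ip Ah u u).
Proof.
move=> Whu; rewrite /graph_norm /graph_ip !sqr_sqrtr// (ip_ge0 LI)//.
  exact: AhL.
exact: WhL.
Qed.

Let graph_ip_semi_inner : semi_inner Wh (graph_ip Ah).
Proof. exact: graph_semi_inner. Qed.

(* [F] is the graph inner product with [r], and [u = p - Ah r], [lam = Dh p]
   with [p] the preimage of [r] under [A] in the boundary domain. *)
Let existence F : dual Wh (graph_norm Ah) F -> exists r p,
  [/\ Wh r, V p, sqn (A p - r) = 0, forall w, Wh w -> F w = graph_ip Ah r w &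
      broken_solution F (p - Ah r) (Dh p)].
Proof.
move=> [Flin [M FM]].
have [|r Whr rP] := riesz_representation graph_ip_semi_inner F
    (graph_complete ShL AclhL totSh AhE).
  by split=> //; exists M => w Whw; rewrite -nWh_gip//; exact: FM.
have Lr := WhL _ Whr; have LAr := AhL _ Whr.
have [p Vp pr] := bdry_domain_surj _ Lr.
have Wp := VW _ Vp; have Lp := WL _ Wp; have LAp := AL _ Wp.
exists r, p; split=> //; split; first exact: LB.
  by exists p.
move=> w Whw; have Lw := WhL _ Whw; have LAw := AhL _ Whw.
(* The two terms [(p, Ah w)] cancel, leaving [(Ah r, Ah w) + (Ah p, w)], and [Ah p], [A p] and [r]
   agree up to null vectors. *)
rewrite rP// /graph_ip /bdry_form (ipBl LI)//.
rewrite (ip_eql (Ah p) r)//; [ring|exact/AhL/WWh|].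
have LAhp : L (Ah p) by exact/AhL/WWh.
by apply: (ip_null_trans LI _ (A p)) => //; exact: AhA.
Qed.

Let uniqueness F u lam u' lam' : broken_solution F u lam ->
  broken_solution F u' lam' -> u' ~~ u /\ eq_dual Wh lam' lam.
Proof.
move=> [Lu [z Vz zlam] uP] [Lu' [z' Vz' zlam'] u'P].
have Lu'u : L (u' - u) by exact: LB.
have uu w : Vs w -> ip (u' - u) (A w) = 0.
  move=> Vsw; have Ww := VsW _ Vsw; have Whw := WWh _ Ww; have Lw := WL _ Ww.
  have LAw := AL _ Ww; have LAhw := AhL _ Whw.
  (* On [Vs] the broken image is the global one, so a trace acts on [w] as [D y w], which is
     zero. *)
  have lam0 y l : V y -> eq_dual Wh (Dh y) l -> l w = 0.
    move=> Vy <-//; have Wy := VW _ Vy; have Ly := WL _ Wy; have LAy := AL _ Wy.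
    have LAhy : L (Ah y) by exact/AhL/WWh.
    rewrite /bdry_form (ip_eql _ (A y))//; last exact: AhA.
    rewrite (ip_eqr (Ah w) (A w))//; last exact: AhA.
    exact: D_V_Vs.
  have := uP _ Whw; have := u'P _ Whw.
  rewrite (lam0 _ _ Vz zlam) (lam0 _ _ Vz' zlam') !addr0 => <- /oppr_inj uu'.
  rewrite -(ip_eqr (Ah w) (A w))//; last exact: AhA.
  by rewrite (ipBl LI)// uu' subrr.
(* On test vectors, [uu] says that the weak image of [u' - u] is zero; on all of [Vs] it then
   becomes the boundary condition that puts [u' - u] in [V]. *)
have gr0 : graph Acl S (u' - u) 0.
  split=> [//||psi Spsi]; first by case: LL.
  have Lpsi := SL _ Spsi; have LApsi := AclL _ Spsi.
  have psiW : W psi by exists (Acl psi); exact: AclE.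
  rewrite (ip0l LI)// oppr0 -(ip_eqr (A psi) (Acl psi))//.
  - apply: uu; split=> //; exists (- Acl psi) => [|v Vv]; first exact: LN.
    have [Lv LAv vP] := AE _ (VW _ Vv).
    by rewrite (ipNr LI)// vP// opprK.
  - exact: AL.
  - exact/graph_A/AclE.
have Wuu : W (u' - u) by exists 0.
have L0 : L 0 by case: LL.
have LAuu := AL _ Wuu.
have A0 : sqn (A (u' - u)) = 0.
  by have := graph_A _ _ gr0; rewrite subr0.
have Vuu : V (u' - u).
  apply: annihilator_V => // w Vsw; rewrite /bdry_form uu// addr0.
  by rewrite (ip_null LI)//; exact/WL/VsW.
have uu0 : u' ~~ u.
  apply/eqP; rewrite eq_le (ip_ge0 LI)// andbT.
  by have := coerciveV _ Vuu; rewrite A0 mulr0.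
split=> // w Whw; have := uP _ Whw; rewrite -(u'P _ Whw).
by rewrite (ip_eql _ u)//; [move=> /addrI|exact: AhL].
Qed.

Theorem broken_well_posed :
  (forall F, dual Wh (graph_norm Ah) F ->
     exists u lam, broken_solution F u lam /\
       forall u' lam', broken_solution F u' lam' ->
         u' ~~ u /\ eq_dual Wh lam' lam) /\
  exists K, forall F u lam, dual Wh (graph_norm Ah) F ->
    broken_solution F u lam ->
    nrm u + trace_norm lam <= K * dual_norm Wh (graph_norm Ah) F.
Proof.
split=> [F /existence[r [p [_ _ _ _ sol]]]|].
  by exists (p - Ah r), (Dh p); split=> // u' lam'; exact: uniqueness.
pose c := Num.sqrt (4 * C).
have c0 : 0 <= c by exact: sqrtr_ge0.
(* With [N] the dual norm of [F], both [r] and [Ah r] have norm at most [N], and [p] has norm at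
   most [c N]. Hence [(c + 1) N] bounds the norm of [p - Ah r] and also the graph norm of [p], which
   dominates the trace norm. *)
exists (c + 1 + (c + 1)) => F u lam dF sol.
have [r [p [Whr Vp pr FE sol']]] := existence _ dF.
have Lr := WhL _ Whr; have LAr := AhL _ Whr.
have Wp := VW _ Vp; have Lp := WL _ Wp; have LAp := AL _ Wp.
set N := dual_norm _ _ _.
have [uE lamE] := uniqueness _ _ _ _ _ sol' sol.
have [Flin [M FM]] := dF.
have F0 : F 0 = 0.
  by rewrite FE ?(ip0r graph_ip_semi_inner)//; case: (domain_subspace ShL AclhL).
have Whs : subspace Wh by exact: (domain_subspace ShL AclhL).
(* [sup] is meaningful only for a nonempty set that is bounded above, so this must be known before
   [dual_norm] can bound anything. *)
have hsup : has_sup [set `|F w| | w in [set w | Wh w /\ graph_norm Ah w <= 1]].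
  split.
    exists `|F 0|, 0 => //; split; first by case: Whs.
    rewrite nWh_gip; last by case: Whs.
    by rewrite (ip0r graph_ip_semi_inner) ?sqrtr0//; case: Whs.
  exists `|M| => _ [w [Whw w1] <-]; apply: (le_trans (FM _ Whw)).
  apply: (le_trans (y := `|M| * graph_norm Ah w)).
    by rewrite ler_wpM2r ?ler_norm// sqrtr_ge0.
  by rewrite -[leRHS]mulr1 ler_wpM2l.
(* [F] is evaluated at [r] divided by its own norm; if that norm is zero, the vector 0 serves. *)
have nr : graph_norm Ah r <= N.
  have r0 : 0 <= graph_norm Ah r by exact: sqrtr_ge0.
  have [rE|rn0] := eqVneq (graph_norm Ah r) 0.
    rewrite rE; apply: (le_trans (normr_ge0 (F 0))).
    apply: ub_le_sup; first by case: hsup.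
    exists 0 => //; split; first by case: Whs.
    rewrite nWh_gip; last by case: Whs.
    by rewrite (ip0r graph_ip_semi_inner) ?sqrtr0//; case: Whs.
  have rp : 0 < graph_norm Ah r by rewrite lt_neqAle eq_sym rn0.
  have rr : graph_ip Ah r r = graph_norm Ah r ^+ 2.
    by rewrite nWh_gip// sqr_sqrtr// (ip_ge0 graph_ip_semi_inner).
  have Whn : Wh ((graph_norm Ah r)^-1 *: r) by exact: subspaceZ.
  apply: ub_le_sup; first by case: hsup.
  exists ((graph_norm Ah r)^-1 *: r).
    split=> //; rewrite nWh_gip//.
    rewrite (ipZl graph_ip_semi_inner)// (ipZr graph_ip_semi_inner)// rr.
    by rewrite expr2 mulKf// mulVf// sqrtr1.
  rewrite FE// (ipZr graph_ip_semi_inner)// rr.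
  by rewrite expr2 mulrA mulVf// mul1r ger0_norm.
have N0 : 0 <= N by apply: le_trans nr; exact: sqrtr_ge0.
have AAr : sqn (A p) = sqn r by exact: ip_eqq.
have nA : nrm (A p) <= N.
  apply: le_trans nr; rewrite -[ip _ _]/(sqn _) AAr /graph_norm ler_wsqrtr//.
  by rewrite sqr_sqrtr ?lerDl ?sqr_ge0// (ip_ge0 LI).
have nAr : nrm (Ah r) <= N.
  apply: le_trans nr; rewrite /graph_norm ler_wsqrtr//.
  by rewrite sqr_sqrtr ?(ip_ge0 LI)// sqr_sqrtr ?(ip_ge0 LI)// lerDr (ip_ge0 LI).
have np : nrm p <= c * N.
  apply: (le_trans (y := c * nrm (A p))); last by rewrite ler_wpM2l.
  by rewrite /c -sqrtrM ?mulr_ge0// ler_wsqrtr//; exact: coerciveV.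
have tri u1 u2 : L u1 -> L u2 -> nrm (u1 - u2) <= nrm u1 + nrm u2.
  move=> L1 L2; rewrite -(ler_pXn2r (n := 2))// ?nnegrE ?sqrtr_ge0 ?addr_ge0 ?sqrtr_ge0//.
  rewrite sqr_sqrtr ?(ip_ge0 LI)//; last exact: LB.
  rewrite (ipBB LI)// sqrrD !sqr_sqrtr ?(ip_ge0 LI)//.
  have := normr_ip LI _ _ L1 L2; have := ler_norm (- ip u1 u2); rewrite normrN.
  by rewrite mulr2n; lra.
have -> : nrm u = nrm (p - Ah r).
  by congr Num.sqrt; apply: ip_eqq => //; [case: sol|exact: LB].
have nu : nrm (p - Ah r) <= c * N + N.
  by apply: (le_trans (tri _ _ Lp LAr)); exact: lerD.
have nl : trace_norm lam <= graph_norm A p.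
  apply: ge_inf; first by exists 0 => _ [v _ <-]; exact: sqrtr_ge0.
  by exists p => //; split=> // w Whw; rewrite lamE.
have nW : graph_norm A p <= c * N + N.
  rewrite -(ler_pXn2r (n := 2))// ?nnegrE ?sqrtr_ge0 ?addr_ge0 ?mulr_ge0//.
  rewrite sqr_sqrtr ?addr_ge0 ?sqr_ge0// sqrrD.
  have : nrm p ^+ 2 <= (c * N) ^+ 2.
    by rewrite ler_pXn2r// ?nnegrE ?sqrtr_ge0 ?mulr_ge0.
  have : nrm (A p) ^+ 2 <= N ^+ 2 by rewrite ler_pXn2r// ?nnegrE ?sqrtr_ge0.
  have : 0 <= c * N * N by rewrite !mulr_ge0.
  by rewrite mulr2n; lra.
by rewrite mulrDl mulrDl mul1r; lra.
Qed.

End broken_formulation.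
End weak_operator.

(** * Lebesgue measure and Fubini on slices *)

Lemma countable_bigcup_measurable d (T : sigmaRingType d) (I : countType)
    (P : set I) (F : I -> set T) :
  (forall i, P i -> measurable (F i)) -> measurable (\bigcup_(i in P) F i).
Proof.
move=> mF; pose G k := if unpickle k is Some i then
  (if i \in P then F i else set0) else set0.
have -> : \bigcup_(i in P) F i = \bigcup_k G k.
  apply/seteqP; split=> x [i Pi Fix].
    by exists (pickle i) => //; rewrite /G pickleK mem_set.
  move: Fix; rewrite /G; case: unpickle => // j.
  by case: ifPn => // /set_mem Pj Fjx; exists j.
apply: bigcupT_measurable => k; rewrite /G; case: unpickle => // i.
by case: ifPn => // /set_mem; exact: mF.
Qed.

Section boxes.
Context {R : realType} {n : nat}.
Local Notation E := 'rV[R]_n.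

Definition obox (a b : E) : set E := [set x | forall i, a 0 i < x 0 i < b 0 i].
Definition cbox (a b : E) : set E := [set x | forall i, a 0 i <= x 0 i <= b 0 i].

Lemma obox_cbox a b : obox a b `<=` cbox a b.
Proof. by move=> x xab i; have /andP[/ltW-> /ltW->] := xab i. Qed.

Lemma coord_cvg (x : E) (i : 'I_n) : (y : E) 0 i @[y --> x] --> x 0 i.
Proof. exact: coord_continuous. Qed.

Lemma closed_cbox a b : closed (cbox a b).
Proof.
have -> : cbox a b = \bigcap_(i in setT) ((fun x : E => x 0 i) @^-1` `[a 0 i, b 0 i]%classic).
  apply/seteqP; split=> [x xab i _|x xab i] /=; first by rewrite in_itv/=; exact: xab.
  by have := xab i I; rewrite /= in_itv.
apply: closed_bigI => i _; apply: preimage_closed; last exact: itv_closed.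
by move=> x _; exact: coord_cvg.
Qed.

Lemma compact_cbox a b : compact (cbox a b).
Proof.
have := @rV_compact R n (fun i => `[a 0 i, b 0 i]%classic) (fun i => @segment_compact R _ _).
by congr compact; apply/seteqP; split=> x xab i; have := xab i; rewrite /= in_itv.
Qed.

(** Rational boxes form a countable base. Local statements become global ones up to measurability or
    null sets by a countable union, without compactness. *)
Lemma open_rat_box (A : set E) x : open A -> A x -> exists ab : 'rV[rat]_n * 'rV[rat]_n,
  obox (map_mx ratr ab.1) (map_mx ratr ab.2) x /\
  cbox (map_mx ratr ab.1) (map_mx ratr ab.2) `<=` A.
Proof.
rewrite openE => oA /oA; rewrite /interior => /nbhs_ballP[e /= e0 eA].
have /choice[a aP] (i : 'I_n) : exists q : rat, x 0 i - e < ratr q < x 0 i.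
  have /rat_in_itvoo[q] : x 0 i - e < x 0 i by rewrite ltrBlDr ltrDl.
  by rewrite in_itv /= => ?; exists q.
have /choice[b bP] (i : 'I_n) : exists q : rat, x 0 i < ratr q < x 0 i + e.
  have /rat_in_itvoo[q] : x 0 i < x 0 i + e by rewrite ltrDl.
  by rewrite in_itv /= => ?; exists q.
exists (\row_i a i, \row_i b i); split => [i|y yab].
  by rewrite !mxE; have /andP[_ ->] := aP i; have /andP[->] := bP i.
apply: eA; split=> // i j; rewrite ord1 /ball/=.
have := yab j; rewrite !mxE.
have /andP[a1 a2] := aP j; have /andP[b1 b2] := bP j => /andP[c1 c2].
by rewrite distrC ltr_norml; apply/andP; split; lra.
Qed.

Lemma measurable_coord_preimage (i : 'I_n) (Y : set R) :
  measurable (Y : set (measurableTypeR R)) -> measurable [set x : E | Y (x 0 i)].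
Proof.
by move=> mY; rewrite -[X in measurable X]setTI; exact: (measurable_rV_coord i).
Qed.

Lemma measurable_obox a b : measurable (obox a b).
Proof.
have -> : obox a b = \bigcap_(i in setT) [set x : E | `]a 0 i, b 0 i[%classic (x 0 i)].
  apply/seteqP; split=> [x xab i _|x xab i] /=; first by rewrite in_itv/=; exact: xab.
  by have := xab i I; rewrite /= in_itv.
apply: fin_bigcap_measurable => [|i _]; first exact: finite_finset.
by apply: measurable_coord_preimage; exact: measurable_itv.
Qed.

(** The sigma-algebra is generated by the coordinates, not by the topology; the countable base links
    the two. *)
Lemma open_measurable_rV (A : set E) : open A -> measurable A.
Proof.
move=> oA.
pose P := [set ab : 'rV[rat]_n * 'rV[rat]_n |
  cbox (map_mx ratr ab.1) (map_mx ratr ab.2) `<=` A].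
have -> : A = \bigcup_(ab in P) obox (map_mx ratr ab.1) (map_mx ratr ab.2).
  apply/seteqP; split=> [x /(open_rat_box _ _ oA)[ab [xab abA]]|x [ab abP]].
    by exists ab.
  by move=> /obox_cbox; exact: abP.
exact: countable_bigcup_measurable (fun ab _ => measurable_obox _ _).
Qed.

Lemma closed_measurable_rV (A : set E) : closed A -> measurable A.
Proof.
move=> cA; rewrite -(setCK A); apply: measurableC; apply: open_measurable_rV.
exact: closed_openC.
Qed.

Lemma continuous_measurable_rV (f : E -> R) : continuous f ->
  measurable_fun setT (f : E -> measurableTypeR R).
Proof.
move=> cf; apply: (measurability _ (RGenOpens.measurableE R)).
move=> _ [_ [a [b ->] <-]]; rewrite setTI; apply: open_measurable_rV.
by move/continuousP : cf; apply; exact: interval_open.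
Qed.

End boxes.

Section leb_integral.
Context {R : realType}.
Local Notation lambda := (@lebesgue_measure R).
Local Notation pt' n := (fun p : 'rV[R]_n * measurableTypeR R => pt p.1 p.2).

Lemma pt_shift n (x : 'rV[R]_n) t s j :
  pt x t + s *: delta_mx 0 (lift ord_max j) = pt (x + s *: delta_mx 0 j) t.
Proof.
apply/rowP => k; rewrite !mxE eqxx /=; case: (unliftP ord_max k) => [l ->|->].
  by rewrite !mxE eqxx (inj_eq lift_inj).
by rewrite (negbTE (neq_lift _ _)) mulr0 addr0.
Qed.

Lemma pt_shift_last n (x : 'rV[R]_n) t s :
  pt x t + s *: delta_mx 0 ord_max = pt x (t + s).
Proof.
apply/rowP => k; rewrite !mxE eqxx /=; case: (unliftP ord_max k) => [l ->|->].
  by rewrite eq_sym (negbTE (neq_lift _ _)) mulr0 addr0.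
by rewrite eqxx mulr1.
Qed.

Definition cube n (M : R) : set 'rV[R]_n := cbox (const_mx (- M)) (const_mx M).

Lemma cubeE n M (x : 'rV[R]_n) : cube n M x = forall i, `|x 0 i| <= M.
Proof.
by apply/propext; split=> xM i; have := xM i; rewrite /= !mxE ler_norml.
Qed.

Lemma measurable_cube n M : measurable (cube n M).
Proof. exact: closed_measurable_rV (closed_cbox _ _). Qed.

Lemma pt_cube n M : pt' n @^-1` cube n.+1 M = cube n M `*` [set t | `|t| <= M].
Proof.
apply/seteqP; split=> [[x t]|[x t]] /=; rewrite !cubeE.
  move=> xM; split=> [i|]; last by have := xM ord_max; rewrite mxE unlift_none.
  by have := xM (lift ord_max i); rewrite mxE liftK.
move=> [xM tM] i; rewrite mxE; case: (unliftP ord_max i) => [l il|//].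
exact: xM.
Qed.

Lemma leb_cube n M : (leb R n (cube n M) < +oo)%E.
Proof.
elim: n => [|n IHn]; first by rewrite /= diracE ltry.
rewrite (_ : leb _ _ _ = (leb R n \x lambda)%E (pt' n @^-1` cube n.+1 M))// pt_cube.
have -> : [set t : R | `|t| <= M] = `[- M, M]%classic.
  by apply/seteqP; split=> t; rewrite /= in_itv /= ler_norml.
have lI : (lambda `[(- M)%R, M]%classic < +oo)%E.
  by rewrite lebesgue_measure_itv /=; case: ifPn => _; rewrite -?EFinB ltry.
rewrite (product_measure1E (leb R n) lambda); [|exact: measurable_cube|by []].
by rewrite lte_mul_pinfty// ge0_fin_numE.
Qed.

(** One constant controls both values and support. The class consists of integrable functions and is
    stable under freezing the last coordinate, as an iterated use of Fubini requires. *)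
Definition bounded_supp {n} (f : 'rV[R]_n -> R) (M : R) :=
  [/\ measurable_fun setT f, forall z, `|f z| <= M & forall z, ~ cube n M z -> f z = 0].

Lemma bounded_supp_restrict n (f : 'rV[R]_n -> R) M : bounded_supp f M ->
  f = f \_ (cube n M).
Proof.
move=> [_ _ f0]; apply/funext => z; rewrite patchE.
by case: ifPn => // /negP; rewrite inE => /f0.
Qed.

Lemma bounded_supp_integrable n (f : 'rV[R]_n -> R) M : bounded_supp f M ->
  (leb R n).-integrable setT (EFin \o f).
Proof.
move=> fM; rewrite (bounded_supp_restrict _ _ _ fM).
rewrite -restrict_EFin; apply/(integrable_mkcond _ (measurable_cube _ _)).
case: fM => mf fM f0; apply: measurable_bounded_integrable.
- exact: measurable_cube.
- exact: leb_cube.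
- exact: measurable_funTS.
- exists M; split=> [|N MN z _]; first exact: num_real.
  exact: le_trans (fM z) (ltW MN).
Qed.

Lemma bounded_supp_integrable_pt n (f : 'rV[R]_n.+1 -> R) M : bounded_supp f M ->
  (leb R n \x lambda)%E.-integrable setT (EFin \o f \o pt' n).
Proof.
move=> fM; rewrite (bounded_supp_restrict _ _ _ fM).
have mpt := @measurable_pt R n.
have mC : measurable (pt' n @^-1` cube n.+1 M).
  by rewrite -[X in measurable X]setTI; apply: mpt => //; exact: measurable_cube.
rewrite (_ : _ \o _ = (EFin \o (f \o pt' n)) \_ (pt' n @^-1` cube n.+1 M)); last first.
  by apply/funext => p; rewrite /= /patch -[p \in _]/(pt p.1 p.2 \in cube n.+1 M); case: ifPn.
apply/(integrable_mkcond _ mC).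
case: fM => mf fM f0; apply: measurable_bounded_integrable => //.
- exact: (leb_cube n.+1 M).
- by apply: measurable_funTS; exact: measurableT_comp.
- exists M; split=> [|N MN z _]; first exact: num_real.
  exact: le_trans (fM _) (ltW MN).
Qed.

Lemma integral_pt n (f : 'rV[R]_n.+1 -> R) M : bounded_supp f M ->
  (\int[leb R n.+1]_z (f z)%:E = \int[leb R n \x lambda]_p (f (pt p.1 p.2))%:E)%E.
Proof.
move=> fM; have [mf _ _] := fM.
have intf := bounded_supp_integrable_pt _ _ _ fM.
have mf' : measurable_fun setT (EFin \o f) by exact: measurableT_comp.
by have := integral_pushforward (@measurable_pt R n) mf' intf measurableT.
Qed.

Lemma bounded_supp_slice n (f : 'rV[R]_n.+1 -> R) M t : bounded_supp f M ->
  bounded_supp (fun x => f (pt x t)) M.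
Proof.
move=> [mf fM f0]; split=> //.
  apply: measurableT_comp => //.
  exact: (measurableT_comp (@measurable_pt R n) (measurable_pair2 t)).
move=> x xM; apply: f0; rewrite cubeE => H; apply: xM; rewrite cubeE => i.
by have := H (lift ord_max i); rewrite mxE liftK.
Qed.

(** Induction on the dimension. If [i] is the last coordinate, Fubini integrates along it first and
    meets zero; otherwise the last coordinate is frozen and the slice falls under the induction
    hypothesis. *)
Lemma slice_integral0 n (i : 'I_n) (f : 'rV[R]_n -> R) M : bounded_supp f M ->
  (forall z, \int[lambda]_s (f (z + s *: delta_mx 0 i))%:E = 0)%E ->
  (\int[leb R n]_z (f z)%:E = 0)%E.
Proof.
elim: n i f => [[]//|n IHn] i f fM f0; rewrite (integral_pt _ _ _ fM).
have intf := bounded_supp_integrable_pt _ _ _ fM.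
case: (unliftP ord_max i) => [j ij|il].
  rewrite -(integral21_prod_meas1 intf) integral0_eq// => t _.
  rewrite /fubini_G /=; apply: (IHn j _ (bounded_supp_slice _ _ _ _ fM)) => x.
  by under eq_integral => s _ do rewrite -pt_shift -ij.
rewrite -(integral12_prod_meas1 intf) integral0_eq// => x _.
rewrite /fubini_F /= -(f0 (pt x 0)) il.
by apply: eq_integral => s _; rewrite pt_shift_last add0r.
Qed.

End leb_integral.

(** * The divergence identity *)

Section integral_derivative.
Context {R : realType}.
Local Notation lambda := (@lebesgue_measure R).

Lemma open_interval_itv (I : set R) (M : R) : open I -> is_interval I -> I !=set0 ->
  (forall x, I x -> `|x| <= M) -> I = `]inf I, sup I[%classic.
Proof.
move=> oI iI I0 IM.
have hs : has_sup I.
  by split=> //; exists M => x /IM; rewrite ler_norml => /andP[].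
have hi : has_inf I.
  by split=> //; exists (- M) => x /IM; rewrite ler_norml => /andP[].
apply/seteqP; split=> x /=; rewrite in_itv /=.
  move=> Ix; have : nbhs x I by move: oI; rewrite openE; exact.
  move=> /nbhs_ballP[e /= e0 eI].
  have I1 : I (x - e / 2).
    by apply: eI; rewrite /ball/= opprB addrC subrK gtr0_norm ?divr_gt0//; lra.
  have I2 : I (x + e / 2).
    by apply: eI; rewrite /ball/= opprD addrA subrr add0r normrN gtr0_norm ?divr_gt0//; lra.
  have := ge_inf hi.2 I1; have := ub_le_sup hs.2 I2 => ? ?.
  by apply/andP; split; lra.
move=> /andP[xi xs].
have [a Ia ax] := inf_lt I0 xi; have [b Ib xb] := sup_gt I0 xs.
by apply: (iI a b) => //; rewrite !ltW.
Qed.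

Lemma integral_itv_derivative (f f' : R -> R) (a b : R) : (a < b)%R ->
  (forall x : R, is_derive x 1 f (f' x)) -> continuous f' ->
  (\int[lambda]_(x in `]a, b[) (f' x)%:E = (f b)%:E - (f a)%:E)%E.
Proof.
move=> ab df cf'.
have cf x : f y @[y --> x] --> f x.
  by apply/differentiable_continuous/derivable1_diffP; have [] := df x.
rewrite -(@integral_itv_bndoo _ _ _ (EFin \o f') true false); last first.
  by apply/measurable_funTS/measurableT_comp => //; exact: continuous_measurable_fun.
rewrite (continuous_FTC2 (F := f) ab)//.
- exact: continuous_subspaceT.
- split=> [x _||]; first by have [] := df x.
    exact/cvg_at_right_filter/cf.
  exact/cvg_at_left_filter/cf.
- by move=> x _; rewrite derive1E; have [_ ->] := df x.
Qed.

(** [U] is a disjoint union of countably many open intervals. An endpoint of one cannot lie in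
    another, which being open would meet the first; so it lies in the closure of [U] but outside
    [U], [f] vanishes there, and the fundamental theorem of calculus gives zero on each interval. *)
Lemma integral_derivative_open (U : set R) (f f' : R -> R) (M : R) : open U ->
  (forall x, U x -> `|x| <= M) ->
  (forall x : R, is_derive x 1 f (f' x)) -> continuous f' ->
  (forall x, ~ U x -> closure U x -> f x = 0) ->
  (\int[lambda]_(x in U) (f' x)%:E = 0)%E.
Proof.
move=> oU UM df cf' f0.
pose I := open_disjoint_itv oU.
have UI : U = \bigcup_k I k := open_disjoint_itv_bigcup oU.
have oI k : open (I k) by exact: open_disjoint_itv_open.
have iI k : is_interval (I k) by exact: open_disjoint_itv_is_interval.
have tI : trivIset setT I by exact: open_disjoint_itv_trivIset.
have IM k x : I k x -> `|x| <= M by move=> Ikx; apply: UM; rewrite UI; exists k.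
have mf' : measurable_fun setT f' by exact: continuous_measurable_fun.
have UMM : U `<=` `[- M, M]%classic.
  by move=> x /UM; rewrite /= in_itv /= ler_norml.
have intf : lambda.-integrable U (EFin \o f').
  have : lambda.-integrable `[- M, M]%classic (EFin \o f').
    apply: continuous_compact_integrable; first exact: segment_compact.
    exact: continuous_subspaceT.
  by apply: integrableS => //; exact: open_measurable.
have endpoint k x : I k !=set0 -> closure (I k) x -> ~ I k x -> f x = 0.
  move=> Ik0 cx Ikx; apply: f0; last first.
    by move: cx; apply: closureS; rewrite UI; exact: bigcup_sup.
  rewrite UI => -[j _ Ijx]; apply: Ikx.
  have /cx[y [Iky Ijy]] : nbhs x (I j) by move: (oI j); rewrite openE; exact.
  suff -> : k = j by []; by apply: (tI k j) => //; exists y.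
rewrite UI integral_bigcup//; last 2 first.
- by move=> k; exact: open_measurable.
- by rewrite -UI.
rewrite eseries0// => k _ _.
have [->|/set0P Ik0] := eqVneq (I k) set0; first by rewrite integral_set0.
have IE := open_interval_itv _ _ (oI k) (iI k) Ik0 (IM k).
have hs : has_sup (I k).
  by split=> //; exists M => x /IM; rewrite ler_norml => /andP[].
have hi : has_inf (I k).
  by split=> //; exists (- M) => x /IM; rewrite ler_norml => /andP[].
have ab : inf (I k) < sup (I k).
  by case: Ik0 => x; rewrite {1}IE /= in_itv /= => /andP[]; exact: lt_trans.
rewrite IE (integral_itv_derivative f)//.
have fs : f (sup (I k)) = 0.
  apply: (endpoint k) => //; first by apply: closure_sup => //; case: hs.
  by rewrite IE /= in_itv /= -IE ltxx andbF.
have fi : f (inf (I k)) = 0.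
  apply: (endpoint k) => //.
    move=> B /nbhs_ballP[e /= e0 eB]; have [x Ikx xe] := inf_adherent e0 hi.
    exists x; split=> //; apply: eB; rewrite /ball/= distrC ger0_norm.
      by rewrite ltrBlDl.
    by rewrite subr_ge0; apply: ge_inf => //; case: hi.
  by rewrite IE /= in_itv /= -IE ltxx.
rewrite fs fi.
by rewrite subee.
Qed.

Lemma is_derive_line n (h : 'rV[R]_n -> R) (v z : 'rV[R]_n) (s : R) :
  derivable h (z + s *: v) v ->
  is_derive s 1 (fun r : R => h (z + r *: v)) ('D_v h (z + s *: v)).
Proof.
move=> dh.
have E : (fun r : R => r^-1 *: (((fun r : R => h (z + r *: v)) \o shift s) (r *: 1) - h (z + s *: v))) =
    (fun r : R => r^-1 *: ((h \o shift (z + s *: v)) (r *: v) - h (z + s *: v))).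
  apply/funext => r /=; congr (_ *: (h _ - _)).
  by rewrite [r%:A]mulr1 scalerDl addrCA.
by apply: DeriveDef; rewrite /derivable /derive E.
Qed.

Lemma open_line n (K : set 'rV[R]_n) (z v : 'rV[R]_n) : open K ->
  open [set r : R | K (z + r *: v)].
Proof.
move=> oK; apply: (open_comp (f := fun r : R => z + r *: v)) => // r _.
by apply: cvgD; [exact: cvg_cst|apply: cvgZr_tmp; exact: cvg_id].
Qed.

Lemma continuous_line n (h : 'rV[R]_n -> R) (z v : 'rV[R]_n) : continuous h ->
  continuous (fun r : R => h (z + r *: v)).
Proof.
move=> ch r; apply: (continuous_comp (f := fun r : R => z + r *: v)); last exact: ch.
by apply: cvgD; [exact: cvg_cst|apply: cvgZr_tmp; exact: cvg_id].
Qed.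

Lemma continuous_cube_bounded n (h : 'rV[R]_n -> R) M : continuous h ->
  exists N, forall z, cube n M z -> `|h z| <= N.
Proof.
move=> ch; have /compact_bounded[N [_ NP]] : compact (h @` cube n M).
  apply: continuous_compact; first exact: continuous_subspaceT.
  exact: compact_cbox.
exists (N + 1) => z Mz; apply: (NP (N + 1)); first by rewrite ltrDl.
by exists z.
Qed.

Lemma restrict_bounded_supp n (K : set 'rV[R]_n) (h : 'rV[R]_n -> R) M :
  measurable K -> K `<=` cube n M -> continuous h ->
  exists N, bounded_supp (h \_ K) N.
Proof.
move=> mK KM ch; have [N NP] := continuous_cube_bounded n h M ch.
exists (Num.max `|N| `|M|); split.
- apply/(measurable_restrictT _ mK); apply: measurable_funTS.
  exact: continuous_measurable_rV.
- move=> z; rewrite patchE; case: ifPn => [/set_mem/KM/NP zN|_].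
    by rewrite (le_trans zN)// le_max ler_norm.
  by rewrite normr0 le_max normr_ge0.
- move=> z zM; rewrite patchE; case: ifPn => // /set_mem/KM Mz; exfalso.
  apply: zM; move: Mz; rewrite !cubeE => Mz i; rewrite (le_trans (Mz i))//.
  by rewrite (le_trans (ler_norm M))// le_max lexx orbT.
Qed.

(* No regularity of [K] is needed: each slice of [K] is a countable union of
   intervals at whose ends [h] vanishes. *)
Lemma integral_partial0 n (i : 'I_n) (K : set 'rV[R]_n) (h : 'rV[R]_n -> R) M :
  open K -> K `<=` cube n M ->
  (forall z, derivable h z (delta_mx 0 i)) -> continuous (partial i h) ->
  (forall z s, ~ K (z + s *: delta_mx 0 i) ->
     closure [set r : R | K (z + r *: delta_mx 0 i)] s ->
     h (z + s *: delta_mx 0 i) = 0) ->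
  \int[leb R n]_(z in K) partial i h z = 0.
Proof.
move=> oK KM dh ch h0; have mK := open_measurable_rV _ oK.
have [N hN] := restrict_bounded_supp _ _ _ _ mK KM ch.
rewrite Rintegral_mkcond /Rintegral (slice_integral0 _ i _ N)// => z.
pose U := [set r : R | K (z + r *: delta_mx 0 i)].
have mU : measurable U by apply: open_measurable; exact: open_line.
transitivity (\int[lambda]_(s in U) (partial i h (z + s *: delta_mx 0 i))%:E)%E.
  rewrite [RHS]integral_mkcond; apply: eq_integral => s _.
  by rewrite /= !patchE -[s \in U]/(z + s *: _ \in K); case: ifPn.
(* On the line through [z] the parameter is the [i]-th coordinate minus [z 0 i], whence the bound
   [M + |z 0 i|]. *)
apply: (integral_derivative_open _ (fun s : R => h (z + s *: delta_mx 0 i)) _ (M + `|z 0 i|)).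
- exact: open_line.
- move=> s /KM; rewrite cubeE => /(_ i); rewrite !mxE !eqxx mulr1 => H.
  have -> : s = (z 0 i + s) - z 0 i by rewrite addrC addKr.
  by rewrite (le_trans (ler_normB _ _))// lerD2r.
- by move=> s; exact: is_derive_line.
- exact: continuous_line.
- by move=> s; exact: h0.
Qed.

End integral_derivative.

(** * Smooth functions and bumps *)

Section Ck.
Context {R : realType} {V : normedModType R} {I : Type} (e : I -> V).
Implicit Types f g : V -> R.

(** Finite orders permit induction; [smooth] is recovered from all of them. The family of directions
    [e] is a parameter so that functions of one real variable, with the single direction 1, and
    functions on row vectors share the closure lemmas. *)
Fixpoint Ck k f : Prop := continuous f /\
  if k is k'.+1 then
    forall i, (forall z, derivable f z (e i)) /\ Ck k' ('D_(e i) f)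
  else True.

Lemma Ck_continuous k f : Ck k f -> continuous f.
Proof. by case: k => [|k] []. Qed.

Lemma CkS k f (df : I -> V -> R) : continuous f ->
  (forall i z, is_derive z (e i) f (df i z)) -> (forall i, Ck k (df i)) -> Ck k.+1 f.
Proof.
move=> cf dfE cdf; split=> // i; split=> [z|]; first by have [] := dfE i z.
have -> : 'D_(e i) f = df i by apply/funext => z; have [_ ->] := dfE i z.
exact: cdf.
Qed.

Lemma Ck_is_derive k f i z : Ck k.+1 f -> is_derive z (e i) f ('D_(e i) f z).
Proof. by case=> _ /(_ i)[df _]; exact: DeriveDef. Qed.

Lemma Ck_derive k f i : Ck k.+1 f -> Ck k ('D_(e i) f).
Proof. by case=> _ /(_ i)[]. Qed.

Lemma Ck_pred k f : Ck k.+1 f -> Ck k f.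
Proof.
elim: k f => [|k IHk] f cf; first by split=> //; exact: Ck_continuous cf.
apply: (CkS _ _ (fun i => 'D_(e i) f)) => [|i z|i]; first exact: Ck_continuous cf.
- exact: Ck_is_derive cf.
- exact/IHk/Ck_derive.
Qed.

Lemma Ck_cst k (a : R) : Ck k (cst a).
Proof.
elim: k a => [|k IHk] a; first by split=> //; exact: cst_continuous.
refine (CkS _ _ (fun _ => cst 0) _ _ (fun=> IHk 0)); first exact: cst_continuous.

Qed.

Lemma CkD k f g : Ck k f -> Ck k g -> Ck k (f + g).
Proof.
elim: k f g => [|k IHk] f g cf cg.
  by split=> // z; apply: cvgD; [exact: Ck_continuous cf z|exact: Ck_continuous cg z].
apply: (CkS _ _ (fun i => 'D_(e i) f + 'D_(e i) g)) => [z|i z|i].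
- by apply: cvgD; [exact: Ck_continuous cf z|exact: Ck_continuous cg z].
- by apply: is_deriveD; [exact: Ck_is_derive cf|exact: Ck_is_derive cg].
- by apply: IHk; exact: Ck_derive.
Qed.

Lemma CkM k f g : Ck k f -> Ck k g -> Ck k (f * g).
Proof.
elim: k f g => [|k IHk] f g cf cg.
  by split=> // z; apply: cvgM; [exact: Ck_continuous cf z|exact: Ck_continuous cg z].
apply: (CkS _ _ (fun i => f * 'D_(e i) g + g * 'D_(e i) f)) => [z|i z|i].
- by apply: cvgM; [exact: Ck_continuous cf z|exact: Ck_continuous cg z].
- by apply: is_deriveM; [exact: Ck_is_derive cf|exact: Ck_is_derive cg].
- by apply: CkD; apply: IHk; do ?[exact: Ck_derive|exact: Ck_pred].
Qed.

Lemma Ck_prod k (J : Type) (s : seq J) (F : J -> V -> R) :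
  (forall j, Ck k (F j)) -> Ck k (\prod_(j <- s) F j).
Proof.
move=> cF; elim: s => [|j s IHs]; first by rewrite big_nil; exact: Ck_cst.
by rewrite big_cons; exact: CkM.
Qed.

End Ck.

Section smooth.
Context {R : realType}.

Definition std_basis n (i : 'I_n) : 'rV[R]_n := delta_mx 0 i.
Local Notation Ck1 := (Ck (fun _ : unit => (1 : R))).
Local Notation Ckn n := (Ck (@std_basis n)).

Lemma Ck_smooth n (f : 'rV[R]_n -> R) : (forall k, Ckn n k f) -> smooth f.
Proof.
move=> cf s; have H k : Ckn n k (iter_partial s f).
  elim: s k => [|i s IHs] k; first exact: cf.
  exact/(Ck_derive (@std_basis n))/(IHs k.+1).
split; first exact: Ck_continuous (H 0).
by move=> i z; have [_ /(_ i)[]] := H 1.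
Qed.

Lemma smooth_Ck1 n (f : 'rV[R]_n -> R) : smooth f -> Ckn n 1 f.
Proof.
move=> sf; have [cf df] := sf [::]; split=> // i; split; first exact: df.
by split=> //; have [] := sf [:: i].
Qed.

Lemma Ck_affine k (h : R -> R) (a b : R) : Ck1 k h ->
  Ck1 k (fun s => h (a * s + b)).
Proof.
have ca : continuous (fun s : R => a * s + b).
  by move=> s; apply: cvgD; [apply: cvgMl_tmp; exact: cvg_id|exact: cvg_cst].
elim: k h => [|k IHk] h ch.
  by split=> // s; apply: continuous_comp; [exact: ca|exact: Ck_continuous ch _].
apply: (CkS _ _ _ (fun _ => cst a * (fun s => 'D_1 h (a * s + b)))) => [s|_ s|_].
- by apply: continuous_comp; [exact: ca|exact: Ck_continuous ch _].
- have -> : (cst a * (fun s => 'D_1 h (a * s + b))) s = 'D_1 h (a * s + b) * a.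
    by rewrite mulrC.
  apply: (is_derive1_comp (f := h) (g := fun s => a * s + b)).
    exact: (Ck_is_derive _ _ _ tt _ ch).
  have := is_deriveD (is_deriveZ a (is_derive_id s 1)) (is_derive_cst b s 1).
  by rewrite addr0 [_%:A]mulr1.
- by apply: CkM; [exact: Ck_cst|exact: (IHk _ (Ck_derive _ _ _ tt ch))].
Qed.

Lemma is_derive_coord n (h : R -> R) (i j : 'I_n) (x : 'rV[R]_n) (dh : R) :
  is_derive (x 0 i) 1 h dh ->
  is_derive x (std_basis n j) (fun x : 'rV[R]_n => h (x 0 i)) ((i == j)%:R * dh).
Proof.
have [<-|ij] := eqVneq i j => hd; last first.
  have E : (fun r : R => r^-1 *: (((fun x : 'rV[R]_n => h (x 0 i)) \o shift x) (r *: std_basis n j) - h (x 0 i))) = cst 0.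
    apply/funext => r /=; rewrite !mxE eqxx (negbTE ij) mulr0 add0r subrr.
    by rewrite scaler0.
  rewrite mul0r; apply: DeriveDef; rewrite /derivable /derive E.
    exact: is_cvg_cst.
  exact: lim_cst.
have E : (fun r : R => r^-1 *: (((fun x : 'rV[R]_n => h (x 0 i)) \o shift x) (r *: std_basis n i) - h (x 0 i))) =
    (fun r : R => r^-1 *: ((h \o shift (x 0 i)) (r *: 1) - h (x 0 i))).
  by apply/funext => r /=; rewrite !mxE eqxx eqxx.
by rewrite mul1r; case: hd => hd1 <-; apply: DeriveDef; rewrite /derivable /derive E.
Qed.

Lemma Ck_coord n k (h : R -> R) (i : 'I_n) : Ck1 k h ->
  Ckn n k (fun x : 'rV[R]_n => h (x 0 i)).
Proof.
elim: k h => [|k IHk] h ch.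
  split=> // x; apply: continuous_comp; first exact: coord_cvg.
  exact: Ck_continuous ch _.
apply: (CkS _ _ _ (fun j => cst (i == j)%:R * (fun x : 'rV[R]_n => 'D_1 h (x 0 i)))).
- move=> x; apply: continuous_comp; first exact: coord_cvg.
  exact: Ck_continuous ch _.
- by move=> j x; apply: is_derive_coord; exact: (Ck_is_derive _ _ _ tt (x 0 i) ch).
- move=> j; apply: CkM; first exact: Ck_cst.
  exact: (IHk _ (Ck_derive _ _ _ tt ch)).
Qed.

(* The derivatives of [exp (- 1 / x)], extended by [0] to [x <= 0], are linear
   combinations of these. *)
Definition flat m (x : R) : R := if 0 < x then x^-1 ^+ m * expR (- x^-1) else 0.

(** With [y = 1 / x], one term of the exponential series gives [y^(m+1) <= (m+1)! exp y]; divide by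
    [y exp y]. *)
Lemma flat_bound m x : 0 < x -> `|flat m x| <= m.+1`!%:R * x.
Proof.
move=> x0; rewrite /flat x0 ger0_norm; last first.
  by rewrite mulr_ge0 ?expR_ge0// exprn_ge0// invr_ge0 ltW.
have y0 : 0 < x^-1 by rewrite invr_gt0.
have := expR_ge1Dxn m (ltW y0).
have f0 : 0 < m.+1`!%:R :> R by rewrite ltr0n fact_gt0.
rewrite expRN ler_pdivrMr ?expR_gt0// => H.
have {}H : x^-1 ^+ m.+1 <= m.+1`!%:R * expR x^-1.
  by rewrite -ler_pdivrMl// mulrC; apply: le_trans H; rewrite lerDr.
rewrite -mulrA mulrCA -ler_pdivrMl// -exprS//.
Qed.

Lemma flat_le0 m x : x <= 0 -> flat m x = 0.
Proof. by rewrite /flat ltNge => ->. Qed.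

Lemma flat_derive m x : is_derive x (1 : R) (flat m) (flat m.+2 x - m%:R * flat m.+1 x).
Proof.
have [x0|x0|->] := ltrgtP x 0.
- rewrite !(flat_le0 _ x) ?ltW// mulr0 subr0.
  apply: (near_eq_is_derive _ (is_derive_cst (0 : R) x 1)).
  by near=> y; rewrite flat_le0// ltW//; near: y; exact: lt_nbhsl.
- have D : is_derive x (1 : R) (fun y => y^-1 ^+ m * expR (- y^-1))
      (flat m.+2 x - m%:R * flat m.+1 x).
    have dV : is_derive x (1 : R) (fun y : R => y^-1) (- x ^- 2 *: 1).
      exact: (@is_deriveV _ id x 1 1 (lt0r_neq0 x0) (is_derive_id x 1)).
    have dE := @is_derive1_comp _ expR (fun y => - y^-1) x _ _ (is_derive_expR (- x^-1)) (is_deriveN dV).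
    have -> : (fun y : R => y^-1 ^+ m * expR (- y^-1)) =
        (fun y : R => y^-1) ^+ m * (expR \o (fun y : R => - y^-1)).
      by apply/funext => y; rewrite mulrfctE exprfctE.
    apply: (is_derive_eq (is_deriveM (is_deriveX m dV) dE)).
    rewrite /flat x0 exprfctE /= ![_%:A]mulr1 opprK -exprVn -![_ *: _]/(_ * _).
    set y := x^-1; set E := expR _; case: (m) => [|j]; first by rewrite !expr0; ring.
    by rewrite /= !exprS; ring.
  apply: near_eq_is_derive D.
  near=> y; rewrite /flat ifT//; near: y; exact: lt_nbhsr.
- rewrite !(flat_le0 _ 0)// mulr0 subr0.
  (* At 0 the difference quotient is itself [flat m.+1 h] for positive [h] and zero for negative
     [h], so [flat_bound] makes it tend to 0. *)
  have H : (fun h : R => h^-1 *: ((flat m \o shift 0) (h *: 1) - flat m 0)) @ 0^' --> (0 : R).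
    apply/cvgrPdist_le => e e0; have C0 : 0 < m.+2`!%:R :> R by rewrite ltr0n fact_gt0.
    near=> h; rewrite sub0r normrN /= addr0 [h%:A]mulr1 (flat_le0 _ 0)// subr0.
    have h0 : h != 0 by near: h; exact: nbhs_dnbhs_neq.
    have [hp|hn] := ltrP 0 h; last by rewrite flat_le0// scaler0 normr0 ltW.
    have -> : h^-1 *: flat m h = flat m.+1 h.
      by rewrite /flat hp -[_ *: _]/(_ * _) mulrA -exprS.
    apply: (le_trans (flat_bound _ _ hp)); rewrite -ler_pdivlMl// mulrC -[leLHS]ger0_norm ?ltW//.
    by near: h; apply: dnbhs0_lt; rewrite divr_gt0.
  by apply: DeriveDef; [apply/cvg_ex; exists 0|exact: cvg_lim H].
Unshelve. all: by end_near. Qed.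

Lemma flat_Ck k m : Ck1 k (flat m).
Proof.
have cf j x : flat j y @[y --> x] --> flat j x.
  by apply/differentiable_continuous/derivable1_diffP; have [] := flat_derive j x.
elim: k m => [|k IHk] m; first by split=> // x; exact: cf.
apply: (CkS _ _ _ (fun _ => flat m.+2 + cst (- m%:R) * flat m.+1)) => [x|_ x|_].
- exact: cf.
- by have := flat_derive m x; rewrite -mulNr.
- by apply: CkD => //; apply: CkM => //; exact: Ck_cst.
Qed.

(** Each factor is [exp (- 1 / ((k+1) t))] where [t > 0] and zero elsewhere. Dilating by [k+1] lets
    it tend to 1 without changing where it vanishes. *)
Definition bump n (a b : 'rV[R]_n) (k : nat) (x : 'rV[R]_n) : R :=
  \prod_i (flat 0 (k.+1%:R * (x 0 i - a 0 i)) * flat 0 (k.+1%:R * (b 0 i - x 0 i))).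

Lemma bump_smooth n a b k : smooth (bump n a b k).
Proof.
apply: Ck_smooth => j.
have -> : bump n a b k = \prod_(i <- enum 'I_n)
   ((fun x : 'rV[R]_n => flat 0 (k.+1%:R * (x 0 i - a 0 i))) * (fun x => flat 0 (k.+1%:R * (b 0 i - x 0 i)))).
  apply/funext => x; rewrite /bump -big_enum /=.
  elim: (enum _) => [|i s IHs]; first by rewrite !big_nil.
  by rewrite !big_cons IHs.
apply: Ck_prod => i; apply: CkM.
  apply: (Ck_coord n j (fun s => flat 0 (k.+1%:R * (s - a 0 i)))).
  have -> : (fun s => flat 0 (k.+1%:R * (s - a 0 i))) =
      (fun s => flat 0 (k.+1%:R * s + - (k.+1%:R * a 0 i))).
    by apply/funext => s; congr flat; ring.
  exact/Ck_affine/flat_Ck.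
apply: (Ck_coord n j (fun s => flat 0 (k.+1%:R * (b 0 i - s)))).
have -> : (fun s => flat 0 (k.+1%:R * (b 0 i - s))) =
    (fun s => flat 0 (- k.+1%:R * s + k.+1%:R * b 0 i)).
  by apply/funext => s; congr flat; ring.
exact/Ck_affine/flat_Ck.
Qed.

Lemma flat0_ge0 x : 0 <= flat 0 x <= 1.
Proof.
rewrite /flat; case: ifPn => [x0|_]; last by rewrite lexx ler01.
by rewrite expr0 mul1r expR_ge0 expR_le1 oppr_le0 invr_ge0 ltW.
Qed.

Lemma bump_ge0 n a b k x : 0 <= bump n a b k x <= 1.
Proof.
apply/andP; split.
  by apply: prodr_ge0 => i _; rewrite mulr_ge0//; have /andP[] := flat0_ge0 (k.+1%:R * (x 0 i - a 0 i)); have /andP[] := flat0_ge0 (k.+1%:R * (b 0 i - x 0 i)).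
apply: prodr_ile1 => i _.
have /andP[u0 u1] := flat0_ge0 (k.+1%:R * (x 0 i - a 0 i)).
have /andP[v0 v1] := flat0_ge0 (k.+1%:R * (b 0 i - x 0 i)).
by rewrite mulr_ge0// mulr_ile1.
Qed.

Lemma bump_out n a b k x : ~ obox a b x -> bump n a b k x = 0.
Proof.
move=> /existsNP[i /negP]; rewrite negb_and -!leNgt => H.
rewrite /bump (bigD1 i)//=; case/orP: H => H.
  by rewrite (flat_le0 _ (_ * (x 0 i - _))) ?mul0r// mulr_ge0_le0// subr_le0.
by rewrite (flat_le0 _ (_ * (_ - x 0 i))) ?mulr0 ?mul0r// mulr_ge0_le0// subr_le0.
Qed.

Lemma flat0_cvg (t : R) : 0 < t -> flat 0 (k.+1%:R * t) @[k --> \oo] --> (1 : R).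
Proof.
move=> t0.
have -> : (fun k : nat => flat 0 (k.+1%:R * t)) =
    (fun k : nat => expR (- (t^-1 * harmonic k))).
  apply/funext => k; rewrite /flat mulr_gt0// expr0 mul1r invfM /harmonic.
  by rewrite [t^-1 * _]mulrC.
have h0 : (- (t^-1 * harmonic k)) @[k --> \oo] --> (- (t^-1 * 0) : R).
  by apply: cvgN; apply: cvgMl_tmp; exact: cvg_harmonic.
have -> : (1 : R) = expR (- (t^-1 * 0)) by rewrite mulr0 oppr0 expR0.
by apply: (cvg_comp _ _ h0); exact: continuous_expR.
Qed.

Lemma bump_cvg n (a b x : 'rV[R]_n) : obox a b x -> bump n a b k x @[k --> \oo] --> (1 : R).
Proof.
move=> xab; have prod_cvg1 (I : Type) (s : seq I) (F : I -> nat -> R) :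
    (forall i, F i k @[k --> \oo] --> (1 : R)) ->
    \prod_(i <- s) F i k @[k --> \oo] --> (1 : R).
  move=> F1; elim: s => [|i s IHs].
    by under eq_fun do rewrite big_nil; exact: cvg_cst.
  have -> : (fun k => \prod_(j <- i :: s) F j k) = F i \* (fun k => \prod_(j <- s) F j k).
    by apply/funext => k; rewrite big_cons.
  by rewrite -[X in _ --> X](mulr1 1); exact: cvgM.
rewrite /bump; apply: prod_cvg1 => i; have /andP[? ?] := xab i.
have := @cvgM _ _ _ _ _ _ (1 : R) (1 : R) (flat0_cvg (x 0 i - a 0 i) _)
  (flat0_cvg (b 0 i - x 0 i) _).
by rewrite !mulr1; apply; rewrite subr_gt0.
Qed.

Lemma bump_test_fun n (K : set 'rV[R]_n) a b k : cbox a b `<=` K ->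
  test_fun K (bump n a b k).
Proof.
move=> abK.
have sab : supp (bump n a b k) `<=` cbox a b.
  rewrite ((closure_id (cbox a b)).1 (closed_cbox a b)).
  apply: closureS => x /=; apply: contraNP => xab; apply/eqP/bump_out.
  by move/obox_cbox.
split; first exact: bump_smooth.
- by apply: subclosed_compact sab; [exact: closed_closure|exact: compact_cbox].
- exact: subset_trans abK.
Qed.

End smooth.

(** * The fundamental lemma of the calculus of variations *)

Lemma countable_bigcup_negligible d (T : sigmaRingType d) (R : realFieldType)
    (mu : {measure set T -> \bar R}) (I : countType) (P : set I) (F : I -> set T) :
  (forall i, P i -> mu.-negligible (F i)) -> mu.-negligible (\bigcup_(i in P) F i).
Proof.
move=> mF; pose G k := if unpickle k is Some i then
  (if i \in P then F i else set0) else set0.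
apply: (@negligibleS _ _ _ _ (\bigcup_k G k)).
  move=> x [i Pi Fix]; exists (pickle i) => //.
  by rewrite /G pickleK mem_set.
apply: negligible_bigcup => k; rewrite /G; case: unpickle => [i|]; last exact: negligible_set0.
by case: ifPn => [/set_mem|_]; [exact: mF|exact: negligible_set0].
Qed.

Section box_generation.
Context {R : realType} {n : nat}.
Local Notation E := 'rV[R]_n.

Definition oboxes : set (set E) := [set A | exists a b, A = obox a b].

Lemma obox_setI (a b a' b' : E) : obox a b `&` obox a' b' =
  obox (\row_i Num.max (a 0 i) (a' 0 i)) (\row_i Num.min (b 0 i) (b' 0 i)).
Proof.
apply/seteqP; split=> x.
  by move=> [xab xab'] i; rewrite !mxE gt_max lt_min; have /andP[-> ->] := xab i; exact: xab'.
move=> H; split=> i; have := H i; rewrite !mxE gt_max lt_min;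
  by move=> /andP[/andP[? ?] /andP[? ?]]; apply/andP.
Qed.

Lemma setI_closed_oboxes : setI_closed oboxes.
Proof.
by move=> _ _ [a [b ->]] [a' [b' ->]]; rewrite obox_setI; eexists; eexists.
Qed.

Lemma measurable_oboxesE : @measurable _ E = <<s oboxes >>.
Proof.
apply/seteqP; split; last first.
  apply: smallest_sub; first exact: sigma_algebra_measurable.
  by move=> _ [a [b ->]]; exact: measurable_obox.
apply: smallest_sub; first exact: smallest_sigma_algebra.
move=> A; rewrite -bigcup_seq => -[i _ [B mB <-]].
have : preimage_set_system setT (rV_coord i) (@measurable _ (measurableTypeR R))
    (setT `&` rV_coord i @^-1` B) by exists B.
rewrite (RGenOpens.measurableE R) -g_sigma_preimageE; move: (setT `&` _).
apply: smallest_sub; first exact: smallest_sigma_algebra.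
move=> _ [_ [s [t ->]] <-]; rewrite setTI.
(* A slab in direction [i] is not a box; it is the union of its truncations in the other
   coordinates. *)
pose F N : set E := obox (\row_j (if j == i then s else - N%:R))
                         (\row_j (if j == i then t else N%:R)).
have -> : rV_coord i @^-1` `]s, t[%classic = \bigcup_N F N.
  apply/seteqP; split=> x.
    rewrite /= in_itv /= => xst; exists (\max_(j < n) (Num.truncn `|x ord0 j|).+1)%N => // j.
    rewrite !mxE; case: eqP => [->//|_]; rewrite -ltr_norml.
    rewrite (lt_le_trans (truncnS_gt _))// ler_nat.
    exact: (leq_bigmax (F := fun j => (Num.truncn `|x ord0 j|).+1)).
  by move=> [N _ /(_ i)]; rewrite !mxE eqxx /= in_itv.
have [_ _] := @smallest_sigma_algebra _ setT oboxes; apply=> N.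
by apply: sub_sigma_algebra; eexists; eexists.
Qed.

(** Open boxes are stable under intersection and generate the Borel sets. By Dynkin's theorem the
    integral of [f] vanishes on every Borel subset of the box, which forces [f = 0] a.e. there. *)
Lemma integral_box0_ae (mu : {measure set E -> \bar R}) (a0 b0 : E) (f : E -> R) :
  mu.-integrable (obox a0 b0) (EFin \o f) ->
  (forall a b : E, (forall i, a0 0 i <= a 0 i /\ b 0 i <= b0 0 i) ->
    (\int[mu]_(x in obox a b) (f x)%:E = 0)%E) ->
  {ae mu, forall x, obox a0 b0 x -> f x = 0}.
Proof.
move=> intf f0; set B := obox a0 b0.
have mB : measurable B by exact: measurable_obox.
have key A : measurable A -> (\int[mu]_(x in B `&` A) (f x)%:E = 0)%E.
  rewrite measurable_oboxesE; move: A.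
  apply: (dynkin_induction measurable_oboxesE setI_closed_oboxes).
  - by rewrite setIT; exact: f0.
  - move=> _ [a [b ->]] /=; rewrite obox_setI; apply: f0 => i.
    by rewrite !mxE le_max ge_min !lexx.
  - move=> S mS S0; have mBS : measurable (B `&` S) by exact: measurableI.
    have mBCS : measurable (B `&` ~` S) by apply: measurableI => //; exact: measurableC.
    have BE : (B `&` S) `|` (B `&` ~` S) = B by rewrite -setIUr setUv setIT.
    have : (\int[mu]_(x in (B `&` S) `|` (B `&` ~` S)) (f x)%:E = 0)%E.
      by rewrite BE; exact: f0.
    rewrite integral_setU_EFin//.
    + by rewrite S0 add0e.
    + by rewrite BE; apply/measurable_EFinP; exact: measurable_int intf.
    + by apply/disj_setPS => x [[_ ?] [_ ?]].
  - move=> F mF tF F0; rewrite setI_bigcupr integral_bigcup//.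
    + by rewrite eseries0.
    + by apply: trivIset_setIl.
    + by move=> k; exact: measurableI.
    + apply: integrableS intf => //.
        by apply: bigcup_measurable => k _; exact: measurableI.
      by move=> x [k _ []].
have /= H : ae_eq mu B (EFin \o f) (cst 0%E).
  apply: integral_ae_eq => // A AB mA.
  by rewrite integral_cst// mul0e; have := key A mA; rewrite setIidr.
by apply: filterS H => x /[apply] -[].
Qed.

End box_generation.

Section square_integrable.
Context {d} {T : measurableType d} {R : realType}.
Variable mu : {measure set T -> \bar R}.
Implicit Types f g : T -> R.

Lemma Lfun2P f : f \in Lfun mu 2%:E <->
  measurable_fun setT f /\ (\int[mu]_x (f x ^+ 2)%:E < +oo)%E.
Proof.
split=> [f2|[mf f2]].
  have mf : measurable_fun setT f.
    by move: (f2); rewrite inE => /andP[+ _]; rewrite inE.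
  split=> //; have /integrableP[_] := Lfun2_integrable_sqr f2.
  by under eq_integral do rewrite /= ger0_norm ?sqr_ge0//.
rewrite inE; apply/andP; split; rewrite inE//=.
rewrite /finite_norm unlock; apply: poweR_lty.
apply: le_lt_trans f2; rewrite le_eqVlt; apply/orP; left; apply/eqP.
by apply: eq_integral => x _; rewrite /= powR_mulrn// real_normK// num_real.
Qed.

Lemma Lfun2_mul_integrable f g : f \in Lfun mu 2%:E -> g \in Lfun mu 2%:E ->
  mu.-integrable setT (EFin \o (f \* g)).
Proof. by move=> f2 g2; exact/Lfun1_integrable/Lfun2_mul_Lfun1. Qed.

Lemma Lfun2_measurable f : f \in Lfun mu 2%:E -> measurable_fun setT f.
Proof. by move=> /Lfun2P[]. Qed.

End square_integrable.

Section fundamental_lemma.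
Context {R : realType} {n : nat}.
Local Notation E := 'rV[R]_n.
Local Notation mu := (leb R n).

Lemma cbox_cube (a b : E) : exists M, cbox a b `<=` cube n M.
Proof.
exists (\sum_i (`|a 0 i| + `|b 0 i|)) => x xab; rewrite cubeE => i.
have /andP[ax xb] := xab i.
rewrite (bigD1 i)//= ler_wpDr//; first by apply: sumr_ge0 => j _; rewrite addr_ge0.
rewrite ler_norml; apply/andP; split.
  apply: le_trans ax; rewrite lerNl (le_trans (ler_norm _))// normrN lerDl.
  exact: normr_ge0.
by apply: (le_trans xb); rewrite (le_trans (ler_norm _))// lerDr.
Qed.

Lemma measurable_cbox (a b : E) : measurable (cbox a b).
Proof. exact: closed_measurable_rV (closed_cbox _ _). Qed.

Lemma leb_cbox (a b : E) : (mu (cbox a b) < +oo)%E.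
Proof.
have [M abM] := cbox_cube a b; apply: le_lt_trans (leb_cube n M).
by apply: le_measure => //; rewrite inE; [exact: measurable_cbox|exact: measurable_cube].
Qed.

(** On a set of finite measure, [|f| <= 1 + f^2] suffices. *)
Lemma Lfun2_integrable_cbox (f : E -> R) a b : f \in Lfun mu 2%:E ->
  mu.-integrable (cbox a b) (EFin \o f).
Proof.
move=> f2; have mf := Lfun2_measurable mu f f2.
have i2 : mu.-integrable (cbox a b) (EFin \o (fun x => f x ^+ 2)).
  apply: integrableS (Lfun2_integrable_sqr f2) => //; exact: measurable_cbox.
have i1 : mu.-integrable (cbox a b) (EFin \o cst (1 : R)).
  apply: measurable_bounded_integrable => //.
  - exact: measurable_cbox.
  - exact: leb_cbox.
  - by exists 1; split=> [|M M1 x _]; [exact: num_real|rewrite /= normr1 ltW].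
apply: le_integrable (integrableD _ i1 i2) => //; try exact: measurable_cbox.
- by apply: measurable_funTS; exact: measurableT_comp.
- move=> x _; rewrite /= lee_fin [leRHS]ger0_norm ?addr_ge0 ?sqr_ge0//.
  have -> : f x ^+ 2 = `|f x| ^+ 2 by rewrite real_normK ?num_real.
  by move: `|f x| => t; rewrite /cst; have := sqr_ge0 (t - 1); have := sqr_ge0 t; rewrite !expr2; lra.
Qed.

(* Smooth bumps increase to the indicator of a box, and boxes generate the
   Borel sets. *)
Lemma fundamental_lemma (K : set E) (f : E -> R) : open K ->
  f \in Lfun mu 2%:E ->
  (forall phi, test_fun K phi -> \int[mu]_(z in K) (f z * phi z) = 0) ->
  {ae mu, forall z, K z -> f z = 0}.
Proof.
move=> oK f2 fphi; have mf := Lfun2_measurable mu f f2.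
have mK := open_measurable_rV _ oK.
have box0 a b : cbox a b `<=` K -> (\int[mu]_(x in obox a b) (f x)%:E = 0)%E.
  move=> abK; have mC := measurable_cbox a b.
  have intC := Lfun2_integrable_cbox f a b f2.
  have mb k : measurable_fun setT (bump n a b k).
    by apply: continuous_measurable_rV; have [] := bump_smooth n a b k [::].
  have mfb k : measurable_fun (cbox a b) (fun x => (f x * bump n a b k x)%:E).
    by apply/measurable_EFinP/measurable_funTS; exact: measurable_funM.
  have fb_le k x : (`|(f x * bump n a b k x)%:E| <= `|f x|%:E)%E.
    rewrite lee_fin normrM -[leRHS]mulr1 ler_wpM2l//.
    by have /andP[? ?] := bump_ge0 n a b k x; rewrite ger0_norm.
  have bE k : (\int[mu]_(x in cbox a b) (f x * bump n a b k x)%:E = 0)%E.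
    have ib : mu.-integrable (cbox a b) (fun x => (f x * bump n a b k x)%:E).
      by apply: le_integrable intC => // x _; exact: fb_le.
    rewrite -(fineK (integrable_fin_num mC ib)); congr (_%:E).
    rewrite -(fphi _ (bump_test_fun n K a b k abK)); congr fine.
    rewrite [LHS]integral_mkcond [RHS]integral_mkcond; apply: eq_integral => x _.
    rewrite /= !patchE; case: ifPn => [/set_mem/abK Kx|/negP xab].
      by rewrite mem_set.
    case: ifPn => // _; rewrite bump_out ?mulr0// => /obox_cbox xab'.
    by apply: xab; exact: mem_set.
  have mlim : measurable_fun setT (f \_ (obox a b)).
    apply/(measurable_restrictT _ (measurable_obox a b)).
    exact: measurable_funTS.
  have [] := @dominated_convergence _ _ _ mu (cbox a b) mC
    (fun k x => (f x * bump n a b k x)%:E) (fun x => ((f \_ (obox a b)) x)%:E)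
    (fun x => `|f x|%:E) mfb.
  - by apply/measurable_EFinP; exact: measurable_funTS.
  - apply: aeW => x _; apply: cvg_EFin; first by near=> k.
    rewrite patchE; case: ifPn => [/set_mem xab|/negP xab].
      rewrite -[X in _ --> X]mulr1; apply: cvgMl_tmp; exact: bump_cvg.
    rewrite (_ : _ \o _ = cst (0 : R)); last first.
      by apply/funext => k /=; rewrite bump_out ?mulr0// => /mem_set.
    exact: cvg_cst.
  - exact: integrable_norm.
  - by apply: aeW => x k _; exact: fb_le.
  move=> _ _; under eq_fun do rewrite bE.
  move=> /(cvg_unique (@ereal_hausdorff R) (cvg_cst _)) E0; apply: etrans _ (esym E0).
  rewrite [LHS]integral_mkcond [RHS]integral_mkcond; apply: eq_integral => x _.
  rewrite /= !patchE; case: ifPn => [/set_mem/obox_cbox xab|]; last by case: ifPn.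
  by rewrite mem_set.
(* Countably many rational boxes inside [K] cover [K], so their exceptional null sets add up to a
   null set. *)
pose P := [set ab : 'rV[rat]_n * 'rV[rat]_n |
  cbox (map_mx ratr ab.1) (map_mx ratr ab.2) `<=` K].
have Pae (ab : 'rV[rat]_n * 'rV[rat]_n) : P ab -> mu.-negligible
    (obox (map_mx ratr ab.1) (map_mx ratr ab.2) `&` [set x | f x <> 0]).
  move=> abK; set a := map_mx _ _; set b := map_mx _ _.
  have intO : mu.-integrable (obox a b) (EFin \o f).
    apply: integrableS (Lfun2_integrable_cbox f a b f2) => //.
    - exact: measurable_cbox.
    - exact: measurable_obox.
    - exact: obox_cbox.
  have : {ae mu, forall x, obox a b x -> f x = 0}.
    apply: integral_box0_ae => // a' b' abab.
    apply: box0 => y yab; apply: abK => i; have [aa bb] := abab i.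
    have /andP[ay yb] := yab i.
    by rewrite (le_trans aa ay) (le_trans yb bb).
  apply: negligibleS => x [xab fx] /=; by apply/not_implyP.
apply: negligibleS (countable_bigcup_negligible _ _ _ _ _ _ _ Pae).
move=> x /= /not_implyP[/(open_rat_box _ _ oK)[ab [xab abK]] fx].
by exists ab.
Unshelve. all: by end_near. Qed.

End fundamental_lemma.

(** * Lipschitz boundaries are null sets *)

Section translation.
Context {R : realType}.
Local Notation lambda := (@lebesgue_measure R).

Lemma measurable_addR (t : R) :
  measurable_fun setT ((fun s => s + t) : measurableTypeR R -> measurableTypeR R).
Proof. by apply: measurable_funD => //; exact: measurable_cst. Qed.

Lemma lebesgue_measure_translation (t : R) (A : set (measurableTypeR R)) :
  measurable A -> lambda [set s | A (s + t)] = lambda A.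
Proof.
move=> mA; have mt := measurable_addR t.
have H : forall X, ocitv X -> lambda X = pushforward lambda
    ((fun s => s + t) : measurableTypeR R -> measurableTypeR R) X.
  move=> _ [[a b]] _ <-; rewrite /pushforward.
  have -> : (fun s : R => s + t) @^-1` `]a, b]%classic = `](a - t), (b - t)]%classic.
    by apply/seteqP; split=> s; rewrite /= !in_itv /= ltrBlDr lerBrDr.
  rewrite !lebesgue_measure_itv /= !lte_fin ltrD2r; case: ifPn => // _.
  by rewrite -!EFinB; congr (_%:E); ring.
exact/esym/(lebesgue_measure_unique H).
Qed.

Lemma measurable_translation n (v : 'rV[R]_n) :
  measurable_fun setT (fun x : 'rV[R]_n => x + v).
Proof.
apply: measurable_fun_rV => i.
rewrite (_ : _ \o _ = (fun s => s + v 0 i) \o @rV_coord R n i); last first.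
  by apply/funext => x; rewrite /rV_coord /= mxE.
by apply: (measurableT_comp (measurable_addR _)); exact: measurable_rV_coord.
Qed.

(** The measure integrates the lengths of the sections along the last coordinate. These are
    invariant under the last component of [v], and the remaining components act on the outer
    integral, where the induction hypothesis applies. *)
Lemma leb_translation n (v : 'rV[R]_n) A : measurable A ->
  leb R n [set x | A (x + v)] = leb R n A.
Proof.
elim: n v A => [|n IHn] v A mA.
  by congr (leb R 0 _); apply/seteqP; split=> x /=; rewrite (thinmx0 (x + v)) (thinmx0 x).
pose B := (fun p : 'rV[R]_n * measurableTypeR R => pt p.1 p.2) @^-1` A.
have mB : measurable B by rewrite -[X in measurable X]setTI; exact: measurable_pt.
pose g (x : 'rV[R]_n) : \bar R := lambda (xsection B x).
have mg : measurable_fun setT g by exact: measurable_fun_xsection.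
have vE x t : pt x t + v = pt (x + xpart v) (t + tpart v).
  apply/rowP => i; rewrite !mxE; case: (unliftP ord_max i) => [j ->|->].
    by rewrite !mxE.
  by [].
have lebSE C : leb R n.+1 C = (\int[leb R n]_x lambda (xsection
    ((fun p : 'rV[R]_n * measurableTypeR R => pt p.1 p.2) @^-1` C) x))%E by [].
transitivity (\int[leb R n]_x g (x + xpart v)%R)%E.
  rewrite lebSE; apply: eq_integral => x _; rewrite /g /=.
  rewrite -[RHS](lebesgue_measure_translation (tpart v)); last exact: measurable_xsection.
  by congr (lambda _); apply/seteqP; split=> s; rewrite /xsection /= !inE /B /= vE.
have -> : (\int[leb R n]_x g (x + xpart v)%R =
    \int[pushforward (leb R n) (fun x => x + xpart v)%R]_x g x)%E.
  by rewrite ge0_integral_pushforward//; exact: measurable_translation.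
rewrite lebSE; apply: (eq_measure_integral (leb R n)).
  exact: measurable_translation.
by move=> ? C mC _; exact: (IHn (xpart v) C mC).
Qed.

End translation.

Section continuity.
Context {R : realType} {V : normedModType R}.
Implicit Types f g : V -> R.

Lemma continuous_sum_fun (I : Type) (s : seq I) (F : I -> V -> R) :
  (forall i, continuous (F i)) -> continuous (\sum_(i <- s) F i).
Proof.
move=> cF; elim: s => [|i s IHs] x; first by rewrite big_nil; exact: cvg_cst.
by rewrite big_cons; apply: cvgD; [exact: cF|exact: IHs].
Qed.

Lemma continuous_sub_fun f g : continuous f -> continuous g -> continuous (f - g).
Proof. by move=> cf cg x; apply: cvgB; [exact: cf|exact: cg]. Qed.

Lemma continuous_mul_fun f g : continuous f -> continuous g -> continuous (f * g).
Proof. by move=> cf cg x; apply: cvgM; [exact: cf|exact: cg]. Qed.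

Lemma continuous_sub_scale f (e : V) : continuous f ->
  continuous (fun y => y - f y *: e).
Proof.
by move=> cf x; apply: cvgB; [exact: cvg_id|apply: cvgZr_tmp; exact: cf].
Qed.

Lemma lipschitz_continuous f : lipschitz f -> continuous f.
Proof.
move=> [M [_ MP]] x; pose N := Num.max M 0 + 1.
have N0 : 0 < N by rewrite ltr_wpDl// le_max lexx orbT.
have MN : M < N by rewrite ltr_pwDr// le_max lexx.
have fN y : `|f x - f y| <= N * `|x - y| by exact: (MP N MN (x, y)).
apply/cvgrPdist_lt => e e0; near=> y.
apply: (le_lt_trans (fN y)); rewrite -ltr_pdivlMl// mulrC.
near: y; apply: cvgr_dist_lt; last by rewrite divr_gt0.
exact: cvg_id.
Unshelve. all: by end_near. Qed.

End continuity.

Section lipschitz_graph.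
Context {R : realType} {n : nat}.
Local Notation E := 'rV[R]_n.
Local Notation mu := (leb R n).

Lemma dotvDl (x y e : E) : dotv (x + y) e = dotv x e + dotv y e.
Proof. by rewrite /dotv -big_split; apply: eq_bigr => i _; rewrite mxE mulrDl. Qed.

Lemma dotvZl a (x e : E) : dotv (a *: x) e = a * dotv x e.
Proof. by rewrite /dotv mulr_sumr; apply: eq_bigr => i _; rewrite mxE mulrA. Qed.

Lemma continuous_dotv (e : E) : continuous (fun y : E => dotv y e).
Proof.
have -> : (fun y : E => dotv y e) = \sum_i ((fun y : E => y 0 i) * cst (e 0 i)).
  by apply/funext => y; rewrite fct_sumE.
apply: continuous_sum_fun => i; apply: continuous_mul_fun.
  by move=> y; exact: coord_cvg.
exact: cst_continuous.
Qed.

(** Signed height above the graph in direction [e]: negative exactly on the strict subgraph. *)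
Definition graph_defect (e : E) (phi : E -> R) (y : E) : R :=
  dotv y e - phi (y - dotv y e *: e).

Lemma continuous_graph_defect e phi : continuous phi -> continuous (graph_defect e phi).
Proof.
move=> cphi; apply: continuous_sub_fun; first exact: continuous_dotv.
move=> y; apply: (continuous_comp (f := fun y : E => y - dotv y e *: e)); last exact: cphi.
apply: continuous_sub_scale; exact: continuous_dotv.
Qed.

(* The translates of such a set along the axis [e] are pairwise disjoint. *)
Lemma negligible_graph (e : E) (phi : E -> R) : dotv e e = 1 -> continuous phi ->
  mu.-negligible [set y | dotv y e = phi (y - dotv y e *: e)].
Proof.
move=> e1 cphi; pose h := graph_defect e phi.
have ch : continuous h by exact: continuous_graph_defect.
set G := [set y | _]; have GE : G = h @^-1` [set 0].
  apply/seteqP; split=> y /= H; apply/eqP; first by rewrite subr_eq0; exact/eqP.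
  by rewrite -subr_eq0; exact/eqP.
have mG : measurable G.
  apply: closed_measurable_rV; rewrite GE; exact: preimage_closed.
have disj s s' y : G (y - s *: e) -> G (y - s' *: e) -> s = s'.
  have sE r : dotv (y - r *: e) e = dotv y e - r.
    by rewrite dotvDl -scaleNr dotvZl e1 mulr1.
  have pE r : y - r *: e - (dotv y e - r) *: e = y - dotv y e *: e.
    by rewrite scalerBl opprB addrA subrK.
  by rewrite /G /= !sE !pE => <- /addrI/oppr_inj.
suff GN0 N : mu (G `&` cube n N%:R) = 0%E.
  apply: (@negligibleS _ _ _ _ (\bigcup_N (G `&` cube n N%:R))).
    move=> y Gy; exists (\max_(j < n) (Num.truncn `|y ord0 j|).+1)%N => //; split=> //.
    rewrite cubeE => j; rewrite ltW// (lt_le_trans (truncnS_gt _))// ler_nat.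
    exact: (leq_bigmax (F := fun j => (Num.truncn `|y ord0 j|).+1)).
  apply: negligible_bigcup => N; apply/negligibleP; last exact: GN0.
  by apply: measurableI => //; exact: measurable_cube.
set GN := G `&` _; have mGN : measurable GN.
  by apply: measurableI => //; exact: measurable_cube.
pose M : R := N%:R + \sum_i `|e 0 i|.
(* The shifts [1 / (k+1)] are distinct and at most 1, so infinitely many disjoint sets of equal
   measure lie in one cube of finite measure. Hence the common measure is zero. *)
pose F k := [set y : E | GN (y - k.+1%:R^-1 *: e)].
have FE k : mu (F k) = mu GN by rewrite -(leb_translation n (- (k.+1%:R^-1 *: e)) _ mGN).
have mF k : measurable (F k).
  by rewrite -[X in measurable X]setTI; exact: measurable_translation.
have tF : trivIset setT F.
  move=> i j _ _ [y [[Gi _] [Gj _]]]; have /invr_inj/eqP := disj _ _ _ Gi Gj.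
  by rewrite eqr_nat eqSS => /eqP.
have FM : \bigcup_k F k `<=` cube n M.
  move=> y [k _ [_]]; rewrite !cubeE => yN j; have := yN j; rewrite !mxE => {}yN.
  have -> : y 0 j = (y 0 j - k.+1%:R^-1 * e 0 j) + k.+1%:R^-1 * e 0 j by rewrite subrK.
  rewrite (le_trans (ler_normD _ _))// lerD// normrM (bigD1 j)//=.
  rewrite ler_wpDr//; first by apply: sumr_ge0.
  by rewrite ler_piMl// ger0_norm ?invr_ge0// invf_le1// ler1n.
have bnd k : (mu GN *+ k <= mu (cube n M))%E.
  apply: (@le_trans _ _ (mu (\bigcup_k F k))); last first.
    by apply: le_measure => //; rewrite inE; [exact: bigcup_measurable|exact: measurable_cube].
  rewrite measure_bigcup//; apply: le_trans (nneseries_lim_ge k _) => //.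
  rewrite (eq_bigl xpredT); last by move=> i; rewrite in_setT.
  rewrite (eq_bigr (fun=> mu GN)); last by move=> i _; exact: FE.
  suff -> : (\sum_(0 <= i < k) mu GN = mu GN *+ k)%R by [].
  by elim: k => [|k IHk]; [rewrite big_nil|rewrite big_nat_recr//= IHk mulrSr].
have [M' M'E] : exists M' : R, mu (cube n M) = M'%:E.
  by exists (fine (mu (cube n M))); rewrite fineK// ge0_fin_numE// leb_cube.
have GN0 : (0 <= mu GN)%E by exact: measure_ge0.
move: GN0; case E0 : (mu GN) => [r| |]//; last first.
  by have := bnd 1; rewrite E0 M'E.
rewrite lee_fin le_eqVlt => /predU1P[<-//|r0].
have := bnd (Num.truncn (M' / r)).+1; rewrite E0 M'E -EFin_natmul lee_fin leNgt.
by rewrite -mulr_natl -ltr_pdivrMr// truncnS_gt.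
Qed.

(** Near a boundary point the boundary lies in a graph: since [A] is open, its boundary avoids [A],
    so the defect is nonnegative there; where it is positive, a whole neighbourhood misses [A]. *)
Lemma boundary_negligible (A : set E) : open A -> lipschitz_boundary A ->
  mu.-negligible (boundary A).
Proof.
move=> oA lA.
pose P := [set ab : 'rV[rat]_n * 'rV[rat]_n |
  mu.-negligible (boundary A `&` obox (map_mx ratr ab.1) (map_mx ratr ab.2))].
have Pneg ab : P ab -> mu.-negligible
   (boundary A `&` obox (map_mx ratr ab.1) (map_mx ratr ab.2)) by [].
apply: negligibleS (countable_bigcup_negligible _ _ _ _ _ _ _ Pneg).
move=> z bz; have [e [phi [U [e1 lphi [oU Uz] UP]]]] := lA z bz.
have [ab [zab abU]] := open_rat_box U z oU Uz; exists ab => //.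
have cphi := lipschitz_continuous _ lphi.
apply: negligibleS (negligible_graph e phi e1 cphi) => y [[cy iy] /obox_cbox/abU Uy].
have Ay : ~ A y by move=> Ay; apply: iy; rewrite openE in oA; exact: oA.
apply/eqP; rewrite eq_le; apply/andP; split; last first.
  by rewrite leNgt; apply/negP => /(UP y Uy).2.
rewrite leNgt; apply/negP => yphi.
have ch := continuous_graph_defect e phi cphi.
have : nbhs y (U `&` [set x | 0 < graph_defect e phi x]).
  apply: filterI; first by move: oU; rewrite openE; exact.
  by apply: (ch y [set r | 0 < r]); apply: lt_nbhsr; rewrite subr_gt0.
move=> /cy[x [Ax [Ux]]]; rewrite /= subr_gt0.
by have := (UP x Ux).1 Ax => /lt_trans H /H; rewrite ltxx.
Qed.

Lemma finite_bigcup_negligible (I : choiceType) (D : set I) (F : I -> set E) :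
  finite_set D -> (forall i, D i -> mu.-negligible (F i)) ->
  mu.-negligible (\bigcup_(i in D) F i).
Proof.
move=> /finite_fsetP[X ->] XF; rewrite bigcup_fset big_seq.
elim/big_ind : _; [exact: negligible_set0|exact: negligibleU|].
by move=> i iX; exact: XF.
Qed.

End lipschitz_graph.

(** * Completeness of L^2 *)

Section riesz_fischer.
Context {d} {T : measurableType d} {R : realType}.
Variable mu : {measure set T -> \bar R}.
Local Notation Lf := (Lfun mu 2%:E).
Implicit Types f g : T -> R.

Lemma Lfun2B f g : f \in Lf -> g \in Lf -> (fun x => f x - g x) \in Lf.
Proof.
move=> /Lfun2P[mf f2] /Lfun2P[mg g2]; apply/Lfun2P.
have mB : measurable_fun setT (fun x => f x - g x) by exact: measurable_funB.
split=> //; apply: (@le_lt_trans _ _ (\int[mu]_x (2 * f x ^+ 2 + 2 * g x ^+ 2)%:E)%E).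
  apply: ge0_le_integral => //.
  - by move=> x _; rewrite lee_fin sqr_ge0.
  - by apply/measurable_EFinP; exact: measurable_funX.
  - by apply/measurable_EFinP/measurable_funD; apply: measurable_funM => //; exact: measurable_funX.
  - move=> x _; rewrite lee_fin; have := sqr_ge0 (f x + g x); rewrite !expr2; lra.
under eq_integral do rewrite EFinD (EFinM 2 (f _ ^+ 2)) (EFinM 2 (g _ ^+ 2)).
rewrite ge0_integralD//; first last.
- by apply/measurable_EFinP; apply: measurable_funM => //; exact: measurable_funX.
- by move=> x _; rewrite -EFinM lee_fin mulr_ge0// sqr_ge0.
- by apply/measurable_EFinP; apply: measurable_funM => //; exact: measurable_funX.
- by move=> x _; rewrite -EFinM lee_fin mulr_ge0// sqr_ge0.
rewrite !ge0_integralZl//; first last.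
- by move=> x _; rewrite lee_fin sqr_ge0.
- by apply/measurable_EFinP; exact: measurable_funX.
- by move=> x _; rewrite lee_fin sqr_ge0.
- by apply/measurable_EFinP; exact: measurable_funX.
by rewrite lte_add_pinfty// lte_mul_pinfty//.
Qed.

Lemma Lfun2_sqr_integral f : f \in Lf ->
  (\int[mu]_x (f x ^+ 2)%:E = (\int[mu]_x (f x ^+ 2))%:E)%E.
Proof.
by move=> f2; rewrite fineK// integrable_fin_num//; exact: Lfun2_integrable_sqr.
Qed.

Local Notation a k := (geometric 1 (2^-1 : R) k).

(** Weighting the squared increments by [1 / a k], where [a k = 2^(-k)], keeps the integral of their
    sum at most 2. The sum is then finite a.e., and wherever it is, the increments are absolutely
    summable. *)
Lemma fast_cauchy_cvg (g : nat -> T -> R) : (forall k, measurable_fun setT (g k)) ->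
  (forall k, \int[mu]_x ((g k.+1 x - g k x) ^+ 2)%:E <= (a k ^+ 2)%:E)%E ->
  exists A, [/\ measurable A, mu (~` A) = 0%E & forall x, A x -> cvgn (g ^~ x)].
Proof.
move=> mg g2; have a0 k : 0 < a k by rewrite /= mul1r exprn_gt0.
pose h k x := (a k)^-1 * (g k.+1 x - g k x) ^+ 2.
have h0 k x : 0 <= h k x by rewrite mulr_ge0 ?sqr_ge0// invr_ge0 ltW.
have md k : measurable_fun setT (fun x => (g k.+1 x - g k x) ^+ 2).
  by apply: measurable_funX; exact: measurable_funB.
have mh k : measurable_fun setT (EFin \o h k).
  by apply/measurable_EFinP; apply: measurable_funM.
pose Phi x := (\sum_(k <oo) (h k x)%:E)%E.
have mPhi : measurable_fun setT Phi.
  apply: (ge0_emeasurable_sum (h := fun k x => (h k x)%:E) (P := xpredT)) => //.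
    by move=> k x _ _; rewrite lee_fin.
  by move=> k _; exact: mh.
have intPhi : (\int[mu]_x Phi x <= (1 * (1 - 2^-1)^-1)%:E)%E.
  rewrite integral_nneseries//; last by move=> k x _; rewrite lee_fin.
  apply: lime_le; first by apply: is_cvg_nneseries => k _ _; apply: integral_ge0 => x _; rewrite lee_fin.
  apply: nearW => n; apply: (@le_trans _ _ (\sum_(0 <= k < n) (a k)%:E)%E).
    apply: lee_sum => k _; under eq_integral do rewrite EFinM.
    rewrite ge0_integralZl//; first last.
    - by rewrite lee_fin invr_ge0 ltW.
    - by move=> x _; rewrite lee_fin sqr_ge0.
    - exact/measurable_EFinP.
    apply: (le_trans (lee_wpmul2l _ (g2 k))); first by rewrite lee_fin invr_ge0 ltW.
    by rewrite -EFinM lee_fin expr2 mulKf// gt_eqF.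
  rewrite sumEFin lee_fin; have := @geometric_le_lim R n 1 2^-1 ler01.
  rewrite /series /=; apply; first by [].
  by rewrite ger0_norm// invf_lt1// ltr1n.
have iPhi : mu.-integrable setT Phi.
  apply/integrableP; split=> //.
  rewrite (eq_integral Phi); last first.
    move=> x _; rewrite gee0_abs//; apply: nneseries_ge0 => k _ _.
    by rewrite lee_fin.
  exact: le_lt_trans intPhi (ltry _).
pose A := setT `&` [set x | Phi x \is a fin_num].
have mA : measurable A by exact: emeasurable_fin_num.
exists A; split=> //.
  apply/negligibleP; first exact: measurableC.
  apply: negligibleS (integrable_ae measurableT iPhi) => x /=.
  by rewrite /A setTI => Px; apply/not_implyP.
move=> x [_ Pfin]; have -> : g ^~ x = (fun n => g 0 x + series (telescope (g ^~ x)) n).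
  by apply/funext => n; rewrite -eq_sum_telescope.
apply: is_cvgD; first exact: is_cvg_cst.
apply: normed_cvg; apply: nondecreasing_is_cvgn.
  apply/nondecreasing_seqP => n.
  rewrite -[leRHS]/(series (fun k => `|telescope (g ^~ x) k|) n.+1).
  by rewrite seriesSr lerDl normr_ge0.
exists ((1 * (1 - 2^-1)^-1 + fine (Phi x)) / 2) => _ [n _ <-].
have half : `|2^-1 : R| < 1 by rewrite ger0_norm// invf_lt1// ltr1n.
have Sa := @geometric_le_lim R n 1 2^-1 ler01 (ltac:(by [])) half.
have Sh : \sum_(0 <= k < n) h k x <= fine (Phi x).
  rewrite -lee_fin fineK// -sumEFin; apply: nneseries_lim_ge => k _.
  by rewrite lee_fin.
(* Arithmetic-geometric mean inequality: an increment of modulus [y] is at most [(b + y^2 / b) / 2]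
   with [b = a k]. *)
apply: (@le_trans _ _ (\sum_(0 <= k < n) (a k + h k x) / 2)).
  apply: ler_sum => k _; rewrite /telescope /h /=.
  set y := g k.+1 x - g k x; set b := 1 * _; have b0 : 0 < b by exact: a0.
  have -> : y ^+ 2 = `|y| ^+ 2 by rewrite real_normK ?num_real.
  have -> : (b + b^-1 * `|y| ^+ 2) / 2 = `|y| + (b - `|y|) ^+ 2 * b^-1 / 2.
    by field; rewrite gt_eqF.
  by rewrite lerDl divr_ge0// mulr_ge0 ?sqr_ge0// invr_ge0 ltW.
rewrite -mulr_suml ler_pM2r// big_split/= lerD//.
Qed.

Lemma riesz_fischer (f : nat -> T -> R) : (forall n, f n \in Lf) ->
  (forall e, 0 < e -> exists N, forall m n, (N <= m)%N -> (N <= n)%N ->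
     \int[mu]_x ((f m x - f n x) ^+ 2) < e) ->
  exists2 g, g \in Lf & forall e, 0 < e -> exists N, forall n, (N <= n)%N ->
     \int[mu]_x ((f n x - g x) ^+ 2) < e.
Proof.
move=> f2 fc; have mf n : measurable_fun setT (f n) by have /Lfun2P[] := f2 n.
have a0 k : 0 < a k ^+ 2 by rewrite exprn_gt0//= mul1r exprn_gt0.
have /choice[N NP] k := fc _ (a0 k).
(* [p k] and [p k.+1] must both exceed [N k] to make the subsequence fast, and [k <= p k] lets it
   run to infinity. *)
pose p k := maxn k (\max_(j < k.+1) N j).
have pN j k : (j <= k)%N -> (N j <= p k)%N.
  move=> jk; rewrite leq_max; apply/orP; right.
  by have := @leq_bigmax _ (fun j : 'I_k.+1 => N j) (inord j); rewrite inordK.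
have fE m n : (\int[mu]_x ((f m x - f n x) ^+ 2)%:E = (\int[mu]_x ((f m x - f n x) ^+ 2))%:E)%E.
  by apply: (Lfun2_sqr_integral (fun x => f m x - f n x)); exact: Lfun2B.
have [A [mA A0 Acvg]] : exists A, [/\ measurable A, mu (~` A) = 0%E &
    forall x, A x -> cvgn (fun k => f (p k) x)].
  apply: (fast_cauchy_cvg (fun k => f (p k))) => // k.
  by rewrite fE lee_fin ltW//; apply: NP; exact: pN.
pose g := (fun x => limn (fun k => f (p k) x)) \_ A.
have gE x : A x -> f (p k) x @[k --> \oo] --> g x.
  by move=> Ax; rewrite /g patchE mem_set//; exact: Acvg.
have mg : measurable_fun setT g.
  apply/(measurable_restrictT _ mA); apply: (measurable_fun_cvg (h := fun k => f (p k))).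
    by move=> k; exact: measurable_funTS.
  by move=> x Ax; exact: Acvg.
(* Fatou's lemma along the subsequence transfers the Cauchy bound to the limit [g]; it gives the
   membership of [g] as well as the convergence of the full sequence. *)
have fatou_le n e : (forall m, (n <= m)%N -> \int[mu]_x ((f n x - f m x) ^+ 2) <= e) ->
    (\int[mu]_x ((f n x - g x) ^+ 2)%:E <= e%:E)%E.
  move=> nm; pose h k x := ((f n x - f (p k) x) ^+ 2)%:E.
  have mh k : measurable_fun setT (h k).
    by apply/measurable_EFinP/measurable_funX; exact: measurable_funB.
  have h0 k x : (0 <= h k x)%E by rewrite lee_fin sqr_ge0.
  have mF : measurable_fun setT (fun x => ((f n x - g x) ^+ 2)%:E).
    by apply/measurable_EFinP/measurable_funX; exact: measurable_funB.
  rewrite (ge0_negligible_integral (N := ~` A))//; [|exact: measurableC|by move=> x _; rewrite lee_fin sqr_ge0].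
  rewrite setTD setCK.
  have -> : (\int[mu]_(x in A) ((f n x - g x) ^+ 2)%:E =
      \int[mu]_(x in A) limn_einf (h ^~ x))%E.
    apply: eq_integral => x /set_mem Ax; apply/esym.
    have := @cvg_limn_einf_sup R (h ^~ x) ((f n x - g x) ^+ 2)%:E; case=> //.
    apply: cvg_EFin; first by near=> k.
    rewrite (_ : _ \o _ = (fun k => (f n x - f (p k) x) ^+ 2))//.
    by under eq_fun do rewrite expr2; rewrite expr2; apply: cvgM; apply: cvgB;
      do ?[exact: cvg_cst|exact: gE].
  apply: (le_trans (fatou _ mA _ _)) => //; first by move=> k; exact: measurable_funTS.
  rewrite limn_einf_lim; apply: lime_le; first exact: is_cvg_einfs.
  near=> m; apply: (@le_trans _ _ (\int[mu]_(x in A) h (maxn m n) x)%E).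
    by apply: ereal_inf_lbound; exists (maxn m n) => //=; exact: leq_maxl.
  apply: (@le_trans _ _ (\int[mu]_x h (maxn m n) x)%E).
    by apply: ge0_subset_integral => //.
  rewrite fE lee_fin; apply: nm; rewrite leq_max; apply/orP; left; exact: leq_maxr.
have [N0 N0P] := fc 1 ltr01.
have g2 : g \in Lf.
  have fg2 : (fun x => f N0 x - g x) \in Lf.
    apply/Lfun2P; split; first exact: measurable_funB.
    apply: (@le_lt_trans _ _ 1%:E); last exact: ltry.
    by apply: fatou_le => m N0m; rewrite ltW// N0P.
  have -> : g = (fun x => f N0 x - (f N0 x - g x)).
    by apply/funext => x; rewrite opprB addrC subrK.
  exact: Lfun2B.
exists g => // e e0; have e2 : 0 < e / 2 by rewrite divr_gt0.
have [M MP] := fc _ e2; exists M => n Mn.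
rewrite -lte_fin -(Lfun2_sqr_integral (fun x => f n x - g x)); last exact: Lfun2B.
apply: (@le_lt_trans _ _ (e / 2)%:E); last by rewrite lte_fin ltr_pdivrMr// ltr_pMr// ltr1n.
by apply: fatou_le => m nm; rewrite ltW// MP// (leq_trans Mn).
Unshelve. all: by end_near. Qed.

End riesz_fischer.

Section vector_L2.
Context {R : realType} {n m : nat} {K : set 'rV[R]_n}.
Hypothesis mK : measurable K.
Local Notation E := 'rV[R]_n.
Local Notation vec := (E -> 'rV[R]_m).
Local Notation mu := (leb R n).
Local Notation Lf := (Lfun mu 2%:E).
Local Notation L := (@L2 R n m K).
Local Notation ipK := (@ip R n m K).
Implicit Types (u v w : vec) (i : 'I_m).

Definition rcomp u i : E -> R := component u i \_ K.

Lemma rcompE u i z : rcomp u i z = if z \in K then u z 0 i else 0.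
Proof. by rewrite /rcomp patchE. Qed.

Lemma rcomp_lin a u v i z : rcomp (a *: u + v) i z = a * rcomp u i z + rcomp v i z.
Proof.
rewrite !rcompE; case: ifPn => _; last by rewrite mulr0 addr0.
by rewrite !mxE.
Qed.

Lemma rcompB u v i z : rcomp (u - v) i z = rcomp u i z - rcomp v i z.
Proof. by rewrite -scaleN1r addrC rcomp_lin mulN1r addrC. Qed.

Lemma ipE u v : ipK u v = \sum_i \int[mu]_z (rcomp u i z * rcomp v i z).
Proof.
apply: eq_bigr => i _; rewrite Rintegral_mkcond; congr fine.
apply: eq_integral => z _; rewrite /= !rcompE patchE; case: ifPn => // _.
by rewrite mulr0.
Qed.

Lemma L2_subspace : subspace L.
Proof.
split=> [i|a u v Lu Lv i].
  have -> : component (0 : vec) i \_ K = cst 0.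
    by apply/funext => z; rewrite -/(rcomp _ _) rcompE mxE if_same.
  apply/Lfun2P; split; first exact: measurable_cst.
  by rewrite integral0_eq// => z _; rewrite /cst expr0n.
have -> : component (a *: u + v) i \_ K =
    (fun z => rcomp v i z - ((- a) \o* rcomp u i) z).
  apply/funext => z; rewrite -/(rcomp _ _) rcomp_lin /=.
  by rewrite mulrN opprK addrC [rcomp u i z * a]mulrC.
apply: Lfun2B; first exact: Lv.
by apply: Lfun_scale; [rewrite ler1n|exact: Lu].
Qed.

Let int_mul u v i : L u -> L v ->
  mu.-integrable setT (EFin \o (fun z => rcomp u i z * rcomp v i z)).
Proof. by move=> Lu Lv; apply: Lfun2_mul_integrable; [exact: Lu|exact: Lv]. Qed.

Lemma L2_semi_inner : semi_inner L ipK.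
Proof.
split; first exact: L2_subspace.
- by move=> u v _ _; apply: eq_bigr => i _; congr fine; apply: eq_integral => z _; rewrite mulrC.
- move=> a u v w Lu Lv Lw; rewrite !ipE mulr_sumr -big_split; apply: eq_bigr => i _ /=.
  have iu := int_mul u w i Lu Lw; have iv := int_mul v w i Lv Lw.
  rewrite -RintegralZl// -RintegralD//; last first.
    by rewrite (_ : _ \o _ = (fun z => a%:E * (EFin \o (fun z => (rcomp u i z * rcomp w i z)%R)) z)%E)//; exact: integrableZl.
  by congr fine; apply: eq_integral => z _; rewrite rcomp_lin mulrDl mulrA.
- move=> u Lu; rewrite ipE; apply: sumr_ge0 => i _; apply: Rintegral_ge0 => z _.
  by rewrite -expr2 sqr_ge0.
Qed.

Let sqr_le_ip u i : L u -> \int[mu]_z (rcomp u i z ^+ 2) <= ipK u u.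
Proof.
move=> Lu; rewrite ipE (bigD1 i)//= -[leLHS]addr0 lerD//.
apply: sumr_ge0 => j _; apply: Rintegral_ge0 => z _.
by rewrite -expr2 sqr_ge0.
Qed.

Lemma L2_complete : complete_in L ipK.
Proof.
move=> s Ls cs.
have LB u v : L u -> L v -> L (u - v) by move=> *; exact: subspaceB L2_subspace _ _.
have /choice[g gP] i : exists g, g \in Lf /\ forall e, 0 < e -> exists N, forall k, (N <= k)%N ->
    \int[mu]_x ((rcomp (s k) i x - g x) ^+ 2) < e.
  have [|e e0|g ? ?] := riesz_fischer mu (fun k => rcomp (s k) i).
  - by move=> k; exact: Ls.
  - have [N NP] := cs _ e0; exists N => j k Nj Nk.
    apply: le_lt_trans (NP _ _ Nj Nk); under eq_Rintegral do rewrite -rcompB.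
    by apply: sqr_le_ip; exact: LB.
  - by exists g.
pose u : vec := fun z => \row_i g i z.
have uE i z : rcomp u i z = if z \in K then g i z else 0 by rewrite rcompE mxE.
have Lu : L u.
  move=> i; have /Lfun2P[mg g2] := (gP i).1; apply/Lfun2P.
  have muu : measurable_fun setT (component u i \_ K).
    have -> : component u i \_ K = g i \_ K.
      by apply/funext => z; rewrite -/(rcomp _ _) uE patchE.
    by apply/(measurable_restrictT _ mK); exact: measurable_funTS.
  split=> //; apply: le_lt_trans g2; apply: ge0_le_integral => //.
  - by move=> z _; rewrite lee_fin sqr_ge0.
  - by apply/measurable_EFinP; exact: measurable_funX.
  - by apply/measurable_EFinP; exact: measurable_funX.
  - move=> z _; rewrite lee_fin -/(rcomp _ _) uE; case: ifPn => // _.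
    by rewrite expr0n sqr_ge0.
(* There are [m] components; [m.+1] makes their sum strictly less than [e] and also covers
   [m = 0]. *)
exists u => // e e0; have e1 : 0 < e / m.+1%:R by rewrite divr_gt0.
have /choice[N NP] i := (gP i).2 _ e1.
exists (\max_i N i)%N => k Nk; rewrite ipE.
apply: (@le_lt_trans _ _ (\sum_(i < m) e / m.+1%:R)).
  apply: ler_sum => i _; have Nik : (N i <= k)%N by apply: leq_trans Nk; exact: leq_bigmax.
  apply: le_trans (ltW (NP i k Nik)).
  have Lsg : (fun z => rcomp (s k) i z - g i z) \in Lf.
    by apply: Lfun2B; [exact: Ls|exact: (gP i).1].
  have Lsu : L (s k - u) by exact: LB.
  apply: le_Rintegral => //.
  - exact: int_mul.
  - exact: Lfun2_integrable_sqr Lsg.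
  - move=> z _; rewrite -expr2 rcompB uE rcompE; case: ifPn => // _.
    by rewrite subrr expr0n sqr_ge0.
rewrite sumr_const card_ord -[ltLHS]mulr_natr -mulrA gtr_pMr//.
by rewrite mulrC ltr_pdivrMr// mul1r ltr_nat.
Qed.

Lemma eqL2P u v : L u -> L v -> eqL2 K u v <-> ipK (u - v) (u - v) = 0.
Proof.
move=> Lu Lv; have Luv : L (u - v) by exact: subspaceB L2_subspace _ _.
have mf i : measurable_fun setT (rcomp (u - v) i) by have /Lfun2P[] := Luv i.
have sq i : \int[mu]_z (rcomp (u - v) i z * rcomp (u - v) i z) = 0 <->
    {ae mu, forall z, rcomp (u - v) i z = 0}.
  have mf2 : measurable_fun setT (fun z => (rcomp (u - v) i z ^+ 2)%:E).
    by apply/measurable_EFinP; exact: measurable_funX.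
  have := ae_eq_integral_abs mu measurableT mf2.
  have -> : (\int[mu]_z `|(rcomp (u - v) i z ^+ 2)%:E| =
      (\int[mu]_z (rcomp (u - v) i z * rcomp (u - v) i z))%:E)%E.
    rewrite -Lfun2_sqr_integral; last exact: Luv.
    by apply: eq_integral => z _; rewrite gee0_abs// lee_fin sqr_ge0.
  move=> H; split=> [H0|H0].
    have /H : (\int[mu]_z (rcomp (u - v) i z * rcomp (u - v) i z))%:E = 0%E by rewrite H0.
    apply: filterS => z /(_ Logic.I) [] /eqP; by rewrite sqrf_eq0 => /eqP.
  suff [] : (\int[mu]_z (rcomp (u - v) i z * rcomp (u - v) i z))%:E = 0%E by [].
  apply/H; apply: filterS H0 => z -> _ /=; by rewrite expr0n.
split=> [uv|].
  rewrite ipE big1// => i _; apply/sq; apply: filterS uv => z uvz.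
  by rewrite rcompE; case: ifPn => // /set_mem /uvz; rewrite !mxE => ->; rewrite subrr.
rewrite ipE => /eqP; rewrite psumr_eq0; last first.
  by move=> i _; apply: Rintegral_ge0 => z _; rewrite -expr2 sqr_ge0.
move=> /allP uv0.
have neg i : setT i -> mu.-negligible [set z | rcomp (u - v) i z <> 0].
  by move=> _; apply/sq/eqP; have := uv0 i; rewrite mem_index_enum => /(_ isT).
apply: negligibleS (countable_bigcup_negligible _ _ _ _ _ _ _ neg).
move=> z /= /not_implyP[Kz uvz].
have [i ui] : exists i, u z 0 i <> v z 0 i.
  by apply/existsNP => H; apply: uvz; apply/rowP.
exists i => //=; rewrite rcompE mem_set// !mxE => /eqP; rewrite subr_eq0 => /eqP.
exact: ui.
Qed.

End vector_L2.

(** * The wave operator *)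

Section domain_integrals.
Context {R : realType} {n : nat} {K : set 'rV[R]_n} {M : R}.
Hypotheses (oK : open K) (KM : K `<=` cube n M).
Local Notation E := 'rV[R]_n.
Local Notation mu := (leb R n).
Local Notation Lf := (Lfun mu 2%:E).
Local Notation C1 := (Ck (@std_basis R n) 1).
Implicit Types f g h : E -> R.

Let mK : measurable K. Proof. exact: open_measurable_rV. Qed.

Definition L2fun f := f \_ K \in Lf.

Definition prodint f g : R := \int[mu]_(z in K) (f z * g z).

Lemma continuous_L2fun f : continuous f -> L2fun f.
Proof.
move=> cf; have [N fN] := restrict_bounded_supp _ _ _ _ mK KM cf.
apply/Lfun2P; split; first by case: fN.
have : bounded_supp (fun z => (f \_ K) z ^+ 2) (Num.max `|N| (N ^+ 2)).
  have [mf bf sf] := fN; split.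
  - exact: measurable_funX.
  - move=> z; rewrite normrX le_max; apply/orP; right.
    by rewrite lerXn2r ?nnegrE//; exact: le_trans (bf z).
  - move=> z zN; rewrite sf ?expr0n// => zN'; apply: zN; move: zN'.
    rewrite !cubeE => zN' i; rewrite (le_trans (zN' i))// le_max.
    by rewrite (le_trans (ler_norm _)).
move=> /bounded_supp_integrable/integrable_lty; apply => //.
Qed.

Lemma prodint_integrable f g : L2fun f -> L2fun g ->
  mu.-integrable K (EFin \o (fun z => f z * g z)).
Proof.
move=> Lf' Lg; apply/(integrable_mkcond _ mK).
have := Lfun2_mul_integrable mu _ _ Lf' Lg; apply: eq_integrable => // z _.
by rewrite /= !patchE; case: ifPn => // _; rewrite mulr0.
Qed.

Lemma prodintDr f g h : L2fun f -> L2fun g -> L2fun h ->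
  prodint f (g + h) = prodint f g + prodint f h.
Proof.
move=> Lf' Lg Lh; rewrite /prodint -RintegralD//; try exact: prodint_integrable.
by congr fine; apply: eq_integral => z _; rewrite -mulrDr.
Qed.

Lemma prodintZr a f g : L2fun f -> L2fun g ->
  prodint f (cst a * g) = a * prodint f g.
Proof.
move=> Lf' Lg; rewrite /prodint -RintegralZl//; last exact: prodint_integrable.
by congr fine; apply: eq_integral => z _; rewrite mulrCA.
Qed.

Lemma prodintC f g : prodint f g = prodint g f.
Proof. by congr fine; apply: eq_integral => z _; rewrite mulrC. Qed.

Lemma prodint0 f : prodint f 0 = 0.
Proof. by rewrite /prodint /Rintegral integral0_eq// => z _; rewrite mulr0. Qed.

Lemma L2funD f g : L2fun f -> L2fun g -> L2fun (f + g).
Proof.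
move=> Lf' Lg; rewrite /L2fun.
have -> : (f + g) \_ K = (fun z => (f \_ K) z - (-1 \o* (g \_ K)) z).
  apply/funext => z; rewrite /= mulrN1 opprK !patchE; case: ifPn => // _.
  exact/esym/(@addr0 R).
by apply: Lfun2B => //; apply: Lfun_scale => //; rewrite ler1n.
Qed.

Lemma L2funZ a f : L2fun f -> L2fun (cst a * f).
Proof.
move=> Lf'; rewrite /L2fun.
have -> : (cst a * f) \_ K = a \o* (f \_ K).
  by apply/funext => z; rewrite /= !patchE; case: ifPn => // _; rewrite ?mul0r// mulrC.
by apply: Lfun_scale => //; rewrite ler1n.
Qed.

Lemma prodint_sumr I (s : seq I) f (G : I -> E -> R) : L2fun f ->
  (forall i, L2fun (G i)) -> prodint f (\sum_(i <- s) G i) = \sum_(i <- s) prodint f (G i).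
Proof.
move=> Lf' LG; suff [] : L2fun (\sum_(i <- s) G i) /\
  prodint f (\sum_(i <- s) G i) = \sum_(i <- s) prodint f (G i) by [].
elim: s => [|i s [L E1]]; first by rewrite !big_nil prodint0; split=> //; exact/continuous_L2fun/cst_continuous.
by rewrite !big_cons prodintDr// E1; split=> //; exact: L2funD.
Qed.

Lemma partial_out f i z : ~ supp f z -> partial i f z = 0.
Proof.
move=> fz; have oS : open (~` supp f) by apply: closed_openC; exact: closed_closure.
rewrite /partial (near_eq_derive (g := cst 0)); first exact: derive_cst.
have : nbhs z (~` supp f) by move: oS; rewrite openE; exact.
apply: filterS => y fy; apply/eqP; apply: contrapT => /negP fy0; apply: fy.
exact: subset_closure.
Qed.

Lemma test_fun_out f z : test_fun K f -> ~ K z -> f z = 0.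
Proof.
move=> [_ _ fK] Kz; apply/eqP; apply: contrapT => /negP fz; apply: Kz; apply: fK.
exact: subset_closure.
Qed.

Lemma test_fun_partial_out f i z : test_fun K f -> ~ K z -> partial i f z = 0.
Proof. by move=> [_ _ fK] Kz; apply: partial_out => /fK. Qed.

Lemma C1_derivable f i z : C1 f -> is_derive z (std_basis n i) f (partial i f z).
Proof. exact: Ck_is_derive. Qed.

Lemma C1_partial_continuous f i : C1 f -> continuous (partial i f).
Proof. by move=> /(Ck_derive _ _ _ i)/Ck_continuous. Qed.

Lemma C1_partial_L2fun f i : C1 f -> L2fun (partial i f).
Proof. by move=> /(C1_partial_continuous f i)/continuous_L2fun. Qed.

Lemma partialM f g i z : C1 f -> C1 g ->
  partial i (f * g) z = f z * partial i g z + g z * partial i f z.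
Proof.
move=> cf cg.
by have [_] := is_deriveM (C1_derivable f i z cf) (C1_derivable g i z cg).
Qed.

(** Integration by parts in one direction. Only the product has to vanish at the ends of the slices,
    so a boundary condition on either factor is enough. *)
Lemma integral_partialM0 f g i : C1 f -> C1 g ->
  (forall z s, ~ K (z + s *: std_basis n i) ->
     closure [set r : R | K (z + r *: std_basis n i)] s ->
     f (z + s *: std_basis n i) * g (z + s *: std_basis n i) = 0) ->
  prodint f (partial i g) + prodint g (partial i f) = 0.
Proof.
move=> cf cg fg0; have cfg : C1 (f * g) by exact: CkM.
have := integral_partial0 n i K (f * g) M oK KM _ (C1_partial_continuous _ i cfg) fg0.
move=> /(_ (fun z => let: DeriveDef h _ := C1_derivable _ i z cfg in h)) <-.
rewrite /prodint -RintegralD//.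
- by congr fine; apply: eq_integral => z _; rewrite -partialM.
- apply: prodint_integrable; last exact: C1_partial_L2fun.
  exact/continuous_L2fun/(Ck_continuous _ _ _ cf).
- apply: prodint_integrable; last exact: C1_partial_L2fun.
  exact/continuous_L2fun/(Ck_continuous _ _ _ cg).
Qed.

Lemma integration_by_parts_test f phi i : C1 f -> test_fun K phi ->
  prodint f (partial i phi) = - prodint (partial i f) phi.
Proof.
move=> cf tphi; have cphi : C1 phi by apply: smooth_Ck1; case: tphi.
have := integral_partialM0 f phi i cf cphi.
rewrite [prodint phi _]prodintC => H; apply/eqP; rewrite -addr_eq0; apply/eqP; apply: H.
by move=> z s Kz _; rewrite (test_fun_out phi)// mulr0.
Qed.

End domain_integrals.

(** * The wave operator on smooth vectors and the energy identity *)

Section classical_wave.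
Context {R : realType} {d : nat}.
Variable c : R.
Local Notation E := 'rV[R]_d.+1.
Local Notation vec := (E -> 'rV[R]_d.+1).
Local Notation mu := (leb R d.+1).
Local Notation C1 := (Ck (@std_basis R d.+1) 1).
Local Notation t_ := (@tidx d).
Local Notation q_ := (@qidx d).
Implicit Types (u v w psi : vec) (f g phi : E -> R) (K Om : set E).

Lemma big_qt (F : 'I_d.+1 -> R) : \sum_i F i = \sum_j F (q_ j) + F t_.
Proof. by rewrite (bigD1_ord t_)//= addrC. Qed.

Definition classical_wave u : vec := fun z =>
  \row_i if unlift ord_max i is Some j
    then partial t_ (qcomp u j) z - c * partial (q_ j) (mucomp u) z
    else partial t_ (mucomp u) z - c * \sum_j partial (q_ j) (qcomp u j) z.
Local Notation Acl := classical_wave.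

Lemma qcomp_wave u j : qcomp (Acl u) j =
  partial t_ (qcomp u j) + cst (- c) * partial (q_ j) (mucomp u).
Proof.
by apply/funext => z; rewrite /qcomp /component mxE liftK -mulNr.
Qed.

Lemma mucomp_wave u : mucomp (Acl u) =
  partial t_ (mucomp u) + cst (- c) * \sum_j partial (q_ j) (qcomp u j).
Proof.
apply/funext => z; rewrite /mucomp /component mxE unlift_none -mulNr.
by congr (_ + _ * _); rewrite fct_sumE.
Qed.

Definition test_vec K : set vec := [set psi | forall i, test_fun K (component psi i)].

Definition C1_vec : set vec := [set u | forall i, C1 (component u i)].

Lemma test_vec_C1 K : test_vec K `<=` C1_vec.
Proof. by move=> psi Kpsi i; apply: smooth_Ck1; case: (Kpsi i). Qed.

Lemma test_vec_out K psi z : test_vec K psi -> ~ K z -> psi z = 0.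
Proof.
by move=> Kpsi Kz; apply/rowP => i; rewrite mxE; exact: test_fun_out (Kpsi i) Kz.
Qed.

Lemma wave_test_vec_out K psi z : test_vec K psi -> ~ K z -> Acl psi z = 0.
Proof.
move=> Kpsi Kz; apply/rowP => i; rewrite !mxE.
have p0 i' k : partial k (component psi i') z = 0.
  exact: test_fun_partial_out (Kpsi i') Kz.
case: unlift => [j|].
  by rewrite !p0 mulr0 subrr.
by rewrite p0 big1 ?mulr0 ?subrr// => j _; exact: p0.
Qed.

Lemma prodint_sub K Om f g : K `<=` Om -> (forall z, ~ K z -> g z = 0) ->
  @prodint R d.+1 K f g = @prodint R d.+1 Om f g.
Proof.
move=> KOm g0; rewrite /prodint Rintegral_mkcond [RHS]Rintegral_mkcond.
congr fine; apply: eq_integral => z _; rewrite /= !patchE.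
case: ifPn => [/set_mem/KOm/mem_set->//|/negP zK]; case: ifPn => // _.
by rewrite g0 ?mulr0// => Kz; apply/zK/mem_set.
Qed.

Lemma ip_sub K Om u v : K `<=` Om -> (forall z, ~ K z -> v z = 0) ->
  ip K u v = ip Om u v.
Proof.
move=> KOm v0; apply: eq_bigr => i _; apply: prodint_sub => // z /v0.
by rewrite /component => ->; rewrite mxE.
Qed.

Lemma L2_sub K Om u : measurable K -> K `<=` Om -> L2 Om u -> L2 K u.
Proof.
move=> mK KOm Lu i; have /Lfun2P[mu2 u2] := Lu i.
have E0 : component u i \_ K = (component u i \_ Om) \_ K.
  apply/funext => z; rewrite !patchE; case: ifPn => // /set_mem/KOm/mem_set->//.
have mK2 : measurable_fun setT (component u i \_ K).
  by rewrite E0; apply/(measurable_restrictT _ mK); exact: measurable_funTS.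
apply/Lfun2P; split=> //; apply: le_lt_trans u2; apply: ge0_le_integral => //.
- by move=> z _; rewrite lee_fin sqr_ge0.
- by apply/measurable_EFinP; exact: measurable_funX.
- by apply/measurable_EFinP; exact: measurable_funX.
- move=> z _; rewrite lee_fin E0 patchE; case: ifPn => // _.
  by rewrite expr0n sqr_ge0.
Qed.

Section on_domain.
Context {K : set E} {M : R}.
Hypotheses (oK : open K) (KM : K `<=` cube d.+1 M).
Local Notation P := (@prodint R d.+1 K).
Local Notation LK := (@L2fun R d.+1 K).

Lemma C1_vec_L2 u : C1_vec u -> L2 K u.
Proof. by move=> cu i; apply: (continuous_L2fun oK KM); exact: Ck_continuous (cu i). Qed.

Let L2funA f g : LK f -> LK g -> LK (f + cst (- c) * g).
Proof. by move=> Lf Lg; apply: L2funD => //; exact: L2funZ. Qed.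

Let L2fun_sum (F : 'I_d -> E -> R) : (forall j, LK (F j)) -> LK (\sum_j F j).
Proof.
move=> LF; elim/big_ind : _ => //; last by move=> *; exact: L2funD.
exact/(continuous_L2fun oK KM)/cst_continuous.
Qed.

Let C1p u i k : C1_vec u -> LK (partial k (component u i)).
Proof. by move=> cu; exact: (C1_partial_L2fun oK KM). Qed.

Lemma C1_vec_wave_L2 u : C1_vec u -> L2 K (Acl u).
Proof.
move=> cu i; rewrite -/(L2fun _); case: (unliftP t_ i) => [j ->|->].
  by rewrite -[component _ _]/(qcomp _ j) qcomp_wave; apply: L2funA; exact: C1p.
rewrite -[component _ _]/(mucomp _) mucomp_wave; apply: L2funA; first exact: C1p.
by apply: L2fun_sum => j; exact: C1p.
Qed.

Let prodint_sub_c f g h : LK f -> LK g -> LK h ->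
  P f (g + cst (- c) * h) = P f g - c * P f h.
Proof.
move=> Lf Lg Lh; rewrite (prodintDr oK f g _ Lf Lg (L2funZ (- c) h Lh)).
by rewrite (prodintZr oK (- c) f h Lf Lh) mulNr.
Qed.

Lemma ip_wave u psi : L2 K u -> C1_vec psi ->
  ip K u (Acl psi) =
  \sum_j (P (qcomp u j) (partial t_ (qcomp psi j))
          - c * P (qcomp u j) (partial (q_ j) (mucomp psi)))
  + (P (mucomp u) (partial t_ (mucomp psi))
     - c * \sum_j P (mucomp u) (partial (q_ j) (qcomp psi j))).
Proof.
move=> Lu cpsi.
have uq j : LK (qcomp u j) by exact: Lu.
have um : LK (mucomp u) by exact: Lu.
have pq k j : LK (partial k (qcomp psi j)) by exact: C1p.
have pm k : LK (partial k (mucomp psi)) by exact: C1p.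
rewrite /ip big_qt; congr (_ + _).
  apply: eq_bigr => j _; rewrite -[LHS]/(P (qcomp u j) (qcomp (Acl psi) j)).
  by rewrite qcomp_wave prodint_sub_c.
rewrite -[LHS]/(P (mucomp u) (mucomp (Acl psi))).
by rewrite mucomp_wave prodint_sub_c ?(prodint_sumr oK KM)//; exact: L2fun_sum.
Qed.

Let P0 f : P f 0 = 0. Proof. exact: prodint0. Qed.

Definition single (i : 'I_d.+1) phi : vec := fun z => phi z *: delta_mx 0 i.

Lemma component_single i phi k :
  component (single i phi) k = if k == i then phi else 0.
Proof.
apply/funext => z; rewrite /component !mxE eqxx.
by case: eqP => _; rewrite ?mulr1 ?mulr0.
Qed.

Lemma smooth0 : smooth (0 : E -> R).
Proof. by apply: Ck_smooth => k; exact: Ck_cst. Qed.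

Lemma test_fun0 : test_fun K 0.
Proof.
have s0 : supp (0 : E -> R) = set0.
  by rewrite /supp -[RHS]closure0; congr closure; rewrite -subset0 => z /=; rewrite eqxx.
by split; [exact: smooth0|rewrite s0; exact: compact0|rewrite s0].
Qed.

Lemma single_test_vec i phi : test_fun K phi -> test_vec K (single i phi).
Proof. by move=> tphi k; rewrite component_single; case: eqP => // _; exact: test_fun0. Qed.

Let partial0 i : partial i (0 : E -> R) = 0.
Proof. by apply/funext => z; rewrite /partial; exact: derive_cst. Qed.

Let dpartialE f i phi : dpartial K f i phi = - P f (partial i phi).
Proof. by []. Qed.

Lemma is_wave_prodint u w : is_wave c K u w <-> forall phi, test_fun K phi ->
  (forall j, P (qcomp w j) phi =
     - P (qcomp u j) (partial t_ phi) + c * P (mucomp u) (partial (q_ j) phi)) /\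
  P (mucomp w) phi = - P (mucomp u) (partial t_ phi)
    + c * \sum_j P (qcomp u j) (partial (q_ j) phi).
Proof.
have E1 phi j : dpartial K (qcomp u j) t_ phi - c * dpartial K (mucomp u) (q_ j) phi =
    - P (qcomp u j) (partial t_ phi) + c * P (mucomp u) (partial (q_ j) phi).
  by rewrite !dpartialE mulrN opprK.
have E2 phi : dpartial K (mucomp u) t_ phi - c * (\sum_j dpartial K (qcomp u j) (q_ j) phi) =
    - P (mucomp u) (partial t_ phi) + c * \sum_j P (qcomp u j) (partial (q_ j) phi).
  by under eq_bigr do rewrite dpartialE; rewrite dpartialE sumrN mulrN opprK.
split=> H phi tphi; have [H1 H2] := H _ tphi; split=> [j|].
- by rewrite -E1; apply/esym/H1.
- by rewrite -E2; apply/esym/H2.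
- by rewrite E1; apply/esym/H1.
- by rewrite E2; apply/esym/H2.
Qed.

Lemma ip_qt u v : ip K u v =
  \sum_j P (qcomp u j) (qcomp v j) + P (mucomp u) (mucomp v).
Proof. exact: big_qt. Qed.

Let sum_aux (a b e f : 'I_d -> R) m : (forall j, f j = - a j + c * e j) ->
  \sum_j (a j - c * b j) + (m - c * \sum_j e j) =
  - (\sum_j f j + (- m + c * \sum_j b j)).
Proof.
move=> fE; rewrite (eq_bigr _ (fun j _ => fE j)) !big_split /= !sumrN -!mulr_sumr.
by ring.
Qed.

Let sum_single (a : 'I_d -> R) j : (forall k, k != j -> a k = 0) -> \sum_k a k = a j.
Proof. by move=> a0; rewrite (bigD1 j)//= big1 ?addr0. Qed.

Local Opaque prodint partial.

(** The formal adjoint of the wave operator is its opposite because the same [c] couples both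
    equations. Adding the componentwise equations gives the pairing, and test vectors with a single
    nonzero component give them back. *)
Lemma is_waveP u w : L2 K u -> L2 K w ->
  is_wave c K u w <-> (forall psi, test_vec K psi -> ip K u (Acl psi) = - ip K w psi).
Proof.
move=> Lu Lw; rewrite is_wave_prodint; split=> [uw psi tpsi|uw phi tphi].
  rewrite ip_wave//; last exact: test_vec_C1 tpsi.
  have [_ E2] := uw _ (tpsi t_); rewrite ip_qt E2.
  have E1 j : P (qcomp w j) (qcomp psi j) =
    - P (qcomp u j) (partial t_ (qcomp psi j)) + c * P (mucomp u) (partial (q_ j) (qcomp psi j)).
    by have [/(_ j)] := uw _ (tpsi (q_ j)).
  exact: (sum_aux _ _ _ _ _ E1).
have H i := uw _ (single_test_vec i _ tphi).
have C1s i : C1_vec (single i phi) by exact/test_vec_C1/single_test_vec.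
have qs j i : qcomp (single i phi) j = if q_ j == i then phi else 0.
  exact: component_single.
have ms i : mucomp (single i phi) = if t_ == i then phi else 0.
  exact: component_single.
have qt j : (q_ j == t_) = false by rewrite eq_sym; exact/negbTE/neq_lift.
have tq j : (t_ == q_ j) = false by exact/negbTE/neq_lift.
have qq j k : (q_ j == q_ k) = (j == k) by exact/inj_eq/lift_inj.
split=> [j|].
  have := H (q_ j); rewrite ip_wave// ip_qt ms tq !partial0 !P0.
  rewrite (sum_single _ j) => [|k kj]; last first.
    by rewrite qs qq (negbTE kj) !partial0 !P0 mulr0 subrr.
  rewrite (sum_single _ j) => [|k kj]; last by rewrite qs qq (negbTE kj) partial0 P0.
  rewrite (sum_single _ j) => [|k kj]; last by rewrite qs qq (negbTE kj) P0.
  rewrite !qs !qq eqxx partial0 P0.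
  by move: (P _ phi) (P _ _) (P _ _) => x y z ?; lra.
have := H t_; rewrite ip_wave// ip_qt ms eqxx.
rewrite (eq_bigr (fun j => - c * P (qcomp u j) (partial (q_ j) phi))) => [|j _]; last first.
  by rewrite qs qt partial0 P0 sub0r mulNr.
rewrite [X in _ - c * X]big1 => [|j _]; last by rewrite qs qt partial0 P0.
rewrite [X in - (X + _)]big1 => [|j _]; last by rewrite qs qt P0.
rewrite -mulr_sumr.
by move: (\sum__ _) (P _ phi) (P _ _) => x y z ?; lra.
Qed.

Lemma graph_waveP u w : graph (ip := ip K) (L := L2 K) Acl (test_vec K) u w <->
  [/\ L2 K u, L2 K w & is_wave c K u w].
Proof. by split=> -[Lu Lw uw]; split=> //; apply/is_waveP. Qed.

Lemma C1_vec_is_wave u : C1_vec u -> is_wave c K u (Acl u).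
Proof.
move=> cu; have pL k i : LK (partial k (component u i)) by exact: C1p.
apply/is_wave_prodint => phi tphi.
have Lphi : LK phi.
  by apply: (continuous_L2fun oK KM); case: tphi => /smooth_Ck1/Ck_continuous.
have ibp i k : P (component u i) (partial k phi) = - P phi (partial k (component u i)).
  by rewrite (integration_by_parts_test oK KM)// prodintC.
split=> [j|]; rewrite prodintC.
  rewrite qcomp_wave (prodint_sub_c _ _ _ Lphi (pL _ _) (pL _ _)).
  by rewrite !ibp opprK mulrN.
rewrite mucomp_wave (prodint_sub_c _ _ _ Lphi (pL _ _)).
  rewrite (prodint_sumr oK KM _ _ phi)//; last by move=> j; exact: pL.
  rewrite ibp opprK -mulrN -sumrN; congr (_ + _ * _).
  by apply: eq_bigr => j _; rewrite ibp.
by apply: L2fun_sum => j; exact: pL.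
Qed.

(* The multiplier [th], affine in time, is chosen to vanish at the end of
   ]0, T[ where [u] does not; its time derivative [b] turns the boundary terms
   of the time integration into [- b |u|^2]. *)
Section energy.
Variables (u : vec) (a b T : R).
Hypothesis cu : C1_vec u.
Let th (z : E) := b * z 0 t_ + a.
Let w : vec := fun z => th z *: u z.

Let C1_affine : Ck (fun _ : unit => (1 : R)) 1 (fun s => b * s + a).
Proof.
have C1_id : Ck (fun _ : unit => (1 : R)) 1 (fun s : R => s).
  refine (CkS _ 0 _ (fun _ => cst 1) _ _ (fun=> Ck_cst _ _ _)).
    by move=> x; exact: cvg_id.
exact: (Ck_affine 1 (fun s => s) b a C1_id).
Qed.

Let C1_th : C1 th.
Proof. exact: (Ck_coord _ _ _ t_ C1_affine). Qed.

Let partial_th k z : partial k th z = (t_ == k)%:R * b.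
Proof.
have dh : is_derive (z 0 t_) 1 (fun s : R => b * s + a) b.
  have := is_deriveD (is_deriveZ b (is_derive_id (z 0 t_) 1)) (is_derive_cst a (z 0 t_) 1).
  by rewrite addr0 [_%:A]mulr1.
by have [_] := is_derive_coord _ _ _ k _ _ dh.
Qed.

Let w_comp i : component w i = th * component u i.
Proof. by apply/funext => z; rewrite /component mxE. Qed.

Let C1_w : C1_vec w.
Proof. by move=> i; rewrite w_comp; exact: CkM. Qed.

Hypothesis t_bdry : forall i z s, ~ K (z + s *: std_basis _ t_) ->
  closure [set r : R | K (z + r *: std_basis _ t_)] s ->
  th (z + s *: std_basis _ t_) * u (z + s *: std_basis _ t_) 0 i = 0.
Hypothesis x_bdry : forall j z s, ~ K (z + s *: std_basis _ (q_ j)) ->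
  closure [set r : R | K (z + r *: std_basis _ (q_ j))] s ->
  mucomp u (z + s *: std_basis _ (q_ j)) = 0.

Let LC f : C1 f -> LK f.
Proof. by move=> /Ck_continuous/(continuous_L2fun oK KM). Qed.

Let P_th f g : P f (th * g) = P (th * f) g.
Proof. by congr fine; apply: eq_integral => z _; rewrite /= mulrCA mulrA. Qed.

Let partial_w k i : partial k (component w i) =
  th * partial k (component u i) + cst ((t_ == k)%:R * b) * component u i.
Proof.
apply/funext => z; rewrite w_comp (partialM _ _ _ _ C1_th (cu i)) partial_th.
by rewrite [component u i z * _]mulrC.
Qed.

Let P_partial_w f k i : LK f -> P f (partial k (component w i)) =
  P (th * f) (partial k (component u i)) + (t_ == k)%:R * b * P f (component u i).
Proof.
move=> Lf; have Lth : LK (th * partial k (component u i)).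
  apply/(continuous_L2fun oK KM)/(Ck_continuous (@std_basis R d.+1) 0).
  by apply: CkM; [exact: Ck_pred C1_th|exact: Ck_derive (cu i)].
rewrite partial_w (prodintDr oK _ _ _ Lf Lth (L2funZ _ _ (LC _ (cu i)))).
by rewrite (prodintZr oK _ _ _ Lf (LC _ (cu i))) P_th.
Qed.

Let energy_t i : 2 * P (component w i) (partial t_ (component u i)) =
  - b * P (component u i) (component u i).
Proof.
have := integral_partialM0 oK KM (component w i) (component u i) t_ (C1_w i) (cu i).
rewrite (P_partial_w _ _ _ (LC _ (cu i))) -w_comp eqxx mul1r.
have H0 z s : ~ K (z + s *: std_basis _ t_) ->
   closure [set r : R | K (z + r *: std_basis _ t_)] s ->
   component w i (z + s *: std_basis _ t_) * component u i (z + s *: std_basis _ t_) = 0.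
  by move=> Kz Uz; rewrite w_comp -[LHS]/(th _ * u _ 0 i * u _ 0 i) t_bdry ?mul0r.
move=> /(_ H0); move: (P _ _) (P _ _) => x y; by lra.
Qed.

(** The multiplier depends on time only, so a spatial integration by parts does not differentiate
    it, and the boundary term vanishes together with [mucomp u]. *)
Let energy_x j : P (component w (q_ j)) (partial (q_ j) (mucomp u)) =
  - P (mucomp w) (partial (q_ j) (qcomp u j)).
Proof.
have E1 : P (qcomp u j) (partial (q_ j) (mucomp w)) =
    P (component w (q_ j)) (partial (q_ j) (mucomp u)).
  rewrite w_comp; apply: (etrans (P_partial_w _ _ _ (LC _ (cu (q_ j))))).
  by rewrite (negbTE (neq_lift _ _)) !mul0r addr0.
have H0 z s : ~ K (z + s *: std_basis _ (q_ j)) ->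
   closure [set r : R | K (z + r *: std_basis _ (q_ j))] s ->
   mucomp w (z + s *: std_basis _ (q_ j)) * qcomp u j (z + s *: std_basis _ (q_ j)) = 0.
  move=> Kz Uz; have -> : mucomp w = th * mucomp u by exact: w_comp.
  rewrite -[LHS]/(th _ * mucomp u _ * qcomp u j _).
  rewrite (x_bdry _ _ _ Kz Uz) mulr0; exact: mul0r.
have := integral_partialM0 oK KM (mucomp w) (qcomp u j) (q_ j) (C1_w t_) (cu (q_ j)) H0.
by rewrite E1 addrC => /eqP; rewrite addr_eq0 => /eqP.
Qed.

Let Lw : L2 K w. Proof. exact: C1_vec_L2. Qed.
Let Lu : L2 K u. Proof. exact: C1_vec_L2. Qed.
Let LAu : L2 K (Acl u). Proof. exact: C1_vec_wave_L2. Qed.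

(** By [energy_x] the spatial terms of the two equations cancel; only the time terms of [energy_t]
    remain. *)
Lemma ip_multiplier_wave : 2 * ip K w (Acl u) = - b * ip K u u.
Proof.
rewrite ip_wave//; under eq_bigr => j _ do rewrite energy_x.
rewrite big_split /= sumrN -mulr_sumr sumrN mulrN opprK.
have -> : - b * ip K u u = 2 * \sum_i P (component w i) (partial t_ (component u i)).
  by rewrite /ip !mulr_sumr; apply: eq_bigr => i _; exact/esym/energy_t.
by rewrite big_qt addrACA subrr addr0.
Qed.

(** Since [b^2 = 1], squaring the identity gives [|u|^4 = 4 (w, Acl u)^2], and Cauchy-Schwarz with
    [|w| <= T |u|] bounds this by [4 T^2 |u|^2 |Acl u|^2]. *)
Lemma energy_estimate : b ^+ 2 = 1 -> (forall z, K z -> `|th z| <= T) ->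
  ip K u u <= 4 * T ^+ 2 * ip K (Acl u) (Acl u).
Proof.
move=> b1 thT; have LI := @L2_semi_inner R d.+1 d.+1 K.
have u0 := ip_ge0 LI _ Lu; have A0 := ip_ge0 LI _ LAu.
have wu : ip K w w <= T ^+ 2 * ip K u u.
  rewrite /ip mulr_sumr; apply: ler_sum => i _.
  have Lui : LK (component u i) by exact: Lu.
  rewrite -(prodintZr oK (T ^+ 2) _ _ Lui Lui); apply: le_Rintegral.
  - exact: open_measurable_rV.
  - by apply: (prodint_integrable oK); exact: Lw.
  - by apply: (prodint_integrable oK) => //; exact: L2funZ.
  move=> z Kz; rewrite w_comp -[leLHS]/(th z * u z 0 i * (th z * u z 0 i)).
  rewrite -[leRHS]/(u z 0 i * (T ^+ 2 * u z 0 i)) [leRHS]mulrCA.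
  rewrite mulrACA -expr2 ler_wpM2r// -?expr2 ?sqr_ge0// -[leLHS]real_normK ?num_real//.
  have zT := thT z Kz; have T0 := le_trans (normr_ge0 _) zT.
  by rewrite lerXn2r ?nnegrE.
have := cauchy_schwarz LI _ _ Lw LAu; have := ip_multiplier_wave.
move: (ip K u u) (ip K w w) (ip K w (Acl u)) (ip K (Acl u) (Acl u)) u0 A0 wu.
move=> x y s z x0 z0 yx sx sy.
have [xN0|/negPn/eqP ->] := boolP (x != 0); last first.
  by apply: mulr_ge0 => //; apply: mulr_ge0 => //; exact: sqr_ge0.
have {}x0 : 0 < x by rewrite lt_neqAle eq_sym xN0.
(* Multiplying by [x], which is [|u|^2], keeps everything polynomial and avoids square roots. *)
rewrite -(ler_pM2l x0).
have -> : x * x = 4 * s ^+ 2.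
  have -> : 4 * s ^+ 2 = (2 * s) ^+ 2 by ring.
  by rewrite sx exprMn sqrrN b1 mul1r expr2.
have := ler_wpM2r z0 yx.
by lra.
Qed.

End energy.

End on_domain.
End classical_wave.

(** * The space-time cylinder and its meshes *)

Section cylinder.
Context {R : realType} {d : nat}.
Variables (Om0 : set 'rV[R]_d) (T : R).
Local Notation E := 'rV[R]_d.+1.
Local Notation Om := (Omega Om0 T).
Local Notation e_ := (@std_basis R d.+1).
Implicit Types (z : E).

Lemma xpart_continuous : continuous (@xpart R d).
Proof.
move=> z A [P nP PA].
exists (fun i k => if unlift ord_max k is Some j then P i j else setT) => [i k|y Py].
  case: (unliftP ord_max k) => [j ->|_]; last exact: filterT.
  by have := nP i j; rewrite mxE ord1.
by apply: PA => i j; have := Py i (lift ord_max j); rewrite liftK mxE ord1.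
Qed.

Lemma open_Omega : open Om0 -> open Om.
Proof.
move=> oOm0.
have -> : Om = @xpart R d @^-1` Om0 `&` (fun z => z 0 ord_max) @^-1` [set s | s \in `]0, T[].
  by apply/seteqP; split=> z; rewrite /Omega /= in_itv.
apply: openI; first by apply: open_comp => // z _; exact: xpart_continuous.
apply: open_comp => [z _|]; first exact: coord_cvg.
exact: interval_open.
Qed.

Lemma mx_norm_coord n (x : 'rV[R]_n) i : `|x 0 i| <= `|x|.
Proof.
rewrite [leRHS]mx_normrE.
exact: (le_bigmax _ (fun ij : 'I_1 * 'I_n => `|x ij.1 ij.2|) (0, i)).
Qed.

Lemma Omega_bounded : bounded_set Om0 -> exists M, Om `<=` cube d.+1 M.
Proof.
move=> bOm0.
have [M [/= MT OM]] : exists M, T <= M /\ forall x, Om0 x -> `|x| <= M.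
  near +oo_R => M; exists M; split.
    by near: M; apply: nbhs_pinfty_ge; rewrite num_real.
  by near: M; exact: bOm0.
exists M => z [/OM zM /andP[z0 zT]].
rewrite cubeE => i; case: (unliftP ord_max i) => [j ->|->].
  by apply: le_trans zM; have := mx_norm_coord _ (xpart z) j; rewrite mxE.
by rewrite -/(tpart z) ger0_norm ?ltW//; exact: lt_le_trans MT.
Unshelve. all: by end_near. Qed.

Lemma xpart_shift_t z s : xpart (z + s *: e_ (tidx d)) = xpart z.
Proof.
apply/rowP => j; rewrite !mxE /tidx.
by rewrite eq_sym (negbTE (neq_lift _ _)) andbF mulr0 addr0.
Qed.

Lemma tpart_shift_t z s : tpart (z + s *: e_ (tidx d)) = tpart z + s.
Proof. by rewrite /tpart !mxE !eqxx mulr1. Qed.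

Lemma tpart_shift_x z s j : tpart (z + s *: e_ (qidx j)) = tpart z.
Proof. by rewrite /tpart !mxE (negbTE (neq_lift _ _)) andbF mulr0 addr0. Qed.

(** A line in the time direction keeps [x] fixed in [Om0], so it can leave the cylinder only through
    the bottom or the top. *)
Lemma Omega_slice_t z s : ~ Om (z + s *: e_ (tidx d)) ->
  closure [set r : R | Om (z + r *: e_ (tidx d))] s ->
  Om0 (xpart z) /\ (tpart z + s = 0 \/ tpart z + s = T).
Proof.
move=> Oz cs; have [r [[]]] := cs setT filterT.
rewrite xpart_shift_t tpart_shift_t => Oxz _ _; split=> //.
have : closure [set r | 0 <= tpart z + r <= T] s.
  apply: closureS cs => r' [_]; rewrite tpart_shift_t /= => /andP[r0 rT].
  by rewrite !ltW.
have <- : [set r | 0 <= tpart z + r <= T] = closure [set r | 0 <= tpart z + r <= T].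
  apply/closure_id.
  have -> : [set r | 0 <= tpart z + r <= T] = (fun r => tpart z + r) @^-1` [set r | r \in `[0, T]].
    by apply/seteqP; split=> r'; rewrite /= in_itv.
  apply: preimage_closed; last exact: interval_closed.
  by move=> r' _; apply: cvgD; [exact: cvg_cst|exact: cvg_id].
move=> /= /andP[]; rewrite le_eqVlt => /predU1P[<-|z0]; first by left.
rewrite le_eqVlt => /predU1P[->|zT]; first by right.
by exfalso; apply: Oz; split; rewrite ?xpart_shift_t// tpart_shift_t z0.
Qed.

(** Here the time stays strictly between 0 and [T], so the line leaves through the lateral boundary;
    continuity of [xpart] carries the closure over to [Om0]. *)
Lemma Omega_slice_x j z s : ~ Om (z + s *: e_ (qidx j)) ->
  closure [set r : R | Om (z + r *: e_ (qidx j))] s ->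
  Gammab Om0 T (z + s *: e_ (qidx j)).
Proof.
move=> Oz cs; have [r [[]]] := cs setT filterT.
rewrite tpart_shift_x => Oxz /andP[z0 zT] _.
split; last by rewrite tpart_shift_x !ltW.
split; last first.
  move=> /interior_subset Ozs; apply: Oz; split=> //.
  by rewrite tpart_shift_x z0.
move=> A nA; have : nbhs s ((fun r => xpart (z + r *: e_ (qidx j))) @^-1` A).
  have cx : {for s, continuous (fun r : R => xpart (z + r *: e_ (qidx j)))}.
    apply: continuous_comp; last exact: xpart_continuous.
    by apply: cvgD; [exact: cvg_cst|apply: cvgZr_tmp; exact: cvg_id].
  exact: cx.
by move=> /cs[r' [[Or' _] Ar']]; exists (xpart (z + r' *: e_ (qidx j))).
Qed.

Lemma smooth_vec_C1 : @smooth_vec R d `<=` C1_vec.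
Proof. by move=> u su i; have [/smooth_Ck1] := su i. Qed.

Section energy.
Variables (c M : R).
Hypotheses (oOm : open Om) (OmM : Om `<=` cube d.+1 M).
Local Notation est u := (ip Om u u <=
  4 * T ^+ 2 * ip Om (classical_wave c u) (classical_wave c u)).

Lemma calV_energy u : calV Om0 T u -> est u.
Proof.
move=> [su u0 ub]; apply: (energy_estimate c oOm OmM u T (-1) T).
- exact: smooth_vec_C1.
- move=> i z s Oz /(Omega_slice_t _ _ Oz)[Oxz Ez] /=.
  have [tz|tz] := Ez; last first.
    rewrite -[_ 0 _]/(tpart _) tpart_shift_t tz mulN1r addNr; exact: mul0r.
  by rewrite (u0 (z + _)) ?mxE ?mulr0//; split; rewrite ?xpart_shift_t ?tpart_shift_t.
- by move=> j z s Oz /(Omega_slice_x _ _ _ Oz); exact: ub.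
- by rewrite sqrrN expr1n.
- move=> z [_ /andP[z0 zT]] /=; rewrite -/(tpart z) mulN1r addrC.
  by rewrite ger0_norm ?subr_ge0 ?(ltW zT)// gerBl ltW.
Qed.

Lemma calVstar_energy u : calVstar Om0 T u -> est u.
Proof.
move=> [su u0 ub]; apply: (energy_estimate c oOm OmM u 0 1 T).
- exact: smooth_vec_C1.
- move=> i z s Oz /(Omega_slice_t _ _ Oz)[Oxz Ez] /=.
  have [tz|tz] := Ez.
    rewrite -[_ 0 _]/(tpart _) tpart_shift_t tz mul1r addr0; exact: mul0r.
  by rewrite (u0 (z + _)) ?mxE ?mulr0//; split; rewrite ?xpart_shift_t ?tpart_shift_t.
- by move=> j z s Oz /(Omega_slice_x _ _ _ Oz); exact: ub.
- by rewrite expr1n.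
- move=> z [_ /andP[z0 zT]] /=; rewrite -/(tpart z) mul1r addr0.
  by rewrite ger0_norm ltW.
Qed.

End energy.

End cylinder.

(** * Broken test vectors and the concrete spaces as weak domains *)

Section mesh.
Context {R : realType} {d : nat} {Om0 : set 'rV[R]_d} {T c M : R}.
Variable Oh : set (set 'rV[R]_d.+1).
Local Notation E := 'rV[R]_d.+1.
Local Notation vec := (E -> 'rV[R]_d.+1).
Local Notation Om := (Omega Om0 T).
Local Notation mu := (leb R d.+1).
Hypotheses (oOm : open Om) (OmM : Om `<=` cube d.+1 M) (mesh : is_mesh Om0 T Oh).
Local Notation Acl := (classical_wave c).

Definition broken_test_vec : set vec := [set psi | exists2 K, Oh K & test_vec K psi].

Let oK K : Oh K -> open K.
Proof. by case: mesh => _ _ + _ => /[apply] -[]. Qed.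

Let KOm K : Oh K -> K `<=` Om.
Proof. by case: mesh => _ _ + _ => /[apply] -[]. Qed.

Let KM K : Oh K -> K `<=` cube d.+1 M.
Proof. by move=> /KOm KO z /KO; exact: OmM. Qed.

Lemma test_vec_sub K Om' : K `<=` Om' -> @test_vec R d K `<=` test_vec Om'.
Proof.
by move=> KO psi tpsi i; have [? ? sK] := tpsi i; split=> //; exact: subset_trans KO.
Qed.

Lemma broken_test_vec_sub : broken_test_vec `<=` test_vec Om.
Proof. by move=> psi [K /KOm KO]; exact: test_vec_sub. Qed.

Lemma broken_test_vec_total :
  total (L := L2 Om) (ip := ip Om) broken_test_vec.
Proof.
move=> f Lf f0.
have L0 : L2 Om (0 : vec) by case: (@L2_subspace R d.+1 d.+1 Om).
suff : eqL2 Om f 0 by rewrite (eqL2P _ _ Lf L0) subr0.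
pose N K i := [set z | ~ (K z -> (component f i \_ K) z = 0)].
have negN K i : Oh K -> mu.-negligible (N K i).
  move=> OhK; have LK := L2_sub _ _ _ (open_measurable_rV _ (oK _ OhK)) (KOm _ OhK) Lf.
  apply: fundamental_lemma => [||phi tphi]; [exact: oK|exact: LK|].
  have := f0 _ (ex_intro2 _ _ K OhK (single_test_vec i phi tphi)).
  rewrite -(ip_sub K Om _ _ (KOm _ OhK)); last first.
    by move=> z; exact: test_vec_out (single_test_vec i phi tphi).
  rewrite /ip (bigD1 i)//= big1 => [|k ki].
    rewrite addr0 component_single eqxx => <-.
    by apply: eq_Rintegral => z zK; rewrite patchE zK.
  by rewrite component_single (negbTE ki); exact: prodint0.
have [finOh _ KP cOm] := mesh.
have neg : mu.-negligible (\bigcup_(K in Oh) (boundary K `|` \bigcup_(i in setT) N K i)).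
  apply: finite_bigcup_negligible => // K OhK; have [oK' _ _ lK] := KP _ OhK.
  apply: negligibleU; first exact: boundary_negligible.
  by apply: countable_bigcup_negligible => i _; exact: negN.
(* A point of [Om] lies in the closure of some element, hence in the element, where the fundamental
   lemma applies, or on its boundary. *)
apply: negligibleS neg => z /= /not_implyP[Oz fz].
have : closure Om z by exact: subset_closure.
rewrite cOm => -[K OhK cKz]; exists K => //.
have [Kz|Kz] := pselect (K z); last first.
  by left; split=> // /interior_subset.
right; apply: contrapT => Nz; apply: fz; apply/rowP => i; rewrite mxE.
apply: contrapT => fiz; apply: Nz; exists i => // H; apply: fiz.
by have := H Kz; rewrite patchE mem_set.
Qed.

(** A test vector supported in [K] gives the same pairing over [K] and over [Om], so the elementwise
    equations become a single weak equation on [Om] with fewer test vectors. *)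
Lemma graph_broken_waveP u w : graph (L := L2 Om) (ip := ip Om) Acl broken_test_vec u w <->
  [/\ L2 Om u, L2 Om w & is_wave_h c Oh u w].
Proof.
have LKu K (v : vec) : Oh K -> L2 Om v -> L2 K v.
  by move=> OhK; exact: L2_sub (open_measurable_rV _ (oK _ OhK)) (KOm _ OhK).
split=> -[Lu Lw H]; split=> //.
  move=> K OhK; apply/(is_waveP c (oK _ OhK) (KM _ OhK)) => [||psi tpsi]; try exact: LKu.
  rewrite (ip_sub K Om _ _ (KOm _ OhK)); last by move=> z; exact: wave_test_vec_out tpsi.
  rewrite (ip_sub K Om _ _ (KOm _ OhK)); last by move=> z; exact: test_vec_out tpsi.
  by apply: H; exists K.
move=> psi [K OhK tpsi]; have := H K OhK => /(is_waveP c (oK _ OhK) (KM _ OhK)).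
move=> /(_ (LKu _ _ OhK Lu) (LKu _ _ OhK Lw) _ tpsi).
rewrite (ip_sub K Om _ _ (KOm _ OhK)); last by move=> z; exact: wave_test_vec_out tpsi.
by rewrite (ip_sub K Om _ _ (KOm _ OhK)); last by move=> z; exact: test_vec_out tpsi.
Qed.

Lemma Wspace_domain : Wspace c Om = domain (L := L2 Om) (ip := ip Om) Acl (test_vec Om).
Proof.
apply/seteqP; split=> [u [Lu [f Lf uf]]|u [f /(graph_waveP c oOm OmM)[Lu Lf uf]]].
  by exists f; apply/(graph_waveP c oOm OmM).
by split=> //; exists f.
Qed.

Lemma Wh_domain : Wh Om0 T c Oh = domain (L := L2 Om) (ip := ip Om) Acl broken_test_vec.
Proof.
apply/seteqP; split=> [u [Lu [f Lf uf]]|u [f /graph_broken_waveP[Lu Lf uf]]].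
  by exists f; apply/graph_broken_waveP.
by split=> //; exists f.
Qed.

Lemma Aop_graph u : Wspace c Om u ->
  graph (L := L2 Om) (ip := ip Om) Acl (test_vec Om) u (Aop c Om u).
Proof.
move=> [Lu [f Lf uf]]; apply/(graph_waveP c oOm OmM).
have [] : [set f | L2 Om f /\ is_wave c Om u f] (Aop c Om u) by apply: xgetPex; exists f.
by split.
Qed.

Lemma Ah_graph u : Wh Om0 T c Oh u ->
  graph (L := L2 Om) (ip := ip Om) Acl broken_test_vec u (Ah Om0 T c Oh u).
Proof.
move=> [Lu [f Lf uf]]; apply/graph_broken_waveP.
have [] : [set f | L2 Om f /\ is_wave_h c Oh u f] (Ah Om0 T c Oh u) by apply: xgetPex; exists f.
by split.
Qed.

End mesh.

Theorem theorem3p1 (R : realType) (d : nat) (Om0 : set 'rV[R]_d) (T c : R)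
    (Oh : set (set 'rV[R]_d.+1)) :
  let Om := Omega Om0 T in
  let nW := normW c Om in
  let VV := Vspace Om0 T c in
  let VVstar := Vstar Om0 T c in
  let X := Wh Om0 T c Oh in
  let nX := normWh Om0 T c Oh in
  (0 < d)%N ->
  Om0 !=set0 -> open Om0 -> connected Om0 -> bounded_set Om0 ->
  lipschitz_boundary Om0 ->
  0 < T -> 0 < c ->
  is_mesh Om0 T Oh ->
  dense_in (calV Om0 T) VV nW ->
  dense_in (calVstar Om0 T) VVstar nW ->
  [/\ VV = right_annihilator (Wspace c Om) (Dop c Om @` VVstar),
      [/\ forall u, VV u -> L2 Om (Aop c Om u),
          forall u v, VV u -> VV v ->
            eqL2 Om (Aop c Om u) (Aop c Om v) -> eqL2 Om u v &
          forall f, L2 Om f -> exists2 u, VV u & eqL2 Om (Aop c Om u) f] &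
      (forall F, dual X nX F ->
         exists u lam, solution Om0 T c Oh F u lam /\
           forall u' lam', solution Om0 T c Oh F u' lam' ->
             eqL2 Om u' u /\ eq_dual X lam' lam) /\
      exists C, forall F u lam, dual X nX F -> solution Om0 T c Oh F u lam ->
        normL2 Om u + normQ Om0 T c Oh lam <= C * dual_norm X nX F].
Proof.
move=> Om nW VV VVstar X nX _ _ oOm0 _ bOm0 _ _ _ mesh dV dVs.
have oOm : open Om by exact: open_Omega.
have [M OmM] : exists M, Om `<=` cube d.+1 M by exact: Omega_bounded.
pose L := @L2 R d.+1 d.+1 Om; pose S := @test_vec R d Om.
pose Sh := broken_test_vec Oh; pose Acl := @classical_wave R d c.
pose dom := domain (L := L) (ip := ip Om) Acl.
pose gr := graph (L := L) (ip := ip Om) Acl.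
pose sq := sqn (ip := @ip R d.+1 d.+1 Om).
pose tot := total (L := L) (ip := ip Om).
pose A := Aop c Om; pose A_h := Ah Om0 T c Oh.
have LI : semi_inner L (ip Om) by exact: L2_semi_inner.
have LC : complete_in L (ip Om).
  by apply: L2_complete; exact: open_measurable_rV.
have WE : Wspace c Om = dom S by exact: Wspace_domain oOm OmM.
have XE : X = dom Sh by exact: (Wh_domain _ OmM mesh).
have SC1 : S `<=` C1_vec by exact: test_vec_C1.
have C1L u : C1_vec u -> L u by exact: C1_vec_L2 oOm OmM _.
have C1gr u : C1_vec u -> gr S u (Acl u).
  move=> cu; apply/(graph_waveP c oOm OmM); split; first exact: C1L.
    exact: C1_vec_wave_L2 oOm OmM _ cu.
  exact: C1_vec_is_wave oOm OmM _ cu.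
have AE u : dom S u -> gr S u (A u).
  by rewrite -WE; exact: Aop_graph oOm OmM _.
have AhE u : dom Sh u -> gr Sh u (A_h u).
  by rewrite -XE; exact: (Ah_graph _ OmM mesh).
have ShS : Sh `<=` S by exact: (broken_test_vec_sub _ mesh).
have totSh : tot Sh by exact: (broken_test_vec_total _ mesh).
have SL : S `<=` L by move=> psi /SC1/C1L.
have AclL psi : S psi -> L (Acl psi) by move=> /SC1/C1gr[].
have AclE psi : S psi -> gr S psi (Acl psi) by move=> /SC1/C1gr.
have totS : tot S.
  by move=> f Lf fS; apply: totSh => // psi /ShS; exact: fS.
have C0 : 0 <= 4 * T ^+ 2 by apply: mulr_ge0 => //; exact: sqr_ge0.
(* The energy estimate concerns the pointwise operator, while density and coercivity use the chosen
   representative; on [C1] vectors they have equal norm. *)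
have AclA u : C1_vec u -> dom S u /\ sq (Acl u) = sq (A u).
  move=> /C1gr gu; have uD : dom S u by exists (Acl u).
  split=> //; have [_ LAu _] := gu; have [_ LAu' _] := AE _ uD.
  apply/esym/(ip_eqq LI) => //.
  exact: (graph_domain LI SL totS AE).
have CVE v : calV Om0 T v -> dom S v /\ sq v <= 4 * T ^+ 2 * sq (A v).
  move=> Vv; have sv : smooth_vec v by case: Vv.
  have [vD <-] := AclA _ (smooth_vec_C1 _ sv); split=> //.
  exact: calV_energy oOm OmM _ Vv.
have CVsE v : calVstar Om0 T v -> dom S v /\ sq v <= 4 * T ^+ 2 * sq (A v).
  move=> Vv; have sv : smooth_vec v by case: Vv.
  have [vD <-] := AclA _ (smooth_vec_C1 _ sv); split=> //.
  exact: calVstar_energy oOm OmM _ Vv.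
(* Once [Wspace] is rewritten as a weak domain, the concrete spaces are instances of the abstract
   ones by unfolding. *)
have VE : VV = bdry_domain (L := L) (ip := ip Om) (Acl := Acl) (S := S) (A := A) (CVs := calVstar Om0 T).
  by rewrite /bdry_domain -[domain Acl S]/(dom S) -WE.
have VsE : VVstar = adjoint_domain (L := L) (ip := ip Om) (Acl := Acl) (S := S) (A := A) (CVs := calVstar Om0 T).
  by rewrite /adjoint_domain -VE.
have eqL u v : L u -> L v -> eqL2 Om u v <-> sq (u - v) = 0.
  exact: eqL2P.
have VL u : VV u -> L u by case=> -[].
have AL u : VV u -> L (A u).
  by move=> [Wu _]; have /AE[] : dom S u by rewrite -WE.
split.
- rewrite WE VsE VE.
  exact: (bdry_domain_annihilator LI SL AclL ShS totSh AclE AE CVsE).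
- split=> [u|u v Vu Vv /(eqL _ _ (AL _ Vu) (AL _ Vv)) uv|f Lf]; first exact: AL.
    apply/eqL; [exact: VL|exact: VL|].
    move: Vu Vv dV uv; rewrite VE => Vu Vv dV'.
    exact: (bdry_domain_inj LI SL AclL ShS totSh AclE AE C0 CVE CVsE dV').
  have := dVs; rewrite VsE => dVs'.
  have [u] := bdry_domain_surj LI LC SL AclL ShS totSh AclE AE C0 CVsE dVs' _ Lf.
  by rewrite -VE => Vu uf; exists u => //; apply/eqL => //; exact: AL.
have := dVs; rewrite VsE => dVs'; have := dV; rewrite VE => dV'.
have solE F u lam : solution Om0 T c Oh F u lam <->
  broken_solution (L := L) (ip := ip Om) (Acl := Acl) (S := S) (Sh := Sh)
    (A := A) (Ah := A_h) (CVs := calVstar Om0 T) F u lam.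
  by rewrite /solution /broken_solution /Qspace /trace_space -/VV VE -/X XE.
have [ex [K bd]] := broken_well_posed LI LC SL AclL ShS totSh AclE AE AhE C0 CVE CVsE dV' dVs'.
split=> [F|].
  rewrite XE => /ex[u [lam [sol uni]]]; exists u, lam; split; first exact/solE.
  move=> u' lam' sol'; have [uu ll] := uni _ _ ((solE _ _ _).1 sol'); split=> //.
  by apply/eqL => //; [case: sol'|case: sol].
exists K => F u lam; rewrite XE => dF /solE sol; have := bd _ _ _ dF sol.
by rewrite /normQ /trace_norm -/VV VE -/X XE.
Qed.
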